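(* Let $q\ge 2$. Then the operator $f\mapsto g_{\mathbb{W}}^q(f)$ is bounded from $L^p(\mathbb{R})$ into itself for every $1<p<\infty$, and from $L^1(\mathbb{R})$ into $L^{1,\infty}(\mathbb{R})$; here $g_{\mathbb{W}}^q$ is the area Littlewood-Paley function associated with the heat semigroup $\mathbb{W}=\{W_t\}_{t>0}$ of the Hermite operator $\mathcal{H}=\frac12\left(-\frac{d^2}{dx^2}+x^2\right)$.
   Context: All Lebesgue spaces are with respect to Lebesgue measure, and $L^{1,\infty}$ is weak $L^1$. The Hermite functions are $h_n(x)=\left(\sqrt{\pi}\,2^n n!\right)^{-1/2}H_n(x)e^{-x^2/2}$, $x\in\mathbb{R}$, $n\in\mathbb{N}=\{0,1,2,\dots\}$, with $H_n$ the Hermite polynomial of degree $n$; they form a complete orthonormal system in $L^2(\mathbb{R})$ and $\mathcal{H}h_n=(n+\frac12)h_n$. The heat semigroup is $W_tf=\sum_{n=0}^\infty e^{-(n+1/2)t}\left(\int_{\mathbb{R}}h_n f\,dx\right)h_n$ for $f\in L^2(\mathbb{R})$, and equivalently, and also for $f\in L^p(\mathbb{R})$, $1\le p<\infty$, $$W_tf(x)=\int_{-\infty}^{+\infty}W_t(x,y)f(y)\,dy,$$ $$W_t(x,y)=\frac{1}{\sqrt{\pi}}\left(\frac{e^{-t}}{1-e^{-2t}}\right)^{1/2}\exp\left(-\frac{(x-e^{-t}y)^2+(y-e^{-t}x)^2}{2(1-e^{-2t})}\right),\quad x,y\in\mathbb{R},\ t>0.$$ For $q>1$, the area $g$-function is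 $$g_{\mathbb{W}}^q(f)(x)=\left\{\int_{\Gamma(x)}\left|\left(s\frac{\partial}{\partial s}W_s(f)(y)\right)_{|s=t^2}\right|^q\frac{dt\,dy}{t^2}\right\}^{1/q},\quad x\in\mathbb{R},$$ where $\Gamma(x)=\{(y,t)\in\mathbb{R}\times(0,\infty):|x-y|<t\}$. The operator $g_{\mathbb{W}}^q$ is sublinear; bounded from $X$ into $Y$ means that there is $C>0$ with $\|g_{\mathbb{W}}^q(f)\|_Y\le C\|f\|_X$ for all $f\in X$. *)

(* Defs.v *)
From mathcomp Require Export all_boot all_order all_algebra.
From mathcomp Require Export all_classical all_reals all_analysis.
From mathcomp Require Export measurable_realfun complex.

Set Implicit Arguments.
Unset Strict Implicit.
Unset Printing Implicit Defensive.

Import Order.TTheory GRing.Theory Num.Theory.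
Import numFieldNormedType.Exports.

Local Open Scope classical_set_scope.
Local Open Scope ring_scope.

(* R[i] carries no topology over R nor a measurable structure in the library,
   so integrals, derivatives and measurability of complex-valued functions are
   taken componentwise. *)

Section complex_valued.
Context {R : realType}.
Let mu := @lebesgue_measure R.

(* the modulus, with values in R rather than in R[i] *)
Definition cmod (z : R[i]) : R := ComplexField.Normc.normc z.

Definition cintegral (f : R -> R[i]) : R[i] :=
  Complex (\int[mu]_y complex.Re (f y)) (\int[mu]_y complex.Im (f y)).

Definition cderive1 (f : R -> R[i]) (s : R) : R[i] :=
  Complex (derive1 (fun r => complex.Re (f r)) s)
          (derive1 (fun r => complex.Im (f r)) s).

Definition cLnorm (p : R) (f : R -> R[i]) : \bar R :=
  Lnorm mu p%:E (fun x => (cmod (f x))%:E).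

(* f is a representative of a class in L^p(R; C). Measurability is Borel, the
   sigma-algebra on which lebesgue_measure is defined; every class of Lebesgue
   measurable functions has a Borel representative. *)
Definition inLp (p : R) (f : R -> R[i]) : Prop :=
  [/\ measurable_fun setT (fun x => complex.Re (f x)),
      measurable_fun setT (fun x => complex.Im (f x))
    & (cLnorm p f < +oo)%E].

Definition weakL1norm (g : R -> \bar R) : \bar R :=
  ereal_sup [set (l%:E * mu [set x | (l%:E < `|g x|)%E])%E
            | l in [set l : R | 0 < l]].

End complex_valued.

Section hermite_area_function.
Context {R : realType}.
Let mu := @lebesgue_measure R.

(* Mehler kernel of exp(-tH), where H = (-d^2/dx^2 + x^2)/2 *)
Definition mehler (t x y : R) : R :=
  (Num.sqrt pi)^-1 * Num.sqrt (expR (- t) / (1 - expR (- (2 * t)))) *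
  expR (- (((x - expR (- t) * y) ^+ 2 + (y - expR (- t) * x) ^+ 2) /
           (2 * (1 - expR (- (2 * t)))))).

Definition hermite_heat (t : R) (f : R -> R[i]) (x : R) : R[i] :=
  cintegral (fun y => (mehler t x y)%:C%C * f y).

Definition area_cone (x : R) : set (R * R) :=
  [set yt | 0 < yt.2 /\ `|x - yt.1| < yt.2].

(* sds = s d/ds, i.e. s * (d/ds) W_s f (y) *)
Definition hermite_heat_sds (f : R -> R[i]) (s y : R) : R[i] :=
  s%:C%C * cderive1 (fun r => hermite_heat r f y) s.

Definition area_g (q : R) (f : R -> R[i]) (x : R) : \bar R :=
  ((\int[(mu \x mu)%E]_(yt in area_cone x)
      (cmod (hermite_heat_sds f (yt.2 ^+ 2) yt.1) `^ q / yt.2 ^+ 2)%:E)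
    `^ q^-1)%E.

End hermite_area_function.

(* Main.v *)
Require Import Defs.
From mathcomp Require Import ring lra.

(** The only facts about the Hermite semigroup that enter are two estimates of
    the kernel K_s = s dW_s/ds,
      |K_s(y, z)|    <= C sqrt s / (s + (y - z)^2)        ([sdmehler_size]),
      |d_z K_s(y, z)| <= C s / (s + (y - z)^2)^2   ([sdmehler_derive_size]),
    read off the Mehler formula, and the L^2 structure of W: it is a symmetric
    semigroup of contractions ([mehler_semigroup], [heat_contraction_ip]).
    Write F(t, y) for the value of s d/ds W_s f(y) at s = t^2 ([sdheat]).

    Reduction to q = 2. At a point (y, t) of the cone over x the size estimate
    dominates F by Poisson averages of |f|, hence |F(t, y)| <= C Mf(x), with M
    the Hardy-Littlewood maximal operator ([sdheat_le_HL]). Therefore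
    |F|^q <= (C Mf(x))^(q - 2) F^2 on the cone, and the area function at x is
    at most C Mf(x) or at most the square root of the integral of
    F^2 dt dy / t^2 over the cone, called [area2] below ([area_g_le]). Since M
    is bounded on L^p and of weak type (1, 1), and since real and imaginary
    parts can be treated separately, it remains to bound [area2] for real f.

    Square integrable f. Instead of expanding in Hermite functions, let
    N(e) = ||W_e f||^2. If h < e then
      ||(W_e - W_(e-h)) f||^2 <= N(e - h) - N(e)           ([incr_energy]),
      4 ||(W_e - W_(e-h)) f||^2 <= ||(W_e - W_(e-2h)) f||^2 ([incr_doubling]),
    because W_h is self-adjoint with 0 <= W_h <= 1. Iterating the second inequality and
    passing to the limit turns the first one into
    h^2 ||d/de W_e f||^2 <= N(e - h) - N(e) ([dheat_energy]), which telescopes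
    over dyadic values of e ([slice_total]); Tonelli's theorem on the cones
    then gives the L^2 bound [area2_L2].

    Weak type (1, 1). This is a Calderon-Zygmund decomposition along the
    components of the open set where Mf > l: the good part is handled by the
    L^2 bound, the bad part by its cancellation and the smoothness estimate
    ([area2_bad], [area2_weak]).

    All p > 1. Interpolating between the two previous bounds would only give
    1 < p <= 2, so L^p bounds are deduced from a good-lambda inequality between
    [area2] and (Mf)^2 ([good_lambda]): on a component of the open set
    where [area2] > l, comparing the cone over x with the cone over an end
    point leaves only the part of f near the component, to which the weak type
    estimate applies ([component_measure]). Summing over geometric levels
    yields the bound [area2_strong] by the maximal function, which is bounded
    on L^p. *)

Set Implicit Arguments.
Unset Strict Implicit.
Unset Printing Implicit Defensive.
Import Order.TTheory GRing.Theory Num.Theory.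
Import numFieldNormedType.Exports.
Local Open Scope classical_set_scope.
Local Open Scope ring_scope.

(** * Integrals and series with values in the extended half line *)

Section nonneg_integral.
Context d (T : measurableType d) (R : realType) (m : {measure set T -> \bar R}).
Local Open Scope ereal_scope.

(** The integral of a nonnegative function is a supremum over the simple
    functions below it, so the comparison holds for arbitrary functions. *)
Lemma le_int0 (D : set T) (f g : T -> \bar R) :
  (forall x, D x -> 0 <= f x) -> (forall x, D x -> f x <= g x) ->
  \int[m]_(x in D) f x <= \int[m]_(x in D) g x.
Proof.
move=> f0 fg.
have g0 x : D x -> 0 <= g x by move=> Dx; exact: le_trans (f0 x Dx) (fg x Dx).
rewrite (ge0_integralE _ f0) (ge0_integralE _ g0).
apply: le_ereal_sup => _ [h /= hf <-]; exists h => // x.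
apply: le_trans (hf x) _; rewrite !patchE; case: ifPn => // /set_mem; exact: fg.
Qed.

Lemma le_int0_set (D E : set T) (f : T -> \bar R) :
  D `<=` E -> (forall x, E x -> 0 <= f x) ->
  \int[m]_(x in D) f x <= \int[m]_(x in E) f x.
Proof.
move=> DE f0; rewrite [leLHS]integral_mkcond [leRHS]integral_mkcond.
apply: le_int0 => x _; rewrite !patchE; case: ifPn => //.
- by move=> /set_mem/DE/f0.
- by move=> /set_mem Dx; rewrite ifT ?inE//; exact: DE.
- by move=> _; case: ifPn => // /set_mem/f0.
Qed.

Lemma ge0_markov (f : T -> \bar R) (c : R) : (forall x, 0 <= f x) -> (0 < c)%R ->
  measurable [set x | c%:E < f x] ->
  m [set x | c%:E < f x] <= c^-1%:E * \int[m]_x f x.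
Proof.
move=> f0 c0 mA; set A := [set x | _] in mA *.
rewrite -(@lee_pmul2l _ c%:E)//= muleA -EFinM divff ?gt_eqF// mul1e.
rewrite -integral_cst// (le_trans _ (@le_int0_set A setT f _ _))//.
by apply: le_int0 => x; rewrite /A/= ?lee_fin => /ltW// _; exact: ltW.
Qed.

Lemma Rint_le (D : set T) (f : T -> R) (g : T -> \bar R) (c : R) :
  measurable D -> measurable_fun D f ->
  (forall x, D x -> `|f x|%:E <= g x) ->
  \int[m]_(x in D) g x <= c%:E -> (`|\int[m]_(x in D) f x| <= c)%R.
Proof.
move=> mD mf fg gc.
have fi : m.-integrable D (EFin \o f).
  apply/integrableP; split; first exact/measurable_EFinP.
  by apply: le_lt_trans (ltry c); apply: le_trans gc; apply: le_int0.
apply: (le_trans (le_normr_Rintegral _ fi)) => //.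
rewrite -lee_fin /Rintegral fineK.
  by apply: le_trans gc; apply: le_int0 => x Dx; [rewrite lee_fin|exact: fg].
have /integrableP[_ h] := fi.
by rewrite ge0_fin_numE// integral_ge0.
Qed.

End nonneg_integral.

Section ereal_series.
Context {R : realType}.
Local Open Scope ereal_scope.
Implicit Types (u : nat -> \bar R) (c : nat -> R).

Lemma nneseries_le u (B : \bar R) : (forall k, 0 <= u k) ->
  (forall n, \sum_(0 <= k < n) u k <= B) -> \sum_(0 <= k <oo) u k <= B.
Proof.
by move=> u0 uB; apply: lime_le; [exact: is_cvg_nneseries|exact: nearW].
Qed.

Lemma nneseries_ge_term u k : (forall k, 0 <= u k) ->
  u k <= \sum_(0 <= k <oo) u k.
Proof.
move=> u0; apply: le_trans (nneseries_lim_ge k.+1 _); last by [].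
by rewrite big_nat_recr//= leeDr// sume_ge0.
Qed.

Lemma nneseriesMr_le c (B : R) (x : \bar R) : (forall k, 0 <= c k)%R ->
  (forall n, \sum_(0 <= k < n) c k <= B)%R -> 0 <= x ->
  \sum_(0 <= k <oo) (c k)%:E * x <= B%:E * x.
Proof.
move=> c0 cB x0; apply: nneseries_le => [k|n]; first by rewrite mule_ge0// lee_fin.
rewrite -ge0_sume_distrl => [|k _]; last by rewrite lee_fin.
by rewrite lee_wpmul2r// sumEFin lee_fin.
Qed.

Lemma sum_geometric_le (r : R) n : (0 < r)%R -> (r < 1)%R ->
  (\sum_(0 <= k < n) r ^+ k <= (1 - r)^-1)%R.
Proof.
move=> r0 r1; have := @geometric_le_lim R n 1 r ler01 r0.
by rewrite (ger0_norm (ltW r0)) => /(_ r1); rewrite mul1r -exprn_geometric.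
Qed.

End ereal_series.

(** * Poisson averages and the maximal function *)

Section maximal.
Context {R : realType}.
Local Notation mu := (@lebesgue_measure R).
Implicit Types (f g : R -> R) (x z r t : R).
Local Open Scope ereal_scope.
Local Notation loc := (locally_integrable [set: R]).

Lemma HL_ball f x r : loc f -> (0 < r)%R ->
  \int[mu]_(z in ball x r) `|f z|%:E <= (2 * r)%:E * HL_maximal f x.
Proof.
move=> lf r0.
have : iavg f (ball x r) <= HL_maximal f x.
  by apply: ereal_sup_ubound; exists r => //; rewrite /= in_itv/= r0.
rewrite /iavg (lebesgue_measure_ball _ (ltW r0)) inver mulrn_eq0/= gt_eqF//.
set I := (X in _ * X <= _) => h.
by rewrite mulr_natl -lee_pdivrMl// mulrn_wgt0.
Qed.

(** The Poisson kernel at height t is dominated by a sum of normalized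
    indicators of the balls of radius 2^k t, with geometrically decaying
    weights; here k is the index of the first of these balls that contains the
    point at distance d. *)
Lemma poisson_dyadic (t d : R) : (0 < t)%R -> (0 <= d)%R -> exists k : nat,
  (d < 2 ^+ k * t)%R /\ (t / (t ^+ 2 + d ^+ 2) <= 4 * t^-1 * (4^-1) ^+ k)%R.
Proof.
move=> t0 d0.
have [k0 hk0] : exists k : nat, (d < 2 ^+ k * t)%R.
  exists (Num.bound (d / t)); rewrite -ltr_pdivrMr//.
  apply: lt_le_trans (archi_boundP (divr_ge0 d0 (ltW t0))) _.
  by rewrite -natrX ler_nat ltnW// (leq_trans _ (ltn_expl _ _)).
(* The minimality of k gives the lower bound on d. *)
have {k0 hk0} [k hk kmin] := ex_minnP (ex_intro (fun k : nat => (d < 2 ^+ k * t)%R) k0 hk0).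
exists k; split => //; case: k hk kmin => [|k] hk kmin.
  rewrite expr0 mulr1 ler_pdivrMr; last by nra.
  have -> : (4 * t^-1 * (t ^+ 2 + d ^+ 2) = 4 * t + 4 * t^-1 * d ^+ 2)%R.
    by field; rewrite gt_eqF.
  have : (0 <= 4 * t^-1 * d ^+ 2)%R by rewrite !mulr_ge0 ?invr_ge0 ?(ltW t0)// sqr_ge0.
  by move: t0 => /[swap]; lra.
have hd : (2 ^+ k * t <= d)%R.
  by rewrite leNgt; apply/negP => /kmin; rewrite ltnn.
rewrite ler_pdivrMr; last by nra.
have -> : (4 * t^-1 * (4^-1) ^+ k.+1 * (t ^+ 2 + d ^+ 2) =
  t * (4^-1) ^+ k + (t^-1 * (4^-1) ^+ k) * d ^+ 2)%R.
  by rewrite exprS; field; rewrite gt_eqF.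
have h2 : (4 ^+ k * t ^+ 2 <= d ^+ 2)%R.
  have -> : (4 ^+ k * t ^+ 2 = (2 ^+ k * t) ^+ 2)%R.
    have -> : (4 = 2 ^+ 2 :> R)%R by ring.
    by rewrite [in RHS]exprMn -!exprM mulnC.
  by rewrite ler_sqr ?nnegrE// mulr_ge0 ?exprn_ge0 ?ltW.
have : (t <= t^-1 * 4^-1 ^+ k * d ^+ 2)%R.
  apply: le_trans (_ : t^-1 * 4^-1 ^+ k * (4 ^+ k * t ^+ 2) <= _)%R; last first.
    by rewrite ler_wpM2l// mulr_ge0 ?invr_ge0 ?exprn_ge0 ?ltW.
  have -> : (t^-1 * 4^-1 ^+ k * (4 ^+ k * t ^+ 2) = (t^-1 * t) * t * (4^-1 ^+ k * 4 ^+ k))%R by ring.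
  rewrite mulVf ?gt_eqF// mul1r -exprMn mulVf ?pnatr_eq0// expr1n mulr1//.
have : (0 <= t * 4^-1 ^+ k)%R by rewrite mulr_ge0 ?exprn_ge0 ?ltW.
lra.
Qed.

(** Each ball of the dyadic decomposition of [poisson_dyadic] contributes its
    average, hence at most the maximal function, with a summable weight. *)
Lemma HL_poisson f x t : loc f -> (0 < t)%R ->
  \int[mu]_z (t / (t ^+ 2 + (x - z) ^+ 2) * `|f z|)%:E <= 16%:E * HL_maximal f x.
Proof.
move=> lf t0; have mf : measurable_fun setT f by case: lf.
have mabs : measurable_fun setT (fun z => `|f z|%:E).
  exact/measurable_EFinP/measurableT_comp.
pose c k : R := (4 * t^-1 * (4^-1) ^+ k)%R.
have c0 k : (0 <= c k)%R by rewrite /c !mulr_ge0 ?invr_ge0 ?exprn_ge0 ?ltW.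
pose b k := (2 ^+ k * t)%R.
have b0 k : (0 < b k)%R by rewrite mulr_gt0// exprn_gt0.
pose u k z := (c k)%:E * ((fun z => `|f z|%:E) \_ (ball x (b k))) z.
have p0 k z : 0 <= ((fun z => `|f z|%:E) \_ (ball x (b k))) z.
  by rewrite patchE; case: ifPn => // _; rewrite lee_fin.
have u0 k z : 0 <= u k z by rewrite mule_ge0 ?lee_fin.
have mp k : measurable_fun setT ((fun z => `|f z|%:E) \_ (ball x (b k))).
  apply/(measurable_restrictT _ (measurable_ball _ _)).
  exact: measurable_funTS.
have mu_ k : measurable_fun setT (u k) by exact: measurable_funeM.
apply: (@le_trans _ _ (\int[mu]_z (\sum_(0 <= k <oo) u k z))).
  apply: le_int0 => z _.
    by rewrite lee_fin mulr_ge0// divr_ge0 ?(ltW t0)// addr_ge0// sqr_ge0.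
  have [k [k1 k2]] := poisson_dyadic t0 (normr_ge0 (x - z)%R).
  apply: (@le_trans _ _ (u k z)); last exact: (@nneseries_ge_term _ (u ^~ z)).
  rewrite /u patchE ifT; last by rewrite inE.
  by move: k2; rewrite real_normK ?num_real// -EFinM lee_fin => k2; exact: ler_wpM2r.
rewrite integral_nneseries//.
apply: (@le_trans _ _ (\sum_(0 <= k <oo) (8 * (2^-1) ^+ k)%:E * HL_maximal f x)).
  apply: lee_nneseries => [k _ _|k _]; first by apply: integral_ge0.
  rewrite /u ge0_integralZl_EFin//; last exact: mp.
  rewrite -integral_mkcond.
  apply: (@le_trans _ _ ((c k)%:E * ((2 * b k)%:E * HL_maximal f x))).
    by rewrite lee_wpmul2l ?lee_fin// HL_ball.
  rewrite muleA -EFinM le_eqVlt; apply/orP; left; apply/eqP; congr (_%:E * _).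
  rewrite /c /b.
  have -> : (4 * t^-1 * 4^-1 ^+ k * (2 * (2 ^+ k * t)) = 8 * (t^-1 * t) * (4^-1 ^+ k * 2 ^+ k))%R by ring.
  rewrite mulVf ?gt_eqF// mulr1 -exprMn; congr (_ * _ ^+ _)%R; lra.
apply: nneseriesMr_le => [k|n|]; [by rewrite mulr_ge0// exprn_ge0| |exact: HL_maximalT_ge0].
have e2 : ((1 - 2^-1)^-1 = 2 :> R)%R by field.
have := @sum_geometric_le R 2^-1 n; rewrite -mulr_sumr e2 => h.
have {}h := h ltac:(lra) ltac:(lra); lra.
Qed.

End maximal.

(** * Powers as sums over geometric levels *)

Section level_sums.
Context {R : realType}.
Local Open Scope ereal_scope.
Context (b r : R) (b0 : (0 < b)%R) (b1 : (b < 1)%R) (r0 : (0 < r)%R).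

Let rho := (b `^ r)%R.

Lemma rho_gt0 : (0 < rho)%R. Proof. exact: powR_gt0. Qed.

Lemma rho_lt1 : (rho < 1)%R.
Proof.
have <- : (1 `^ r = 1 :> R)%R by rewrite powR1.
apply: gt0_ltr_powR => //; rewrite nnegrE ?ler01//.
exact: ltW.
Qed.

(** Geometric levels L, L b, L b^2, ... replace the continuous parameter of
    the layer cake formula, so that integrals of powers become series that can
    be compared term by term. *)
Definition level (L : R) (k : nat) : R := (L * b ^+ k)%R.

Lemma level_gt0 L k : (0 < L)%R -> (0 < level L k)%R.
Proof. by move=> L0; rewrite mulr_gt0// exprn_gt0. Qed.

Lemma level_powR L k : (0 < L)%R -> ((level L k) `^ r = L `^ r * rho ^+ k)%R.
Proof.
move=> L0; rewrite powRM ?exprn_ge0 ?(ltW b0) ?(ltW L0)//; congr (_ * _)%R.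
rewrite /rho -(powR_mulrn k (ltW b0)) -(powR_mulrn k (powR_ge0 b r)) -!powRrM.
by congr (b `^ _)%R; exact: mulrC.
Qed.

Lemma levelS L k : level L k.+1 = level (L * b) k.
Proof. by rewrite /level exprS mulrA. Qed.

(** The levels below a form a geometric progression, dominated by its largest
    term. *)
Lemma level_sum_le n L (a : \bar R) : (0 < L)%R -> 0 <= a ->
  \sum_(0 <= k < n) ((level L k) `^ r * ((level L k)%:E < a)%E%:R)%:E
    <= (1 - rho)^-1%:E * a `^ r.
Proof.
move=> + a0; elim: n L => [|n IH] L L0.
  rewrite big_geq// mule_ge0 ?poweR_ge0// lee_fin invr_ge0 subr_ge0.
  exact/ltW/rho_lt1.
have [La|aL] := ltP L%:E a.
  apply: (@le_trans _ _ ((1 - rho)^-1%:E * L%:E `^ r)); last first.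
    rewrite lee_wpmul2l//; first by rewrite lee_fin invr_ge0 subr_ge0 ltW// rho_lt1.
    apply: gt0_ler_poweR; rewrite ?(ltW r0)//.
    - by rewrite in_itv/= leey lee_fin (ltW L0).
    - by rewrite in_itv/= leey a0.
    - exact: ltW.
  rewrite sumEFin poweR_EFin -EFinM lee_fin.
  apply: (@le_trans _ _ (\sum_(0 <= k < n.+1) L `^ r * rho ^+ k)%R).
    apply: ler_sum => k _; rewrite level_powR// ler_piMr//.
      by rewrite mulr_ge0 ?powR_ge0// exprn_ge0// ltW// rho_gt0.
    by case: (_ < _).
  rewrite -mulr_sumr mulrC ler_wpM2r ?powR_ge0//.
  by apply: sum_geometric_le; [exact: rho_gt0|exact: rho_lt1].
rewrite big_nat_recl// /level expr0 mulr1 ltNge aL/= mulr0 add0e.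
under eq_bigr do rewrite -/(level L _.+1) levelS.
by apply: IH; rewrite mulr_gt0.
Qed.

(** The first level below a is at least b a, unless a exceeds the top level L,
    whence the minimum. *)
Lemma level_sum_ge L (a : \bar R) : (0 < L)%R -> 0 <= a ->
  (Order.min a L%:E) `^ r
    <= rho^-1%:E * \sum_(0 <= k <oo) ((level L k) `^ r * ((level L k)%:E < a)%E%:R)%:E.
Proof.
move=> L0 a0.
pose u k := ((level L k) `^ r * ((level L k)%:E < a)%E%:R)%:E.
have u0 k : 0 <= u k by rewrite lee_fin mulr_ge0 ?powR_ge0.
have s0 : 0 <= \sum_(0 <= k <oo) u k by apply: nneseries_ge0.
have [aL|La] := leP a L%:E; last first.
  apply: (@le_trans _ _ (u 0%N)).
    by rewrite /u /level expr0 mulr1 La mulr1 poweR_EFin.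
  apply: (le_trans (nneseries_ge_term 0 u0)).
  rewrite -[leLHS]mul1e lee_wpmul2r// lee_fin -invr1 lef_pV2 ?posrE//.
    exact/ltW/rho_lt1.
  exact: rho_gt0.
move: a0; rewrite le_eqVlt => /predU1P[<-|a0].
  rewrite poweR0r ?gt_eqF// mule_ge0 ?lee_fin ?invr_ge0 ?powR_ge0//.
  by apply: nneseries_ge0 => k _ _; rewrite lee_fin mulr_ge0 ?powR_ge0.
have af : a = (fine a)%:E by rewrite fineK// ge0_fin_numE ?(ltW a0)// (le_lt_trans aL)// ltry.
move: aL a0; rewrite /u {u u0 s0}af; set c := fine a => aL a0.
rewrite lee_fin in aL; rewrite lte_fin in a0.
have ex : exists k, (level L k < c)%R.
  have /cvgrPdist_lt/(_ _ a0)[k _ /(_ _ (leqnn k))] :=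
    @cvg_geometric R L b (ltac:(by rewrite ger0_norm// ltW)).
  rewrite /= sub0r normrN ger0_norm; last exact/ltW/level_gt0.
  by exists k.
have [[|k] hk kmin] := ex_minnP ex.
  by move: hk; rewrite /level expr0 mulr1 ltNge aL.
have ck : (c <= level L k)%R by rewrite leNgt; apply/negP => /kmin; rewrite ltnn.
pose u k := ((level L k) `^ r * ((level L k)%:E < c%:E)%E%:R)%:E.
have u0 j : 0 <= u j by rewrite lee_fin mulr_ge0 ?powR_ge0.
apply: (@le_trans _ _ (rho^-1%:E * u k.+1)); last first.
  by rewrite lee_wpmul2l ?lee_fin ?invr_ge0 ?(ltW rho_gt0)//; exact: (nneseries_ge_term k.+1 u0).
rewrite /u lte_fin hk mulr1 poweR_EFin -EFinM lee_fin level_powR// exprS.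
have -> : (rho^-1 * (L `^ r * (rho * rho ^+ k)) = (rho^-1 * rho) * (L `^ r * rho ^+ k))%R by ring.
rewrite mulVf ?gt_eqF ?rho_gt0// mul1r -level_powR//.
by apply: ge0_ler_powR; rewrite ?nnegrE ?(ltW r0) ?(ltW a0)//; exact/ltW/level_gt0.
Qed.

End level_sums.

Section power_limits.
Context {R : realType}.
Local Open Scope ereal_scope.

Lemma lt_poweR_sup (r : R) (a : \bar R) (u : nat -> \bar R) : (0 < r)%R ->
  0 <= a -> (forall n, 0 <= u n) ->
  (forall c : R, c%:E < a -> exists n, c%:E < u n) ->
  a `^ r <= ereal_sup (range (fun n => u n `^ r)).
Proof.
move=> r0 a0 u0 ua; rewrite leNgt; apply/negP => h.
have s0 : 0 <= ereal_sup (range (fun n => u n `^ r)).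
  by apply: le_trans (poweR_ge0 (u 0%N) r) _; apply: ereal_sup_ubound; exists 0%N.
have sf : ereal_sup (range (fun n => u n `^ r)) \is a fin_num.
  by rewrite ge0_fin_numE// (lt_le_trans h)// leey.
move: h s0 sf; set s := ereal_sup _ => h s0 sf.
have mono x y : 0 <= x -> x <= y -> x `^ r <= y `^ r.
  move=> x0 xy; apply: gt0_ler_poweR; rewrite ?(ltW r0)//.
  - by rewrite in_itv/= leey x0.
  - by rewrite in_itv/= leey (le_trans x0).
pose c := (fine s `^ r^-1)%R.
have cs : c%:E `^ r = s.
  rewrite poweR_EFin /c -powRrM mulVf ?gt_eqF// powRr1 ?fine_ge0//.
  exact: fineK.
have c0 : 0 <= c%:E by rewrite lee_fin powR_ge0.
have ca : c%:E < a.
  by rewrite ltNge; apply/negP => /(mono _ _ a0); rewrite cs leNgt h.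
have [n un] := ua _ ca.
have : c%:E `^ r < u n `^ r.
  rewrite lt_neqAle mono ?(ltW un)// andbT; apply/eqP => e.
  have : (c%:E `^ r) `^ r^-1 = (u n `^ r) `^ r^-1 by rewrite e.
  rewrite -!poweRrM mulfV ?gt_eqF// !poweRe1// => e2.
  by rewrite e2 ltxx in un.
rewrite cs ltNge => /negP; apply.
by apply: ereal_sup_ubound; exists n.
Qed.

(** Monotone convergence for powers. Stated with strict lower bounds of a
    instead of a = sup_n u n, which is the form in which truncations produce
    it. *)
Lemma int_poweR_sup d (T : measurableType d) (m : {measure set T -> \bar R})
    (r : R) (a : T -> \bar R) (u : nat -> T -> \bar R) (C : \bar R) : (0 < r)%R ->
  (forall x, 0 <= a x) -> (forall n x, 0 <= u n x) ->
  (forall n, measurable_fun setT (u n)) ->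
  (forall n k x, (n <= k)%N -> u n x <= u k x) ->
  (forall x (c : R), c%:E < a x -> exists n, c%:E < u n x) ->
  (forall n, \int[m]_x u n x `^ r <= C) -> \int[m]_x a x `^ r <= C.
Proof.
move=> r0 a0 u0 mU ndu ua uC.
have mU' n : measurable_fun setT (fun x => u n x `^ r).
  by apply: (measurableT_comp (measurable_poweR _)); exact: mU.
have nd x : {homo (fun n => u n x `^ r) : n k / (n <= k)%N >-> n <= k}.
  move=> n k nk; apply: gt0_ler_poweR; rewrite ?(ltW r0)//.
  - by rewrite in_itv/= leey u0.
  - by rewrite in_itv/= leey u0.
  - exact: ndu.
apply: (@le_trans _ _ (\int[m]_x limn (fun n => u n x `^ r))).
  apply: le_int0 => x _; first exact: poweR_ge0.
  have /cvg_lim -> // := ereal_nondecreasing_cvgn (nd x).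
  by apply: (@lt_poweR_sup r (a x) (u ^~ x)) => //; exact: ua.
rewrite (@monotone_convergence _ _ _ m setT measurableT (fun n x => u n x `^ r))//; last first.
  by move=> n x _; exact: poweR_ge0.
apply: lime_le; last exact: nearW.
apply: ereal_nondecreasing_is_cvgn => n k nk.
by apply: le_int0 => x _; [exact: poweR_ge0|exact: nd].
Qed.

End power_limits.

Section good_lambda.
Context d (T : measurableType d) {R : realType} (m : {measure set T -> \bar R}).
Local Open Scope ereal_scope.
Context (b r : R) (b0 : (0 < b)%R) (b1 : (b < 1)%R) (r0 : (0 < r)%R).
Let rho := (b `^ r)%R.
Let lev := level b.

Lemma int_level_sum (A : T -> \bar R) (w : T -> R) (L : R) :
  (0 < L)%R -> measurable_fun setT A -> measurable_fun setT w ->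
  (forall x, 0 <= w x)%R ->
  \int[m]_x ((w x)%:E * \sum_(0 <= k <oo) ((lev L k) `^ r * ((lev L k)%:E < A x)%E%:R)%:E) =
  \sum_(0 <= k <oo) ((lev L k) `^ r)%:E * \int[m]_(x in [set x | (lev L k)%:E < A x]) (w x)%:E.
Proof.
move=> L0 mA mw w0.
have mS k : measurable [set x | (lev L k)%:E < A x].
  by rewrite -[X in measurable X]setTI; apply: emeasurable_fun_o_infty.
have mwS k : measurable_fun setT ((fun x => (w x)%:E) \_ [set x | (lev L k)%:E < A x]).
  by apply/(measurable_restrictT _ (mS k))/measurable_funTS/measurable_EFinP.
have wS0 k x : 0 <= ((fun x => (w x)%:E) \_ [set x | (lev L k)%:E < A x]) x.
  by rewrite patchE; case: ifPn; rewrite // lee_fin.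
transitivity (\int[m]_x (\sum_(0 <= k <oo)
   ((lev L k) `^ r)%:E * ((fun x => (w x)%:E) \_ [set x | (lev L k)%:E < A x]) x)).
  apply: eq_integral => x _.
  rewrite -nneseriesZl; last by move=> k _; rewrite lee_fin mulr_ge0 ?powR_ge0.
  apply: eq_eseriesr => k _; rewrite patchE.
  have [h|h] := boolP ((lev L k)%:E < A x).
    by rewrite mulr1 ifT; [rewrite muleC|exact: mem_set].
  rewrite mulr0 mule0 ifF; first by rewrite mule0.
  by apply/negP => /set_mem h'; rewrite h' in h.
rewrite integral_nneseries//.
- apply: eq_eseriesr => k _; rewrite ge0_integralZl_EFin ?powR_ge0//.
  by rewrite -integral_mkcond.
- by move=> k; exact: measurable_funeM.
- by move=> k x _; rewrite mule_ge0 ?lee_fin ?powR_ge0.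
Qed.

Lemma integral_one (S : set T) : measurable S ->
  \int[m]_(x in S) (cst 1%R x)%:E = m S.
Proof. by move=> mS; have := integral_cst m mS 1%:E; rewrite mul1e. Qed.

Lemma int_min_level (A : T -> \bar R) (L : R) : (0 < L)%R ->
  (forall x, 0 <= A x) -> measurable_fun setT A ->
  \int[m]_x (Order.min (A x) L%:E) `^ r <=
  rho^-1%:E * \sum_(0 <= k <oo) ((lev L k) `^ r)%:E * m [set x | (lev L k)%:E < A x].
Proof.
move=> L0 A0 mA.
have mS k : measurable [set x | (lev L k)%:E < A x].
  by rewrite -[X in measurable X]setTI; apply: emeasurable_fun_o_infty.
have ri : (0 <= rho^-1)%R by rewrite invr_ge0 powR_ge0.
have := @int_level_sum A (cst 1%R) L L0 mA (measurable_cst _) (fun=> ler01).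
under eq_integral do rewrite mul1e.
under [in X in _ = X -> _]eq_eseriesr do rewrite integral_one//.
move=> <-; rewrite -ge0_integralZl_EFin//; first last.
- apply: ge0_emeasurable_sum => [k x _ _|k _]; first by rewrite lee_fin mulr_ge0 ?powR_ge0.
  apply/measurable_EFinP; apply: measurable_funM => //.
  apply: measurableT_comp => //; apply: measurableT_comp => //.
  apply: (measurable_fun_bool true); rewrite setTI.
  by rewrite (_ : _ @^-1` _ = [set x | (lev L k)%:E < A x]).
- by move=> x _; apply: nneseries_ge0 => k _ _; rewrite lee_fin mulr_ge0 ?powR_ge0.
apply: le_int0 => x _; first exact: poweR_ge0.
exact: level_sum_ge.
Qed.

Lemma int_level_le (N : T -> \bar R) (w : T -> R) (L : R) : (0 < L)%R ->
  (forall x, 0 <= N x) -> measurable_fun setT N ->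
  measurable_fun setT w -> (forall x, 0 <= w x)%R ->
  \sum_(0 <= k <oo) ((lev L k) `^ r)%:E * \int[m]_(x in [set x | (lev L k)%:E < N x]) (w x)%:E
  <= (1 - rho)^-1%:E * \int[m]_x ((w x)%:E * N x `^ r).
Proof.
move=> L0 N0 mN mw w0; rewrite -int_level_sum//.
have r1 : (0 <= (1 - rho)^-1)%R by rewrite invr_ge0 subr_ge0 ltW// rho_lt1.
rewrite -ge0_integralZl_EFin//; first last.
- apply: emeasurable_funM; first exact/measurable_EFinP.
  by apply: (measurableT_comp (measurable_poweR _)); exact: mN.
- by move=> x _; rewrite mule_ge0 ?lee_fin ?poweR_ge0.
apply: le_int0 => x _.
  rewrite mule_ge0 ?lee_fin//.
  by apply: nneseries_ge0 => k _ _; rewrite lee_fin mulr_ge0 ?powR_ge0.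
rewrite muleCA lee_wpmul2l ?lee_fin//; apply: nneseries_le => [k|n].
  by rewrite lee_fin mulr_ge0 ?powR_ge0.
exact: level_sum_le.
Qed.

(** Multiplying the good-lambda inequality by the r-th power of the level and
    summing over levels bounds the level sum S of A by a constant times S plus
    the level sum of N. The constant e / rho is at most 1/2, so S can be
    absorbed; this needs S finite, which is what the crude bound V is for. *)
Lemma good_lambda_int (A N : T -> \bar R) (e V : R) :
  (forall x, 0 <= A x) -> measurable_fun setT A ->
  (forall x, 0 <= N x) -> measurable_fun setT N ->
  (0 <= e)%R -> (e <= rho / 2)%R ->
  (forall l : R, (0 < l)%R -> m [set x | l%:E < A x] <= V%:E) ->
  (forall l : R, (0 < l)%R ->
    m [set x | l%:E < A x] <=
      e%:E * m [set x | (b * l)%:E < A x] + m [set x | l%:E < N x]) ->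
  \int[m]_x A x `^ r <= (2 / (rho * (1 - rho)))%:E * \int[m]_x N x `^ r.
Proof.
move=> A0 mA N0 mN e0 e1 AV gl.
have [rh0 rh1] := (rho_gt0 r b0, rho_lt1 b0 b1 r0).
rewrite -/rho in rh0 rh1.
have mSA k : measurable [set x | k%:E < A x].
  by rewrite -[X in measurable X]setTI; apply: emeasurable_fun_o_infty.
have mSN k : measurable [set x | k%:E < N x].
  by rewrite -[X in measurable X]setTI; apply: emeasurable_fun_o_infty.
apply: (@int_poweR_sup _ _ _ _ r A (fun n x => Order.min (A x) n.+1%:R%:E)) => //.
- by move=> n x; rewrite le_min A0 lee_fin ler0n.
- by move=> n; apply: measurable_mine.
- move=> n k x nk; rewrite le_min ge_min lexx/=.
  by rewrite ge_min lee_fin ler_nat ltnS nk orbT.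
- move=> x c cA; exists (Num.bound c); rewrite lt_min cA/= lte_fin.
  apply: (le_lt_trans (ler_norm c)); apply: (lt_trans (archi_boundP (normr_ge0 c))).
  by rewrite /Num.bound ltr_nat /Num.bound normr_id.
move=> n; pose L : R := n.+1%:R; have L0 : (0 < L)%R by rewrite ltr0n.
apply: (le_trans (int_min_level L0 A0 mA)).
set S := \sum_(0 <= k <oo) _.
pose Sk k := ((lev L k) `^ r)%:E * m [set x | (lev L k)%:E < A x].
have Sk0 k : 0 <= Sk k by rewrite mule_ge0 ?lee_fin ?powR_ge0.
have lev0 k : (0 < lev L k)%R by exact: level_gt0.
pose Q := \sum_(0 <= k <oo) ((lev L k) `^ r)%:E * m [set x | (lev L k)%:E < N x].
have Q0 : 0 <= Q by apply: nneseries_ge0 => k _ _; rewrite mule_ge0 ?lee_fin ?powR_ge0.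
have S0 : 0 <= S by apply: nneseries_ge0 => k _ _; exact: Sk0.
have Sfin : S \is a fin_num.
  rewrite ge0_fin_numE//; apply: (@le_lt_trans _ _ ((L `^ r * (1 - rho)^-1)%:E * V%:E)).
    have V0 : 0 <= V%:E by apply: le_trans (AV 1%R ltr01).
    apply: (@le_trans _ _ (\sum_(0 <= k <oo) (L `^ r * rho ^+ k)%:E * V%:E)).
      apply: lee_nneseries => [k _ _|k _]; first exact: Sk0.
      by rewrite /lev level_powR// lee_wpmul2l ?lee_fin ?mulr_ge0 ?powR_ge0 ?exprn_ge0 ?(ltW rh0)//; exact: AV.
    apply: nneseriesMr_le => // [k|k].
      by rewrite mulr_ge0 ?powR_ge0 ?exprn_ge0 ?(ltW rh0).
    by rewrite -mulr_sumr ler_wpM2l ?powR_ge0//; exact: sum_geometric_le.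
  by rewrite -EFinM ltry.
(* The shift of the level by one step costs the factor rho. *)
have SQ : S <= (2^-1)%:E * S + Q.
  have half : \sum_(0 <= k <oo) (2^-1)%:E * Sk k.+1 <= (2^-1)%:E * S.
    rewrite nneseriesZl; last by move=> k _; exact: Sk0.
    apply: lee_wpmul2l; first by rewrite lee_fin invr_ge0.
    rewrite /S; apply: nneseries_le => // k.
    apply: le_trans (nneseries_lim_ge k.+1 _); last by move=> j _ _; exact: Sk0.
    by rewrite big_nat_recl//=; apply: leeDr; exact: (Sk0 0%N).
  apply: (@le_trans _ _ (\sum_(0 <= k <oo) ((2^-1)%:E * Sk k.+1 +
      ((lev L k) `^ r)%:E * m [set x | (lev L k)%:E < N x]))).
    apply: lee_nneseries => [k _ _|k _]; first exact: Sk0.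
    apply: (@le_trans _ _ (((lev L k) `^ r)%:E * (e%:E * m [set x | (b * lev L k)%:E < A x]
       + m [set x | (lev L k)%:E < N x]))).
      by rewrite lee_wpmul2l ?lee_fin ?powR_ge0//; exact: gl.
    rewrite ge0_muleDr ?mule_ge0 ?lee_fin//; rewrite leeD2r//.
    rewrite /Sk !muleA -!EFinM.
    have -> : (b * lev L k = lev L k.+1)%R by rewrite /lev /level exprS; ring.
    rewrite lee_wpmul2r// lee_fin /lev !level_powR// exprS.
    have p0 : (0 <= L `^ r * rho ^+ k)%R by rewrite mulr_ge0 ?powR_ge0 ?exprn_ge0 ?(ltW rh0).
    have -> : (2^-1 * (L `^ r * (b `^ r * b `^ r ^+ k)) = (L `^ r * rho ^+ k) * (rho / 2))%R.
      by rewrite /rho; ring.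
    by rewrite ler_wpM2l.
  rewrite nneseriesD; last 2 first.
  - by move=> k _ _; rewrite mule_ge0 ?lee_fin ?invr_ge0.
  - by move=> k _ _; rewrite mule_ge0 ?lee_fin ?powR_ge0.
  by rewrite leeD2r.
have SQ2 : S <= 2%:E * Q.
  case: Q Q0 SQ => [Q Q0|Q0 _|//]; last by rewrite gt0_muley ?leey// lte_fin.
  by rewrite -(fineK Sfin) -!EFinM -EFinD !lee_fin; lra.
have QN : Q <= (1 - rho)^-1%:E * \int[m]_x N x `^ r.
  have := @int_level_le N (cst 1%R) L L0 N0 mN (measurable_cst _) (fun=> ler01).
  under [X in X <= _ -> _]eq_eseriesr do rewrite integral_one//.
  by under [in X in _ <= X -> _]eq_integral do rewrite mul1e.
apply: (@le_trans _ _ (rho^-1%:E * (2%:E * ((1 - rho)^-1%:E * \int[m]_x N x `^ r)))).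
  rewrite lee_wpmul2l ?lee_fin ?invr_ge0 ?powR_ge0//.
  by apply: (le_trans SQ2); rewrite lee_wpmul2l.
rewrite !muleA -!EFinM le_eqVlt; apply/orP; left; apply/eqP; congr (_%:E * _).
by field; rewrite subr_eq0 gt_eqF// gt_eqF.
Qed.

End good_lambda.

(** * The maximal theorem in L^p *)

Section maximal_Lp.
Context {R : realType}.
Local Notation mu := (@lebesgue_measure R).
Implicit Types (f g : R -> R) (x z r t l : R).
Local Open Scope ereal_scope.
Local Notation loc := (locally_integrable [set: R]).

Lemma loc_le f g : measurable_fun setT f -> (forall z, `|f z| <= `|g z|)%R ->
  loc g -> loc f.
Proof.
move=> mf fg [_ _ lg]; split => //; first exact: openT.
move=> K KT cK; apply: le_lt_trans (lg K KT cK).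
by apply: le_int0 => z _; rewrite lee_fin.
Qed.

Lemma HL_leD_cst f g c x : loc f -> loc g -> (0 <= c)%R ->
  (forall z, `|f z| <= `|g z| + c)%R -> HL_maximal f x <= HL_maximal g x + c%:E.
Proof.
move=> lf lg c0 fg; apply: ge_ereal_sup => _ [r /= + <-].
rewrite in_itv/= andbT => r0.
have mb := measurable_ball x r.
have mg : measurable_fun (ball x r) (fun z => `|g z|%:E).
  by apply: measurable_funTS; apply/measurable_EFinP/measurableT_comp => //; case: lg.
have r2 : (0 < r *+ 2)%R by rewrite mulrn_wgt0.
have i0 : 0 <= (lebesgue_measure (ball x r))^-1 by rewrite inve_ge0.
apply: (@le_trans _ _ (iavg g (ball x r) + c%:E)); last first.
  by rewrite leeD2r//; apply: ereal_sup_ubound; exists r => //=; rewrite in_itv/= r0.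
rewrite /iavg.
apply: (@le_trans _ _ ((mu (ball x r))^-1 *
   (\int[mu]_(z in ball x r) (`|g z|%:E) + \int[mu]_(z in ball x r) c%:E))).
  rewrite lee_wpmul2l// -ge0_integralD//.
  by apply: le_int0 => // z _; rewrite -EFinD lee_fin.
rewrite integral_cst// ge0_muleDr ?integral_ge0 ?mule_ge0 ?lee_fin//.
rewrite leeD2l// (lebesgue_measure_ball _ (ltW r0)) inver gt_eqF//.
rewrite [X in _ * (_ * X) <= _](lebesgue_measure_ball _ (ltW r0)).
by rewrite -!EFinM lee_fin mulrCA mulVf ?gt_eqF// mulr1.
Qed.

(** Values of f below l / 2 raise the maximal function by at most l / 2, so
    that the weak type inequality only sees the part of f above l / 2. This is
    the step of the Marcinkiewicz interpolation between L^1 and L^infinity. *)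
Lemma HL_weak_trunc f l : loc f -> (0 < l)%R ->
  mu [set x | l%:E < HL_maximal f x] <=
  (6 / l)%:E * \int[mu]_(z in [set z | l%:E < (2 * `|f z|)%:E]) `|f z|%:E.
Proof.
move=> lf l0; have mf : measurable_fun setT f by case: lf.
pose S := [set z | l%:E < (2 * `|f z|)%:E].
have mS : measurable S.
  rewrite -[X in measurable X]setTI; apply: emeasurable_fun_o_infty => //.
  by apply/measurable_EFinP; apply: measurable_funM => //; exact: measurableT_comp.
pose g := (f \_ S)%R.
have gE z : g z = if z \in S then f z else 0%R by rewrite /g patchE.
have mg : measurable_fun setT g.
  by apply/(measurable_restrictT _ mS); exact: measurable_funTS.
have lg : loc g.
  by apply: loc_le lf => // z; rewrite gE; case: ifPn => // _; rewrite normr0.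
have l20 : (0 < l / 2)%R by rewrite divr_gt0.
have mHL (h : R -> R) k : loc h -> measurable [set x | k%:E < HL_maximal h x].
  move=> lh; rewrite -[X in measurable X]setTI; apply: emeasurable_fun_o_infty => //.
  exact: measurable_HL_maximal.
apply: (@le_trans _ _ (mu [set x | (l / 2)%:E < HL_maximal g x])).
  apply: le_measure; rewrite ?inE; try exact: mHL.
  move=> x /= lx.
  have : HL_maximal f x <= HL_maximal g x + (l / 2)%:E.
    apply: HL_leD_cst => // [|z]; first exact: ltW.
    rewrite gE; case: ifPn => [_|/negP h]; first by have := ltW l20; lra.
    rewrite normr0 add0r leNgt; apply/negP => h'; apply: h; rewrite inE /S/= lte_fin; lra.
  case: (HL_maximal g x) => [c| _|].
  - rewrite -EFinD => /(lt_le_trans lx); rewrite !lte_fin; lra.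
  - by rewrite ltry.
  - by rewrite addNye => /(lt_le_trans lx).
apply: (le_trans (maximal_inequality lg l20)).
have -> : (3 / (l / 2) = 6 / l)%R by field; rewrite gt_eqF.
rewrite lee_wpmul2l// ?lee_fin ?divr_ge0 ?(ltW l0)//.
rewrite [leRHS]integral_mkcond; apply: le_int0 => z _ //.
by rewrite /= patchE -/S gE; case: ifPn => // _; rewrite normr0.
Qed.

(** Marcinkiewicz interpolation: summing [HL_weak_trunc] over levels against
    the (p - 1)-st power of the level. *)
Lemma HL_strong (p : R) : (1 < p)%R -> exists2 C : R, (0 < C)%R &
  forall f, loc f ->
  \int[mu]_x (HL_maximal f x) `^ p <= C%:E * \int[mu]_x (`|f x| `^ p)%:E.
Proof.
move=> p1; pose b : R := 2^-1%R.
have b0 : (0 < b)%R by rewrite invr_gt0.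
have b1 : (b < 1)%R by rewrite invf_lt1// ltr1n.
have p0 : (0 < p)%R by rewrite (lt_trans ltr01).
have q0 : (0 < p - 1)%R by rewrite subr_gt0.
have [[rp0 rq0] rq1] := (rho_gt0 p b0, rho_gt0 (p-1) b0, rho_lt1 b0 b1 q0).
pose C := ((b `^ p)^-1 * 6 * (1 - b `^ (p - 1))^-1 * 2 `^ (p - 1))%R.
have C0 : (0 < C)%R.
  by rewrite /C !mulr_gt0 ?invr_gt0 ?powR_gt0 ?subr_gt0.
exists C => // f lf; have mf : measurable_fun setT f by case: lf.
have mabs : measurable_fun setT (fun z => `|f z|%R) by exact: measurableT_comp.
have mH := measurable_HL_maximal lf.
have H0 := HL_maximalT_ge0 lf.
apply: (@int_poweR_sup _ _ _ mu p (HL_maximal f) (fun n x => Order.min (HL_maximal f x) n.+1%:R%:E)) => //.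
- by move=> n x; rewrite le_min H0 lee_fin ler0n.
- by move=> n; apply: measurable_mine.
- move=> n k x nk; rewrite le_min ge_min lexx/=.
  by rewrite ge_min lee_fin ler_nat ltnS nk orbT.
- move=> x c cA; exists (Num.bound c); rewrite lt_min cA/= lte_fin.
  apply: (le_lt_trans (ler_norm c)); apply: (lt_trans (archi_boundP (normr_ge0 c))).
  by rewrite /Num.bound ltr_nat /Num.bound normr_id.
move=> n; pose L : R := n.+1%:R; have L0 : (0 < L)%R by rewrite ltr0n.
apply: (le_trans (int_min_level mu b0 b1 p0 L0 H0 mH)).
have lev0 k : (0 < level b L k)%R by exact: level_gt0.
apply: (@le_trans _ _ ((b `^ p)^-1%:E * (6%:E * \sum_(0 <= k <oo) ((level b L k) `^ (p - 1))%:E *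
  \int[mu]_(z in [set z | (level b L k)%:E < (2 * `|f z|)%:E]) `|f z|%:E))).
  rewrite lee_wpmul2l ?lee_fin ?invr_ge0 ?powR_ge0//.
  rewrite -nneseriesZl; last by move=> k _; rewrite mule_ge0 ?lee_fin ?powR_ge0 ?integral_ge0.
  apply: lee_nneseries => k _; first by rewrite mule_ge0 ?lee_fin ?powR_ge0.
  apply: (le_trans (lee_wpmul2l _ (HL_weak_trunc lf (lev0 k)))); first by rewrite lee_fin powR_ge0.
  rewrite !muleA -!EFinM lee_wpmul2r ?integral_ge0// lee_fin.
  rewrite -{1}(mulr_powRB1 (ltW (lev0 k)) p0).
  have -> : (level b L k * level b L k `^ (p - 1) * (6 / level b L k) =
     6 * level b L k `^ (p - 1) * (level b L k / level b L k))%R by ring.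
  by rewrite divff ?gt_eqF// mulr1.
have m2 : measurable_fun setT (fun z => (2 * `|f z|)%:E).
  by apply/measurable_EFinP; apply: measurable_funM.
have := int_level_le mu b0 b1 q0 L0 (N := fun z => (2 * `|f z|)%:E) (w := fun z => `|f z|%R) _ m2 mabs (fun=> normr_ge0 _).
move=> /(_ (fun x => ltac:(by rewrite lee_fin mulr_ge0))) h.
apply: (@le_trans _ _ ((b `^ p)^-1%:E * (6%:E * ((1 - b `^ (p - 1))^-1%:E * (2 `^ (p - 1))%:E * \int[mu]_x (`|f x| `^ p)%:E)))).
  rewrite lee_wpmul2l ?lee_fin ?invr_ge0 ?powR_ge0// lee_wpmul2l//.
  apply: (le_trans h); rewrite -muleA lee_wpmul2l ?lee_fin ?invr_ge0 ?subr_ge0 ?(ltW rq1)//.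
  rewrite -ge0_integralZl_EFin; first last.
  - exact: powR_ge0.
  - by apply/measurable_EFinP; apply: (measurableT_comp (measurable_powR p)).
  - by move=> x _; rewrite lee_fin powR_ge0.
  - exact: measurableT.
  apply: le_int0 => x _; first by rewrite mule_ge0 ?lee_fin ?poweR_ge0.
  rewrite poweR_EFin powRM// -!EFinM lee_fin mulrCA -(mulr_powRB1 (normr_ge0 (f x)) p0) //.
by rewrite /C !EFinM !muleA.
Qed.

End maximal_Lp.

(** * Estimates of the Mehler kernel *)

Section derive_combinators.
Context {R : realType}.
Implicit Types (f g : R -> R) (x df dg : R).

Lemma drvM f g x df dg : is_derive x 1 f df -> is_derive x 1 g dg ->
  is_derive x 1 (fun y => f y * g y) (df * g x + f x * dg).
Proof.
move=> hf hg; apply: is_derive_eq (is_deriveM hf hg) _.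
by rewrite /GRing.scale /= addrC; congr (_ + _); rewrite mulrC.
Qed.

Lemma drvD f g x df dg : is_derive x 1 f df -> is_derive x 1 g dg ->
  is_derive x 1 (fun y => f y + g y) (df + dg).
Proof. by move=> hf hg; exact: is_deriveD. Qed.

Lemma drvN f x df : is_derive x 1 f df -> is_derive x 1 (fun y => - f y) (- df).
Proof. by move=> hf; exact: is_deriveN. Qed.

Lemma drvB f g x df dg : is_derive x 1 f df -> is_derive x 1 g dg ->
  is_derive x 1 (fun y => f y - g y) (df - dg).
Proof. by move=> hf hg; exact: is_deriveB. Qed.

Lemma drvC (c x : R) : is_derive x 1 (fun _ : R => c) 0.
Proof. exact: is_derive_cst. Qed.

Lemma drvI x : is_derive x 1 (fun y : R => y) 1.
Proof. exact: is_derive_id. Qed.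

Lemma drv_expR f x df : is_derive x 1 f df ->
  is_derive x 1 (fun y => expR (f y)) (expR (f x) * df).
Proof.
move=> hf; have := @is_derive1_comp R expR f x _ _ (is_derive_expR (f x)) hf.
exact.
Qed.

Lemma drv_ln f x df : 0 < f x -> is_derive x 1 f df ->
  is_derive x 1 (fun y => ln (f y)) ((f x)^-1 * df).
Proof.
move=> f0 hf; have := @is_derive1_comp R (@ln R) f x _ _ (is_derive1_ln f0) hf.
exact.
Qed.

Lemma drvV f x df : f x != 0 -> is_derive x 1 f df ->
  is_derive x 1 (fun y => (f y)^-1) (- df / (f x) ^+ 2).
Proof.
move=> f0 hf; have [hd hv] := hf; apply: DeriveDef; first exact: derivableV.
rewrite deriveV// hv /GRing.scale/= mulrC mulrN mulNr; congr (- (_ * _)).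
Qed.

End derive_combinators.

Section mehler_kernel.
Context {R : realType}.
Implicit Types (s t x y z : R).

Local Notation a s := (expR (- s)).

Lemma decay_gt0 s : 0 < a s. Proof. exact: expR_gt0. Qed.

Lemma decay_lt1 s : 0 < s -> a s < 1.
Proof. by move=> s0; rewrite -expR0 ltr_expR oppr_lt0. Qed.

(** The logarithmic derivative in s of the Mehler kernel. *)
Definition dlog_mehler s x y : R := - (1 + a s ^+ 2) / (2 * (1 - a s ^+ 2))
  + (x - y) ^+ 2 * (a s / (2 * (1 - a s) ^+ 2))
  - (x + y) ^+ 2 * (a s / (2 * (1 + a s) ^+ 2)).

(** The kernel of s d/ds W_s, by [mehler_derive]. *)
Definition sdmehler s x y : R := mehler s x y * (s * dlog_mehler s x y).

(** This is tanh (s / 2), comparable to s for small s and to 1 for large s: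
    the Gaussian width of the Mehler kernel in x - y is of the order of its
    square root, and that in x + y of the order of the inverse square root. *)
Definition tanh_half s : R := (1 - a s) / (1 + a s).

Lemma tanh_half_gt0 s : 0 < s -> 0 < tanh_half s.
Proof.
move=> s0; rewrite /tanh_half divr_gt0 ?subr_gt0 ?decay_lt1// addr_gt0//; exact: decay_gt0.
Qed.

(** In the variables x - y and x + y the quadratic form of the Mehler kernel
    is diagonal. *)
Lemma mehler_exponent s x y : 0 < s ->
  mehler s x y = (Num.sqrt pi)^-1 * Num.sqrt (a s / (1 - a s ^+ 2)) *
    expR (- (((x - y) ^+ 2 / tanh_half s + tanh_half s * (x + y) ^+ 2) / 4)).
Proof.
move=> s0; have [a0 a1] := (decay_gt0 s, decay_lt1 s0).
have e2 : expR (- (2 * s)) = a s ^+ 2 by rewrite -expRM_natl mulrN.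
rewrite /mehler e2; congr (_ * expR _); congr (- _).
rewrite /tanh_half; field; rewrite !gt_eqF//.
all: nra.
Qed.

(** With the prefactor inside the exponential, differentiating in s produces
    the logarithmic derivative as a factor. *)
Lemma mehler_exp s x y : 0 < s ->
  mehler s x y = (Num.sqrt pi)^-1 * expR (- (ln (expR s - a s) / 2)
   - ((x - y) ^+ 2 * ((1 + a s) / (1 - a s)) + (x + y) ^+ 2 * ((1 - a s) / (1 + a s))) / 4).
Proof.
move=> s0; have [a0 a1] := (decay_gt0 s, decay_lt1 s0).
rewrite mehler_exponent// -mulrA; congr (_ * _); rewrite expRD; congr (_ * _); last first.
  congr (expR _); congr (- _); rewrite /tanh_half; field; rewrite !gt_eqF//; lra.
have es : expR s = (a s)^-1 by rewrite expRN invrK.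
have X0 : 0 < expR s - a s.
  by rewrite subr_gt0 ltr_expR; lra.
have -> : a s / (1 - a s ^+ 2) = expR (- (ln (expR s - a s) / 2)) ^+ 2.
  have e2 : 2 * - (ln (expR s - a s) / 2) = - ln (expR s - a s) by field.
  rewrite -[in RHS]expRM_natl e2 [in RHS]expRN lnK ?posrE// es.
  by field; rewrite !gt_eqF// ?subr_gt0//; nra.
by rewrite sqrtr_sqr ger0_norm// expR_ge0.
Qed.

Lemma mehler_derive s x y : 0 < s ->
  is_derive s 1 (fun r => mehler r x y) (mehler s x y * dlog_mehler s x y).
Proof.
move=> s0; have [a0 a1] := (decay_gt0 s, decay_lt1 s0).
have es : expR s = (a s)^-1 by rewrite expRN invrK.
have X0 : 0 < expR s - a s.
  by rewrite subr_gt0 ltr_expR; lra.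
have dna : is_derive s 1 (fun r : R => - r) (-1) by exact: drvN (drvI s).
have da : is_derive s 1 (fun r => a r) (- a s).
  by apply: is_derive_eq (drv_expR dna) _; rewrite mulrN1.
have b0 : 0 < 1 - a s ^+ 2 by nra.
have n1 : 1 - a s != 0 by rewrite gt_eqF// subr_gt0.
have n2 : 1 + a s != 0 by rewrite gt_eqF// addr_gt0.
have dp := drvD (drvC 1 s) da; have dm := drvB (drvC 1 s) da.
have dX := drvB (drv_expR (drvI s)) da.
have dl := drvM (@drv_ln _ (fun r => expR r - a r) s _ X0 dX) (drvC 2^-1 s).
have d1 := drvM (drvC ((x - y) ^+ 2) s) (drvM dp (@drvV _ (fun r => 1 - a r) s _ n1 dm)).
have d2 := drvM (drvC ((x + y) ^+ 2) s) (drvM dm (@drvV _ (fun r => 1 + a r) s _ n2 dp)).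
have dE := drv_expR (drvB (drvN dl) (drvM (drvD d1 d2) (drvC 4^-1 s))).
have dall := drvM (drvC (Num.sqrt pi)^-1 s) dE.
have : is_derive s 1 (fun r : R => (Num.sqrt pi)^-1 * expR (- (ln (expR r - a r) / 2)
   - ((x - y) ^+ 2 * ((1 + a r) / (1 - a r)) + (x + y) ^+ 2 * ((1 - a r) / (1 + a r))) / 4))
   (mehler s x y * dlog_mehler s x y).
  apply: is_derive_eq dall _.
  rewrite mehler_exp// /dlog_mehler; set E := expR (_ - _); set L := ln _.
  set c := (Num.sqrt pi)^-1; rewrite es; field; rewrite !gt_eqF//; rewrite ?subr_gt0 ?addr_gt0//.
apply: near_eq_is_derive.
near=> r; rewrite mehler_exp//; near: r; exact: lt_nbhsr.
Unshelve. all: by end_near. Qed.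

Lemma tanh_half_le s : 0 < s -> tanh_half s <= s.
Proof.
move=> s0; have a0 := decay_gt0 s; rewrite /tanh_half ler_pdivrMr ?addr_gt0//.
by have := expR_ge1Dx (- s); nra.
Qed.

Lemma tanh_half_ge s : 0 < s -> s <= 2 * (1 + s) * tanh_half s.
Proof.
move=> s0; have [a0 a1] := (decay_gt0 s, decay_lt1 s0).
rewrite /tanh_half mulrA ler_pdivlMr ?addr_gt0//.
have : a s * (1 + s) <= 1.
  rewrite expRN mulrC ler_pdivrMr ?expR_gt0// mul1r; exact: expR_ge1Dx.
nra.
Qed.

Lemma tanh_half_lt1 s : tanh_half s < 1.
Proof.
by have a0 := decay_gt0 s; rewrite /tanh_half ltr_pdivrMr ?addr_gt0//; nra.
Qed.

(** The factor exp (- s / 2), from the bottom 1 / 2 of the spectrum,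
    compensates the growth of s / tanh (s / 2) for large s; thus the estimates
    below hold for all s with the same homogeneity as for small s. *)
Lemma decay_ratio s : 0 < s -> expR (- (s / 2)) * (s / tanh_half s) ^+ 2 <= 64.
Proof.
move=> s0; have t0 := tanh_half_gt0 s0.
have h1 : s / tanh_half s <= 2 * (1 + s) by rewrite ler_pdivrMr//; exact: tanh_half_ge.
have h0 : 0 <= s / tanh_half s by rewrite divr_ge0 ?ltW.
(* The constant 64 trades 1 + s for 1 + s / 4, whose square is at most exp (s
   / 2). *)
have h2 : (s / tanh_half s) ^+ 2 <= 64 * (1 + s / 4) ^+ 2.
  apply: le_trans (_ : (2 * (1 + s)) ^+ 2 <= _); last by nra.
  by rewrite ler_sqr ?nnegrE// mulr_ge0//; lra.
have h3 : (1 + s / 4) ^+ 2 <= expR (s / 2).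
  have -> : s / 2 = 2%:R * (s / 4) by field.
  rewrite expRM_natl ler_sqr ?nnegrE ?expR_ge0//; last lra.
  exact: expR_ge1Dx.
rewrite expRN mulrC ler_pdivrMr ?expR_gt0//; nra.
Qed.

Definition decay_cst : R := 16 ^+ 4.

Lemma decay_cst_gt0 : 0 < decay_cst. Proof. by rewrite exprn_gt0. Qed.

(** Fourth powers suffice: the derivatives of the kernel bring in at most the
    square of (1 + P) (1 + W). *)
Lemma gauss_decay (P : R) : 0 <= P -> expR (- (P / 4)) <= decay_cst / (1 + P) ^+ 4.
Proof.
move=> P0; rewrite expRN -[leLHS]mul1r ler_pdivrMr ?expR_gt0// mulrAC ler_pdivlMr; last first.
  by rewrite exprn_gt0//; lra.
rewrite mul1r.
have -> : P / 4 = 4%:R * (P / 16) by field.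
rewrite expRM_natl.
have h : 1 + P / 16 <= expR (P / 16) by exact: expR_ge1Dx.
apply: (@le_trans _ _ (decay_cst * (1 + P / 16) ^+ 4)); last first.
  rewrite ler_wpM2l ?(ltW decay_cst_gt0)//.
  by rewrite lerXn2r// nnegrE ?expR_ge0//; lra.
have -> : decay_cst * (1 + P / 16) ^+ 4 = (16 + P) ^+ 4 by rewrite /decay_cst -exprMn; congr (_ ^+ _); field.
by rewrite lerXn2r// ?nnegrE; lra.
Qed.

Lemma norm_le_sqr (u b : R) : 0 <= b -> u ^+ 2 <= b ^+ 2 -> `|u| <= b.
Proof.
move=> b0; rewrite -(real_normK (num_real u)) ler_sqr ?nnegrE//.
Qed.

Lemma mehler_prefactor_le s : 0 < s ->
  (Num.sqrt pi)^-1 * Num.sqrt (a s / (1 - a s ^+ 2)) <= expR (- (s / 2)) / Num.sqrt (tanh_half s).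
Proof.
move=> s0; have [[a0 a1] t0] := (decay_gt0 s, decay_lt1 s0, tanh_half_gt0 s0).
have b0 : 0 < 1 - a s ^+ 2 by nra.
apply: (@le_trans _ _ (1 * Num.sqrt (a s / (1 - a s ^+ 2)))).
  rewrite ler_wpM2r ?sqrtr_ge0// invf_le1 ?sqrtr_gt0 ?pi_gt0//.
  rewrite -[leLHS]sqrtr1 ler_wsqrtr//; apply: le_trans (pi_ge2 R); lra.
rewrite mul1r.
have -> : expR (- (s / 2)) / Num.sqrt (tanh_half s) = Num.sqrt (a s / tanh_half s).
  rewrite (sqrtrM _ (expR_ge0 _)) sqrtrV ?(ltW t0)//.
  congr (_ / _); have -> : a s = expR (- (s / 2)) ^+ 2.
    by rewrite -expRM_natl; congr expR; field.
  by rewrite sqrtr_sqr ger0_norm// expR_ge0.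
apply: ler_wsqrtr; rewrite ler_pM2l// lef_pV2 ?posrE//.
rewrite /tanh_half ler_pdivrMr ?addr_gt0//; nra.
Qed.

Definition sdmehler_cst : R := 64 * decay_cst ^+ 2.
Lemma sdmehler_cst_gt0 : 0 < sdmehler_cst. Proof. by rewrite mulr_gt0// !exprn_gt0. Qed.

Lemma dlog_mehlerE s x y : 0 < s -> dlog_mehler s x y = (tanh_half s)^-1 *
  (- (1 + tanh_half s ^+ 2) / 4 + (1 - tanh_half s ^+ 2) / 8 * ((x - y) ^+ 2 / tanh_half s - tanh_half s * (x + y) ^+ 2)).
Proof.
move=> s0; have [a0 a1] := (decay_gt0 s, decay_lt1 s0).
by rewrite /dlog_mehler /tanh_half; field; rewrite !gt_eqF//; nra.
Qed.

Lemma tanh_ratio_le s u : 0 < s -> (1 + u ^+ 2 / tanh_half s)^-1 <= s / (s + u ^+ 2).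
Proof.
move=> s0; have t0 := tanh_half_gt0 s0; have tl := tanh_half_le s0.
have -> : (1 + u ^+ 2 / tanh_half s)^-1 = tanh_half s / (tanh_half s + u ^+ 2).
  by field; rewrite !gt_eqF//; nra.
rewrite ler_pdivrMr; last nra.
rewrite mulrAC ler_pdivlMr; nra.
Qed.

Lemma gauss2_le (P W : R) : 0 <= P -> 0 <= W ->
  expR (- ((P + W) / 4)) <= decay_cst ^+ 2 / ((1 + P) ^+ 4 * (1 + W) ^+ 4).
Proof.
move=> P0 W0; rewrite mulrDl opprD expRD.
apply: le_trans (ler_pM (expR_ge0 _) (expR_ge0 _) (gauss_decay P0) (gauss_decay W0)) _.
rewrite (_ : decay_cst ^+ 2 / _ = decay_cst / (1 + P) ^+ 4 * (decay_cst / (1 + W) ^+ 4))//.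
by rewrite invfM expr2 mulrACA.
Qed.

Lemma frac_le (X Y : R) : 1 <= X -> 1 <= Y ->
  (X ^+ 4 * Y ^+ 4)^-1 * (X * Y) <= X^-1.
Proof.
move=> X1 Y1; have [X0 Y0] : 0 < X /\ 0 < Y by split; lra.
have XY0 : 0 < X ^+ 4 * Y ^+ 4 by rewrite mulr_gt0 ?exprn_gt0.
rewrite mulrC ler_pdivrMr// ler_pdivlMl//.
have -> : X * (X * Y) = X ^+ 2 * Y ^+ 1 by ring.
by apply: ler_pM; rewrite ?exprn_ge0 ?(ltW X0) ?(ltW Y0)//; exact: ler_weXn2l.
Qed.

Lemma frac_le2 (X Y : R) : 1 <= X -> 1 <= Y ->
  (X ^+ 4 * Y ^+ 4)^-1 * (X * Y) ^+ 2 <= (X^-1) ^+ 2.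
Proof.
move=> X1 Y1; have [X0 Y0] : 0 < X /\ 0 < Y by split; lra.
have XY0 : 0 < X ^+ 4 * Y ^+ 4 by rewrite mulr_gt0 ?exprn_gt0.
rewrite exprVn mulrC ler_pdivrMr// ler_pdivlMl ?exprn_gt0//.
have -> : X ^+ 2 * (X * Y) ^+ 2 = X ^+ 4 * Y ^+ 2 by ring.
by apply: ler_pM; rewrite ?exprn_ge0 ?(ltW X0) ?(ltW Y0)//; exact: ler_weXn2l.
Qed.

Lemma amgm4 (P : R) : 0 <= P -> P <= (1 + P) ^+ 2 / 4.
Proof. by move=> P0; have := sqr_ge0 (1 - P); rewrite !expr2; lra. Qed.

Lemma sq_half (v : R) : 1 <= v -> v ^+ 2 / 2 + v / 4 <= v ^+ 2.
Proof. by move=> v1; nra. Qed.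

Lemma dlog_mehler_arith (h P W : R) : 0 < h -> h < 1 -> 0 <= P -> 0 <= W ->
  `|- (1 + h) / 4 + (1 - h) / 8 * (P - W)| <= (1 + P) * (1 + W).
Proof.
move=> h0 h1 P0 W0.
have hP : 0 <= h * P <= P by apply/andP; split; nra.
have hW : 0 <= h * W <= W by apply/andP; split; nra.
have PW : 0 <= P * W by exact: mulr_ge0.
rewrite ler_norml; apply/andP; split; nra.
Qed.

Section kernel_bounds.
Context (s y z : R) (s0 : 0 < s).
Let P := (y - z) ^+ 2 / tanh_half s.
Let W := tanh_half s * (y + z) ^+ 2.
Let D := expR (- (s / 2)).
Let q := Num.sqrt (tanh_half s).
Let t0 : 0 < tanh_half s. Proof. exact: tanh_half_gt0. Qed.
Let t1 : tanh_half s < 1. Proof. exact: tanh_half_lt1. Qed.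
Let th2 : 0 < tanh_half s ^+ 2 < 1.
Proof. by rewrite exprn_gt0//= exprn_ilt1 ?(ltW t0). Qed.
Let u0 : 0 < s + (y - z) ^+ 2. Proof. by rewrite ltr_wpDr ?sqr_ge0. Qed.
Let tt0 : 0 < 2 * tanh_half s. Proof. exact: mulr_gt0. Qed.
Let t40 : 0 < 4 * tanh_half s ^+ 2. Proof. by rewrite mulr_gt0// exprn_gt0. Qed.
Let P0 : 0 <= P. Proof. by rewrite divr_ge0 ?sqr_ge0 ?ltW. Qed.
Let W0 : 0 <= W. Proof. by rewrite mulr_ge0 ?sqr_ge0 ?ltW. Qed.
Let X1 : 1 <= 1 + P. Proof. by rewrite lerDl. Qed.
Let Y1 : 1 <= 1 + W. Proof. by rewrite lerDl. Qed.
Let XX0 : 0 <= 1 + P. Proof. exact: le_trans ler01 X1. Qed.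
Let YY0 : 0 <= 1 + W. Proof. exact: le_trans ler01 Y1. Qed.
Let D0 : 0 < D. Proof. exact: expR_gt0. Qed.
Let q0 : 0 < q. Proof. by rewrite sqrtr_gt0. Qed.
Let qq : tanh_half s = q ^+ 2. Proof. by rewrite sqr_sqrtr// ltW. Qed.
Let qt : 0 < q * tanh_half s. Proof. exact: mulr_gt0. Qed.
Let q8 : 0 < 8 * q. Proof. exact: mulr_gt0. Qed.
Let qt8 : 0 < 8 * (q * tanh_half s). Proof. exact: mulr_gt0. Qed.
Let q1 : q < 1.
Proof. by move: t1 q0; rewrite qq; nra. Qed.
Let c0 : 0 < decay_cst ^+ 2. Proof. by rewrite exprn_gt0// decay_cst_gt0. Qed.

Lemma mehler_ge0 : 0 <= mehler s y z.
Proof.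
by rewrite mehler_exponent// !mulr_ge0 ?invr_ge0 ?sqrtr_ge0 ?expR_ge0.
Qed.

Let hm : mehler s y z <= D / q * (decay_cst ^+ 2 * ((1 + P) ^+ 4 * (1 + W) ^+ 4)^-1).
Proof.
rewrite mehler_exponent// -/P -/W.
apply: ler_pM; [|exact: expR_ge0|exact: mehler_prefactor_le|exact: gauss2_le].
by rewrite mulr_ge0 ?invr_ge0 ?sqrtr_ge0.
Qed.

(** A crude bound, whose constant depends on s; it is only used for the
    convergence of the integrals. *)
Lemma mehler_size : mehler s y z <= D / q * decay_cst ^+ 2 * (s / (s + (y - z) ^+ 2)).
Proof.
apply: (le_trans hm); rewrite mulrA ler_wpM2l//.
  by rewrite !mulr_ge0 ?invr_ge0 ?(ltW c0) ?(ltW D0) ?(ltW q0).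
apply: le_trans (tanh_ratio_le _ s0); apply: le_trans (frac_le X1 Y1).
rewrite ler_peMr ?invr_ge0 ?mulr_ge0 ?exprn_ge0//.
by rewrite -[leLHS]mulr1; apply: ler_pM.
Qed.

Let hg : `|dlog_mehler s y z| <= (tanh_half s)^-1 * ((1 + P) * (1 + W)).
Proof.
rewrite dlog_mehlerE// -/P -/W normrM gtr0_norm ?invr_gt0// ler_wpM2l ?invr_ge0 ?(ltW t0)//.
by case/andP: th2 => ? ?; exact: dlog_mehler_arith.
Qed.

(** With P = (y - z)^2 / tanh (s / 2) and W = tanh (s / 2) (y + z)^2, the
    kernel is a Gaussian in P and W times a polynomial. The Gaussian absorbs
    the polynomial and leaves one factor 1 / (1 + P), which is the Poisson
    kernel. *)
Lemma sdmehler_size : `|sdmehler s y z| <= sdmehler_cst * (Num.sqrt s / (s + (y - z) ^+ 2)).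
Proof.
rewrite /sdmehler normrM (ger0_norm mehler_ge0) normrM gtr0_norm//.
apply: (@le_trans _ _ ((D / q * (decay_cst ^+ 2 * ((1 + P) ^+ 4 * (1 + W) ^+ 4)^-1)) *
    (s * ((tanh_half s)^-1 * ((1 + P) * (1 + W)))))).
  apply: ler_pM; rewrite ?mehler_ge0 ?hm ?mulr_ge0 ?(ltW s0)//.
  by rewrite ler_wpM2l ?(ltW s0).
have -> : (D / q * (decay_cst ^+ 2 * ((1 + P) ^+ 4 * (1 + W) ^+ 4)^-1)) *
    (s * ((tanh_half s)^-1 * ((1 + P) * (1 + W)))) =
    decay_cst ^+ 2 * (D * (s / tanh_half s) / q) * (((1 + P) ^+ 4 * (1 + W) ^+ 4)^-1 * ((1 + P) * (1 + W))) by ring.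
have k0 : 0 <= decay_cst ^+ 2 * (D * (s / tanh_half s) / q).
  by rewrite !mulr_ge0 ?invr_ge0 ?(ltW c0) ?(ltW D0) ?(ltW s0) ?(ltW t0) ?(ltW q0).
apply: (@le_trans _ _ (decay_cst ^+ 2 * (D * (s / tanh_half s) / q) * (s / (s + (y - z) ^+ 2)))).
  by rewrite ler_wpM2l//; apply: le_trans (frac_le X1 Y1) _; exact: tanh_ratio_le.
have hs : s / q <= s / tanh_half s * Num.sqrt s.
  rewrite qq; have -> : s / q ^+ 2 * Num.sqrt s = s / q * (Num.sqrt s / q) by field; rewrite gt_eqF.
  rewrite ler_peMr ?divr_ge0 ?(ltW s0) ?(ltW q0)// ler_pdivlMr// mul1r.
  by rewrite ler_wsqrtr// tanh_half_le.
have -> : decay_cst ^+ 2 * (D * (s / tanh_half s) / q) * (s / (s + (y - z) ^+ 2)) =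
  decay_cst ^+ 2 / (s + (y - z) ^+ 2) * (D * (s / tanh_half s)) * (s / q) by ring.
apply: (@le_trans _ _ (decay_cst ^+ 2 / (s + (y - z) ^+ 2) * (D * (s / tanh_half s)) * (s / tanh_half s * Num.sqrt s))).
  by rewrite ler_wpM2l// !mulr_ge0 ?invr_ge0 ?(ltW c0) ?(ltW D0) ?(ltW s0) ?(ltW t0) ?(ltW u0).
have -> : decay_cst ^+ 2 / (s + (y - z) ^+ 2) * (D * (s / tanh_half s)) * (s / tanh_half s * Num.sqrt s) =
  (decay_cst ^+ 2 * (Num.sqrt s / (s + (y - z) ^+ 2))) * (D * (s / tanh_half s) ^+ 2) by ring.
have -> : sdmehler_cst * (Num.sqrt s / (s + (y - z) ^+ 2)) =
  (decay_cst ^+ 2 * (Num.sqrt s / (s + (y - z) ^+ 2))) * 64 by rewrite /sdmehler_cst; ring.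
rewrite ler_wpM2l ?decay_ratio// mulr_ge0 ?(ltW c0)//.
by rewrite divr_ge0 ?sqrtr_ge0 ?(ltW u0).
Qed.

(** The kernel [sdmehler] is the Mehler kernel times s [dlog_mehler]; this is
    the factor that replaces [dlog_mehler] after a derivative in z. *)
Definition dz_factor : R :=
  ((y - z) / (2 * tanh_half s) - tanh_half s * (y + z) / 2) * dlog_mehler s y z
  - (y - z) * (2 * (a s / (2 * (1 - a s) ^+ 2)))
  - (y + z) * (2 * (a s / (2 * (1 + a s) ^+ 2))).

Lemma sdmehler_derive : is_derive z 1 (fun z => sdmehler s y z) (mehler s y z * (s * dz_factor)).
Proof.
have [a0 a1] := (decay_gt0 s, decay_lt1 s0).
(* Squares are written as products to match the shape of the product rule. *)
pose pre := (Num.sqrt pi)^-1 * Num.sqrt (a s / (1 - a s ^+ 2)).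
pose B := a s / (2 * (1 - a s) ^+ 2); pose B' := a s / (2 * (1 + a s) ^+ 2).
have -> : (fun z => sdmehler s y z) = (fun z => (pre *
    expR (- (((y - z) * (y - z) * (tanh_half s)^-1 + tanh_half s * ((y + z) * (y + z))) * 4^-1))) *
    (s * (- (1 + a s ^+ 2) / (2 * (1 - a s ^+ 2)) + (y - z) * (y - z) * B - (y + z) * (y + z) * B'))).
  by apply/funext => r; rewrite /sdmehler mehler_exponent// /dlog_mehler -!expr2.
have du := drvB (drvC y z) (drvI z); have dv := drvD (drvC y z) (drvI z).
have du2 := drvM du du; have dv2 := drvM dv dv.
have dE := drvN (drvM (drvD (drvM du2 (drvC (tanh_half s)^-1 z)) (drvM (drvC (tanh_half s) z) dv2)) (drvC 4^-1 z)).
have dM := drvM (drvC pre z) (drv_expR dE).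
have dG := drvB (drvD (drvC (- (1 + a s ^+ 2) / (2 * (1 - a s ^+ 2))) z) (drvM du2 (drvC B z))) (drvM dv2 (drvC B' z)).
have dall := drvM dM (drvM (drvC s z) dG).
apply: is_derive_eq dall _.
rewrite /dz_factor mehler_exponent// -/pre -/B -/B' /dlog_mehler -/B -/B' -!expr2.
set c := - (1 + _) / _; set E := expR _.
have -> : E = expR (- (((y - z) ^+ 2 / tanh_half s + tanh_half s * (y + z) ^+ 2) / 4)) by [].
by field; rewrite gt_eqF.
Qed.

Let abs_u : `|y - z| <= q * (1 + P) / 2.
Proof.
apply: norm_le_sqr; first by rewrite divr_ge0// mulr_ge0// ltW.
have -> : (y - z) ^+ 2 = q ^+ 2 * P by rewrite /P -qq; field; rewrite gt_eqF.
have -> : (q * (1 + P) / 2) ^+ 2 = q ^+ 2 * ((1 + P) ^+ 2 / 4) by field.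
by rewrite ler_wpM2l ?sqr_ge0//; exact: amgm4.
Qed.

Let abs_v : `|y + z| <= (1 + W) / (2 * q).
Proof.
apply: norm_le_sqr; first by rewrite divr_ge0// mulr_ge0// ltW.
have -> : (y + z) ^+ 2 = (q ^+ 2)^-1 * W by rewrite /W -qq; field; rewrite gt_eqF.
have -> : ((1 + W) / (2 * q)) ^+ 2 = (q ^+ 2)^-1 * ((1 + W) ^+ 2 / 4).
  by field; rewrite gt_eqF.
by rewrite ler_wpM2l ?invr_ge0 ?sqr_ge0//; exact: amgm4.
Qed.

Let dz_factor_le : `|dz_factor| <= ((1 + P) * (1 + W)) ^+ 2 / (q * tanh_half s).
Proof.
have [a0 a1] := (decay_gt0 s, decay_lt1 s0).
pose X := 1 + P; pose Y := 1 + W.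
have XY : X + Y <= 2 * (X * Y) by have := X1; have := Y1; rewrite -/X -/Y; move: X Y => {}X {}Y; nra.
have XY1 : 1 <= X * Y by have := X1; have := Y1; rewrite -/X -/Y; move: X Y XY => {}X {}Y _; nra.
have -> : dz_factor = ((y - z) / (2 * tanh_half s) - tanh_half s * (y + z) / 2) * dlog_mehler s y z
  - ((y - z) * ((1 - tanh_half s ^+ 2) / (4 * tanh_half s ^+ 2)) + (y + z) * ((1 - tanh_half s ^+ 2) / 4)).
  by rewrite /dz_factor /tanh_half; field; rewrite !gt_eqF//; nra.
have h1 : `|(y - z) / (2 * tanh_half s) - tanh_half s * (y + z) / 2| <= X * Y / (2 * q).
  apply: le_trans (ler_normB _ _) _.
  have e1 : `|(y - z) / (2 * tanh_half s)| <= X / (4 * q).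
    rewrite normf_div (gtr0_norm tt0) ler_pdivrMr//; apply: le_trans abs_u _.
    by rewrite qq le_eqVlt; apply/orP; left; apply/eqP; rewrite /X; field; rewrite gt_eqF.
  have e2 : `|tanh_half s * (y + z) / 2| <= Y / (4 * q).
    rewrite -mulrA normrM gtr0_norm// normf_div (ger0_norm (_ : (0:R) <= 2))//.
    have hv : `|y + z| / 2 <= Y / (4 * q).
      rewrite ler_pdivrMr//; apply: le_trans abs_v _.
      by rewrite le_eqVlt; apply/orP; left; apply/eqP; rewrite /Y; field; rewrite gt_eqF.
    apply: le_trans hv; rewrite ler_piMl ?(ltW t1)// divr_ge0//.
  apply: le_trans (lerD e1 e2) _.
  have -> : X / (4 * q) + Y / (4 * q) = (X + Y) / (4 * q) by field; rewrite gt_eqF.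
  have -> : X * Y / (2 * q) = 2 * (X * Y) / (4 * q) by field; rewrite gt_eqF.
  by rewrite ler_wpM2r// invr_ge0 mulr_ge0// ltW.
have h2 : `|(y - z) * ((1 - tanh_half s ^+ 2) / (4 * tanh_half s ^+ 2)) + (y + z) * ((1 - tanh_half s ^+ 2) / 4)| <= X * Y / (4 * (q * tanh_half s)).
  have th3 : 0 <= 1 - tanh_half s ^+ 2 <= 1 by case/andP: th2 => ? ?; apply/andP; split; lra.
  apply: le_trans (ler_normD _ _) _.
  have e1 : `|(y - z) * ((1 - tanh_half s ^+ 2) / (4 * tanh_half s ^+ 2))| <= X / (8 * (q * tanh_half s)).
    rewrite normrM [X in _ * X]ger0_norm; last first.
      by rewrite divr_ge0 ?(ltW t40)//; case/andP: th3.
    apply: (@le_trans _ _ (q * X / 2 * (1 / (4 * tanh_half s ^+ 2)))).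
      apply: ler_pM => //; first by rewrite divr_ge0 ?(ltW t40)//; case/andP: th3.
      by rewrite ler_wpM2r ?invr_ge0 ?(ltW t40)//; case/andP: th3.
    by rewrite qq le_eqVlt; apply/orP; left; apply/eqP; field; rewrite gt_eqF.
  have e2 : `|(y + z) * ((1 - tanh_half s ^+ 2) / 4)| <= Y / (8 * (q * tanh_half s)).
    rewrite normrM [X in _ * X]ger0_norm; last by case/andP: th3 => ? ?; lra.
    apply: (@le_trans _ _ (Y / (2 * q) * (1 / 4))).
      by apply: ler_pM => //; case/andP: th3 => ? ?; lra.
    have -> : Y / (2 * q) * (1 / 4) = Y / (8 * q) by field; rewrite gt_eqF.
    rewrite ler_wpM2l ?(le_trans ler01 Y1)// lef_pV2 ?posrE//.
    by rewrite ler_wpM2l// ler_piMr ?(ltW q0) ?(ltW t1).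
  apply: le_trans (lerD e1 e2) _.
  have -> : X / (8 * (q * tanh_half s)) + Y / (8 * (q * tanh_half s)) = (X + Y) / (8 * (q * tanh_half s)).
    by field; rewrite !gt_eqF.
  have -> : X * Y / (4 * (q * tanh_half s)) = 2 * (X * Y) / (8 * (q * tanh_half s)).
    by field; rewrite !gt_eqF.
  by rewrite ler_wpM2r// invr_ge0 (ltW qt8).
apply: le_trans (ler_normB _ _) _; rewrite normrM.
apply: (@le_trans _ _ (X * Y / (2 * q) * ((tanh_half s)^-1 * (X * Y)) + X * Y / (4 * (q * tanh_half s)))).
  by apply: lerD => //; apply: ler_pM.
have -> : X * Y / (2 * q) * ((tanh_half s)^-1 * (X * Y)) + X * Y / (4 * (q * tanh_half s)) =
  ((X * Y) ^+ 2 / 2 + X * Y / 4) / (q * tanh_half s) by field; rewrite !gt_eqF.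
rewrite -/X -/Y ler_wpM2r ?invr_ge0 ?(ltW qt)//.
exact: sq_half.
Qed.

(** The derivative in z costs a factor 1 / sqrt (tanh (s / 2)) and polynomial
    factors in P and W; two factors 1 / (1 + P) of the Gaussian decay are
    left. *)
Lemma sdmehler_derive_size : `|mehler s y z * (s * dz_factor)| <= sdmehler_cst * (s / (s + (y - z) ^+ 2) ^+ 2).
Proof.
rewrite normrM (ger0_norm mehler_ge0) normrM gtr0_norm//.
apply: (@le_trans _ _ ((D / q * (decay_cst ^+ 2 * ((1 + P) ^+ 4 * (1 + W) ^+ 4)^-1)) *
    (s * (((1 + P) * (1 + W)) ^+ 2 / (q * tanh_half s))))).
  apply: ler_pM; rewrite ?mehler_ge0 ?hm ?mulr_ge0 ?(ltW s0)//.
  by rewrite ler_wpM2l ?(ltW s0).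
have -> : (D / q * (decay_cst ^+ 2 * ((1 + P) ^+ 4 * (1 + W) ^+ 4)^-1)) *
    (s * (((1 + P) * (1 + W)) ^+ 2 / (q * tanh_half s))) =
    decay_cst ^+ 2 * (D * s / (q ^+ 2 * tanh_half s)) *
    (((1 + P) ^+ 4 * (1 + W) ^+ 4)^-1 * ((1 + P) * (1 + W)) ^+ 2).
  by rewrite !invfM; ring.
rewrite -qq -expr2.
apply: (@le_trans _ _ (decay_cst ^+ 2 * (D * s / tanh_half s ^+ 2) * (s / (s + (y - z) ^+ 2)) ^+ 2)).
  rewrite ler_wpM2l//.
    by rewrite !mulr_ge0 ?invr_ge0 ?sqr_ge0 ?(ltW c0) ?(ltW D0) ?(ltW s0).
  apply: le_trans (frac_le2 X1 Y1) _.
  have x0 : 0 <= (1 + P)^-1 by rewrite invr_ge0 (le_trans ler01).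
  by rewrite lerXn2r ?nnegrE ?divr_ge0 ?(ltW s0) ?(ltW u0)//; exact: tanh_ratio_le.
have -> : decay_cst ^+ 2 * (D * s / tanh_half s ^+ 2) * (s / (s + (y - z) ^+ 2)) ^+ 2 =
  (decay_cst ^+ 2 * (s / (s + (y - z) ^+ 2) ^+ 2)) * (D * (s / tanh_half s) ^+ 2).
  by field; rewrite !gt_eqF.
have -> : sdmehler_cst * (s / (s + (y - z) ^+ 2) ^+ 2) =
  (decay_cst ^+ 2 * (s / (s + (y - z) ^+ 2) ^+ 2)) * 64 by rewrite /sdmehler_cst; ring.
rewrite ler_wpM2l ?decay_ratio// mulr_ge0 ?(ltW c0)//.
by rewrite divr_ge0 ?sqr_ge0 ?(ltW s0).
Qed.

End kernel_bounds.

(** The bound is stated at the intermediate point c of the mean value theorem;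
    where it is used, z' is the centre of an interval that contains z, hence
    c. *)
Lemma sdmehler_lipschitz s y z z' : 0 < s -> exists2 c : R, `|c - z'| <= `|z - z'| &
  `|sdmehler s y z - sdmehler s y z'| <= sdmehler_cst * (s / (s + (y - c) ^+ 2) ^+ 2) * `|z - z'|.
Proof.
move=> s0.
have main u v : u <= v -> exists2 c : R, u <= c <= v &
    `|sdmehler s y v - sdmehler s y u| <= sdmehler_cst * (s / (s + (y - c) ^+ 2) ^+ 2) * `|v - u|.
  move=> uv; have [|c cuv ->] := @MVT_segment R (fun z => sdmehler s y z)
     (fun z => mehler s y z * (s * dz_factor s y z)) u v uv (fun x _ => sdmehler_derive y x s0).
    apply: derivable_within_continuous => x _.
    by have [] := sdmehler_derive y x s0.
  exists c; first by move: cuv; rewrite in_itv.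
  by rewrite normrM ler_wpM2r// sdmehler_derive_size.
have [zz|/ltW zz] := leP z z'.
  have [c /andP[c1 c2] h] := main _ _ zz; exists c; last by rewrite distrC (distrC z).
  by rewrite distrC (distrC z) !ger0_norm ?subr_ge0//; lra.
have [c /andP[c1 c2] h] := main _ _ zz; exists c => //.
by rewrite !ger0_norm ?subr_ge0//; lra.
Qed.

End mehler_kernel.

(** * Measurability and differentiation of the heat integrals *)

Section measurability_tools.
Context {R : realType}.

Lemma measurable_inv : measurable_fun [set: R] (fun x : R => x^-1).
Proof.
rewrite (_ : (fun x : R => x^-1) =
    (fun x => if 0 <= x then x `^ (-1) else - ((- x) `^ (-1)))); last first.
  apply/funext => x; case: ifPn => x0; first by rewrite powR_inv1.
  by rewrite powR_inv1 ?oppr_ge0 ?ltW ?ltNge// invrN opprK.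
apply: measurable_fun_ifT => /=.
- by apply: measurable_fun_ler.
- exact: measurable_powR.
- apply: measurableT_comp => //; apply: (measurableT_comp (measurable_powR _)).
  exact: oppr_measurable.
Qed.

Lemma measurable_sqrt : measurable_fun [set: R] (@Num.sqrt R).
Proof.
rewrite (_ : @Num.sqrt R = (fun x => if 0 <= x then x `^ 2^-1 else 0)); last first.
  apply/funext => x; case: ifPn => x0; first by rewrite powR12_sqrt.
  by rewrite ler0_sqrtr// ltW// ltNge.
by apply: measurable_fun_ifT => //=; apply: measurable_fun_ler.
Qed.

Context d (T : measurableType d).
Implicit Types f g : T -> R.

Lemma mfV f : measurable_fun setT f -> measurable_fun setT (fun x => (f x)^-1).
Proof. by move=> mf; exact: (measurableT_comp measurable_inv). Qed.

Lemma mfN f : measurable_fun setT f -> measurable_fun setT (fun x => - f x).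
Proof. by move=> mf; exact: measurableT_comp. Qed.

Lemma mfexp f : measurable_fun setT f -> measurable_fun setT (fun x => expR (f x)).
Proof. by move=> mf; exact: (measurableT_comp (@measurable_expR R)). Qed.

Lemma mfsqrt f : measurable_fun setT f -> measurable_fun setT (fun x => Num.sqrt (f x)).
Proof. by move=> mf; exact: (measurableT_comp measurable_sqrt). Qed.

Lemma mfM f g : measurable_fun setT f -> measurable_fun setT g -> measurable_fun setT (fun x => f x * g x).
Proof. by move=> mf mg; exact: measurable_funM. Qed.

Lemma mfD f g : measurable_fun setT f -> measurable_fun setT g -> measurable_fun setT (fun x => f x + g x).
Proof. by move=> mf mg; exact: measurable_funD. Qed.

Lemma mfX f n : measurable_fun setT f -> measurable_fun setT (fun x => f x ^+ n).
Proof. by move=> mf; exact: measurable_funX. Qed.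

Lemma mf_mehler (r x y : T -> R) : measurable_fun setT r ->
  measurable_fun setT x -> measurable_fun setT y ->
  measurable_fun setT (fun p => mehler (r p) (x p) (y p)).
Proof.
move=> mr mx my; have ma : measurable_fun setT (fun p => expR (- r p)) by exact/mfexp/mfN.
have m2 : measurable_fun setT (fun p => 1 - expR (- (2 * r p))).
  by apply: mfD => //; apply/mfN/mfexp/mfN/mfM.
apply: mfM; [apply: mfM => //; apply/mfsqrt/mfM => //; exact: mfV|].
apply/mfexp/mfN/mfM; last by apply/mfV/mfM.
by apply: mfD; apply/mfX/mfD => //; apply/mfN/mfM.
Qed.

Lemma mf_dlog_mehler (r x y : T -> R) : measurable_fun setT r ->
  measurable_fun setT x -> measurable_fun setT y ->
  measurable_fun setT (fun p => dlog_mehler (r p) (x p) (y p)).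
Proof.
move=> mr mx my; have ma : measurable_fun setT (fun p => expR (- r p)) by exact/mfexp/mfN.
have ma2 : measurable_fun setT (fun p => expR (- r p) ^+ 2) by exact: mfX.
apply: mfD; [apply: mfD|apply: mfN].
- apply: mfM; [by apply/mfN/mfD|apply/mfV/mfM => //; apply/mfD => //; exact: mfN].
- apply: mfM; first by apply/mfX/mfD => //; exact: mfN.
  by apply: mfM => //; apply/mfV/mfM => //; apply/mfX/mfD => //; exact: mfN.
- apply: mfM; first by apply/mfX/mfD.
  by apply: mfM => //; apply/mfV/mfM => //; apply/mfX/mfD.
Qed.

Lemma mf_sdmehler (r x y : T -> R) : measurable_fun setT r ->
  measurable_fun setT x -> measurable_fun setT y ->
  measurable_fun setT (fun p => sdmehler (r p) (x p) (y p)).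
Proof.
by move=> mr mx my; apply: mfM; [exact: mf_mehler|apply: mfM => //; exact: mf_dlog_mehler].
Qed.

Lemma mf_Rintegral d2 (T2 : measurableType d2) (m : {sigma_finite_measure set T2 -> \bar R})
    (G : T * T2 -> R) : measurable_fun setT G ->
  measurable_fun setT (fun p => \int[m]_z G (p, z)).
Proof.
move=> mG; rewrite /Rintegral.
under eq_fun do rewrite integralE.
have mE : measurable_fun setT (EFin \o G) by exact/measurable_EFinP.
apply: (measurableT_comp (f := fine)) => //; apply: emeasurable_funB.
- rewrite (_ : (fun x => _) = fubini_F m (EFin \o G)^\+%E); last first.
    by apply/funext => p; rewrite /fubini_F; apply: eq_integral => z _; rewrite ?funeposE ?funenegE.
  by apply: measurable_fun_fubini_tonelli_F => //; exact: measurable_funepos.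
- rewrite (_ : (fun x => _) = fubini_F m (EFin \o G)^\-%E); last first.
    by apply/funext => p; rewrite /fubini_F; apply: eq_integral => z _; rewrite ?funeposE ?funenegE.
  by apply: measurable_fun_fubini_tonelli_F => //; exact: measurable_funeneg.
Qed.

End measurability_tools.

Section tame_functions.
Context {R : realType}.
Local Notation mu := (@lebesgue_measure R).
Implicit Types (f g : R -> R) (x y z t : R).

(** Integrability against 1 / (1 + z^2), the decay of the kernels. The class
    contains L^p for every p >= 1 ([tame_Lp]), and W_s f and s d/ds W_s f are
    given by absolutely convergent integrals on it. *)
Definition tame f := measurable_fun setT f /\
  (\int[mu]_z (`|f z| / (1 + z ^+ 2))%:E < +oo)%E.

Lemma tame_le f g : measurable_fun setT f -> (forall z, `|f z| <= `|g z|) ->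
  tame g -> tame f.
Proof.
move=> mf fg [mg gy]; split => //; apply: le_lt_trans gy.
apply: le_int0 => z _; first by rewrite lee_fin divr_ge0// addr_ge0// sqr_ge0.
by rewrite lee_fin ler_wpM2r// invr_ge0 addr_ge0// sqr_ge0.
Qed.

Lemma tame_integrable f : mu.-integrable setT (EFin \o f) -> tame f.
Proof.
move=> /integrableP[/measurable_EFinP mf fy]; split => //; apply: le_lt_trans fy.
have p1 z : 1 <= 1 + z ^+ 2 by rewrite lerDl sqr_ge0.
apply: le_int0 => z _; rewrite lee_fin.
  by rewrite divr_ge0// (le_trans ler01).
by rewrite ler_pdivrMr ?(lt_le_trans ltr01)// ler_peMr.
Qed.

Lemma poisson_le_weight t y z : 0 < t ->
  t / (t ^+ 2 + (y - z) ^+ 2) <= t * ((1 + 2 * y ^+ 2) / t ^+ 2 + 2) / (1 + z ^+ 2).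
Proof.
move=> t0; have tt0 : 0 < t ^+ 2 by rewrite exprn_gt0.
have d0 : 0 < t ^+ 2 + (y - z) ^+ 2 by rewrite ltr_wpDr ?sqr_ge0.
have z0 : 0 < 1 + z ^+ 2 by rewrite ltr_wpDr ?sqr_ge0.
rewrite -mulrA ler_pM2l// ler_pdivlMr// mulrC ler_pdivrMr// mulrDl.
have h1 : 1 + 2 * y ^+ 2 <= (1 + 2 * y ^+ 2) / t ^+ 2 * (t ^+ 2 + (y - z) ^+ 2).
  rewrite mulrDr divfK ?gt_eqF// lerDl mulr_ge0 ?sqr_ge0// divr_ge0 ?ltW//.
  by rewrite ltr_wpDr// mulr_ge0// sqr_ge0.
have h2 : z ^+ 2 <= 2 * y ^+ 2 + 2 * (y - z) ^+ 2.
  by have := sqr_ge0 (y + (y - z)); have := sqr_ge0 z; rewrite !expr2; lra.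
move: h1 h2; set H := _ / _ * _ => h1 h2; rewrite mulrDr; lra.
Qed.

Lemma tame_poisson f t y : tame f -> 0 < t ->
  (\int[mu]_z (t / (t ^+ 2 + (y - z) ^+ 2) * `|f z|)%:E < +oo)%E.
Proof.
move=> [mf fy] t0.
pose c := t * ((1 + 2 * y ^+ 2) / t ^+ 2 + 2).
have c0 : 0 <= c.
  rewrite mulr_ge0 ?(ltW t0)// addr_ge0// divr_ge0 ?sqr_ge0//.
  by rewrite addr_ge0// mulr_ge0 ?sqr_ge0.
apply: (@le_lt_trans _ _ (\int[mu]_z (c%:E * (`|f z| / (1 + z ^+ 2))%:E))%E).
  apply: le_int0 => z _; rewrite -?EFinM lee_fin.
    by rewrite mulr_ge0// divr_ge0 ?(ltW t0)// addr_ge0 ?sqr_ge0.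
  rewrite mulrCA mulrC; apply: ler_wpM2l => //; exact: poisson_le_weight.
rewrite ge0_integralZl_EFin//.
- by rewrite lte_mul_pinfty.
- by move=> z _; rewrite lee_fin divr_ge0// addr_ge0// sqr_ge0.
- apply/measurable_EFinP/mfM; first exact: measurableT_comp.
  by apply/mfV/mfD => //; exact: mfX.
Qed.

Lemma tame_loc f : tame f -> locally_integrable setT f.
Proof.
move=> tf; have [mf _] := tf; split => //; first exact: openT.
move=> K _ cK.
have [M [Mr KM]] := compact_bounded cK.
pose B := `|M| + 1.
have KB z : K z -> `|z| <= B.
  by move=> Kz; apply: KM => //; rewrite /B (le_lt_trans (ler_norm M))// ltrDl.
have B0 : 0 <= B by rewrite addr_ge0.
have mw : measurable_fun setT (fun z => (1 / (1 ^+ 2 + (0 - z) ^+ 2) * `|f z|)%:E).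
  apply/measurable_EFinP/mfM; last exact: measurableT_comp.
  by apply/mfM => //; apply/mfV/mfD => //; apply/mfX/mfD => //; exact: mfN.
have w0 z : (0 <= (1 / (1 ^+ 2 + (0 - z) ^+ 2) * `|f z|)%:E)%E.
  by rewrite lee_fin mulr_ge0// divr_ge0// addr_ge0 ?sqr_ge0.
apply: (@le_lt_trans _ _ (\int[mu]_z ((1 + B ^+ 2)%:E *
   (1 / (1 ^+ 2 + (0 - z) ^+ 2) * `|f z|)%:E))%E); last first.
  rewrite ge0_integralZl_EFin//; last by rewrite addr_ge0 ?sqr_ge0.
  rewrite lte_mul_pinfty ?lee_fin ?addr_ge0 ?sqr_ge0//.
  exact: tame_poisson.
apply: (@le_trans _ _ (\int[mu]_(z in K) ((1 + B ^+ 2)%:E *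
   (1 / (1 ^+ 2 + (0 - z) ^+ 2) * `|f z|)%:E))%E); last first.
  apply: le_int0_set => // z _.
  by apply: mule_ge0; [rewrite lee_fin addr_ge0 ?sqr_ge0|exact: w0].
apply: le_int0 => z Kz; first by rewrite lee_fin.
rewrite -EFinM lee_fin mulrA ler_peMl// expr1n sub0r sqrrN mulrA mulr1.
rewrite ler_pdivlMr ?ltr_wpDr ?sqr_ge0// mul1r lerD2l -(real_normK (num_real z)).
by rewrite ler_sqr ?nnegrE//; exact: KB.
Qed.

Lemma sdmehler_integrable f s y : tame f -> 0 < s ->
  mu.-integrable setT (fun z => (sdmehler s y z * f z)%:E).
Proof.
move=> tf s0; have [mf _] := tf.
have t0 : 0 < Num.sqrt s by rewrite sqrtr_gt0.
apply/integrableP; split.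
  by apply/measurable_EFinP/mfM => //; apply: mf_sdmehler.
apply: (@le_lt_trans _ _ (\int[mu]_z (sdmehler_cst%:E *
   (Num.sqrt s / ((Num.sqrt s) ^+ 2 + (y - z) ^+ 2) * `|f z|)%:E))%E).
  apply: le_int0 => z _ //=; rewrite lee_fin normrM mulrA ler_wpM2r//.
  by rewrite sqr_sqrtr ?(ltW s0)// sdmehler_size.
rewrite ge0_integralZl_EFin//.
- by rewrite lte_mul_pinfty ?lee_fin ?(ltW sdmehler_cst_gt0)//; exact: tame_poisson.
- move=> z _; rewrite lee_fin mulr_ge0// divr_ge0 ?(ltW t0)// addr_ge0 ?sqr_ge0//.
- apply/measurable_EFinP/mfM; last exact: measurableT_comp.
  by apply/mfM => //; apply/mfV/mfD => //; apply/mfX/mfD => //; exact: mfN.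
- exact/ltW/sdmehler_cst_gt0.
Qed.

Lemma mehler_integrable f s y : tame f -> 0 < s ->
  mu.-integrable setT (fun z => (mehler s y z * f z)%:E).
Proof.
move=> tf s0; have [mf _] := tf.
have t0 : 0 < Num.sqrt s by rewrite sqrtr_gt0.
pose c : R := expR (- (s / 2)) / Num.sqrt (tanh_half s) * decay_cst ^+ 2 * Num.sqrt s.
have c0 : 0 <= c.
  by rewrite !mulr_ge0 ?invr_ge0 ?sqrtr_ge0 ?expR_ge0 ?exprn_ge0.
apply/integrableP; split.
  by apply/measurable_EFinP/mfM => //; apply: mf_mehler.
apply: (@le_lt_trans _ _ (\int[mu]_z (c%:E *
   (Num.sqrt s / ((Num.sqrt s) ^+ 2 + (y - z) ^+ 2) * `|f z|)%:E))%E).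
  apply: le_int0 => z _ //=; rewrite lee_fin normrM mulrA ler_wpM2r//.
  rewrite ger0_norm ?mehler_ge0//; apply: (le_trans (mehler_size y z s0)).
  rewrite /c sqr_sqrtr ?(ltW s0)// -!mulrA [Num.sqrt s * (_ * _)]mulrA -expr2.
  by rewrite sqr_sqrtr ?(ltW s0).
rewrite ge0_integralZl_EFin//.
- by rewrite lte_mul_pinfty//; exact: tame_poisson.
- move=> z _; rewrite lee_fin mulr_ge0// divr_ge0 ?(ltW t0)// addr_ge0 ?sqr_ge0//.
- apply/measurable_EFinP/mfM; last exact: measurableT_comp.
  by apply/mfM => //; apply/mfV/mfD => //; apply/mfX/mfD => //; exact: mfN.
Qed.

(** Differentiation under the integral sign; on (s / 2, 2 s) the size estimate
    provides a dominating Poisson kernel that does not depend on the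
    parameter. *)
Lemma heat_derive_cvg f s y : tame f -> 0 < s ->
  h^-1 *: ((\int[mu]_z (mehler (h + s) y z * f z)) - \int[mu]_z (mehler s y z * f z))
    @[h --> 0^'] --> \int[mu]_z (mehler s y z * dlog_mehler s y z * f z).
Proof.
move=> tf s0; have [mf _] := tf.
pose u := s / 2; pose v := 2 * s.
have u0 : 0 < u by rewrite divr_gt0.
have Is : `]u, v[%classic s by rewrite /= in_itv/=; apply/andP; split; rewrite /u /v; lra.
have I0 r : `]u, v[%classic r -> 0 < r.
  by rewrite /= in_itv/= => /andP[ur _]; exact: lt_trans ur.
have dd (r z : R) : 0 < r -> is_derive r 1 (fun r => mehler r y z * f z) (mehler r y z * dlog_mehler r y z * f z).
  move=> r0; apply: is_derive_eq (drvM (mehler_derive y z r0) (drvC (f z) r)) _.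
  by rewrite mulr0 addr0.
have d1E (r z : R) : 0 < r -> partial1of2 (fun r z => mehler r y z * f z) r z = mehler r y z * dlog_mehler r y z * f z.
  by move=> r0; rewrite partial1of2E; have [_ ->] := dd r z r0.
have t0 : 0 < Num.sqrt u by rewrite sqrtr_gt0.
pose c := sdmehler_cst * Num.sqrt v / u / Num.sqrt u.
have c0 : 0 <= c by rewrite !mulr_ge0 ?invr_ge0 ?sqrtr_ge0 ?(ltW sdmehler_cst_gt0) ?(ltW u0).
pose G z := c * (Num.sqrt u / ((Num.sqrt u) ^+ 2 + (y - z) ^+ 2) * `|f z|).
have := @cvg_differentiation_under_integral R _ _ mu (fun r z => mehler r y z * f z)
  setT measurableT s u v Is _ _ G _ _ _.
move=> H; under [X in _ --> X]eq_Rintegral do rewrite -d1E//.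
apply: H.
- by move=> r Ir; exact: mehler_integrable (I0 _ Ir).
- by move=> r z Ir _; have [] := dd r z (I0 _ Ir).
- by move=> z; rewrite /G mulr_ge0// mulr_ge0// divr_ge0 ?(ltW t0)// addr_ge0 ?sqr_ge0.
- apply/integrableP; split.
    apply/measurable_EFinP/mfM => //; apply/mfM; last exact: measurableT_comp.
    by apply/mfM => //; apply/mfV/mfD => //; apply/mfX/mfD => //; exact: mfN.
  apply: (@le_lt_trans _ _ (\int[mu]_z (c%:E *
   (Num.sqrt u / ((Num.sqrt u) ^+ 2 + (y - z) ^+ 2) * `|f z|)%:E))%E).
    apply: le_int0 => z _ //=; rewrite lee_fin ger0_norm// /G.
    by rewrite mulr_ge0// mulr_ge0// divr_ge0 ?(ltW t0)// addr_ge0 ?sqr_ge0.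
  rewrite ge0_integralZl_EFin//.
  + by rewrite lte_mul_pinfty//; exact: tame_poisson.
  + move=> z _; rewrite lee_fin mulr_ge0// divr_ge0 ?(ltW t0)// addr_ge0 ?sqr_ge0//.
  + apply/measurable_EFinP/mfM; last exact: measurableT_comp.
    by apply/mfM => //; apply/mfV/mfD => //; apply/mfX/mfD => //; exact: mfN.
- move=> r z Ir _; have r0 := I0 _ Ir; rewrite d1E// normrM /G mulrA ler_wpM2r//.
  have -> : mehler r y z * dlog_mehler r y z = r^-1 * sdmehler r y z.
    by rewrite /sdmehler; field; rewrite gt_eqF.
  rewrite normrM gtr0_norm ?invr_gt0//.
  move: Ir; rewrite /= in_itv/= => /andP[ur rv].
  have ud : 0 < u + (y - z) ^+ 2 by rewrite ltr_wpDr ?sqr_ge0.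
  have rd : 0 < r + (y - z) ^+ 2 by rewrite ltr_wpDr ?sqr_ge0.
  apply: (@le_trans _ _ (u^-1 * (sdmehler_cst * (Num.sqrt v / (u + (y - z) ^+ 2))))).
    apply: ler_pM => //; first by rewrite invr_ge0 ltW.
      by rewrite lef_pV2 ?posrE ?(ltW ur).
    apply: (le_trans (sdmehler_size y z r0)); rewrite ler_wpM2l ?(ltW sdmehler_cst_gt0)//.
    apply: ler_pM; rewrite ?sqrtr_ge0 ?invr_ge0 ?(ltW rd)//.
      by rewrite ler_wsqrtr// ltW.
    by rewrite lef_pV2 ?posrE// lerD2r ltW.
  rewrite sqr_sqrtr ?(ltW u0)// /c le_eqVlt; apply/orP; left; apply/eqP.
  by field; rewrite !gt_eqF.
Qed.

Lemma heat_derive f s y : tame f -> 0 < s ->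
  derive1 (fun r => \int[mu]_z (mehler r y z * f z)) s =
  \int[mu]_z (mehler s y z * dlog_mehler s y z * f z).
Proof. by move=> tf s0; apply: cvg_lim => //; exact: heat_derive_cvg. Qed.

End tame_functions.

(** * The heat semigroup on bounded integrable functions *)

Section heat_operator.
Context {R : realType}.
Local Notation mu := (@lebesgue_measure R).
Implicit Types (f g u v : R -> R) (r s t x y z : R).

Lemma mehler_sym s x y : mehler s x y = mehler s y x.
Proof. by rewrite /mehler (addrC ((x - _) ^+ 2)). Qed.

(** Dropping the term in (x + y)^2 leaves the density of a normal law centred
    at x of variance 2 tanh (s / 2), up to a prefactor at most 1, by the
    inequality 4 a <= (1 + a)^2. *)
Lemma mehler_le_normal s x y : 0 < s ->
  mehler s x y <= normal_pdf x (Num.sqrt (2 * tanh_half s)) y.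
Proof.
move=> s0; have t0 := tanh_half_gt0 s0; have [a0 a1] := (decay_gt0 s, decay_lt1 s0).
have tt0 : 0 < 2 * tanh_half s by exact: mulr_gt0.
have b0 : 0 < 1 - expR (- s) ^+ 2 by nra.
have q0 : Num.sqrt (2 * tanh_half s) != 0 by rewrite gt_eqF// sqrtr_gt0.
have p0 : 0 < pi :> R by exact: pi_gt0.
rewrite normal_pdfE// /normal_pdf /normal_fun /normal_peak sqr_sqrtr ?(ltW tt0)//.
rewrite mehler_exponent//; apply: ler_pM; rewrite ?expR_ge0//.
- rewrite -!sqrtrV ?(ltW p0)//; last by rewrite mulrn_wge0// mulr_ge0 ?(ltW tt0) ?(ltW p0).
  rewrite -sqrtrM ?invr_ge0 ?(ltW p0)// ler_wsqrtr//.
  rewrite mulrC ler_pdivrMr//.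
  have -> : (2 * tanh_half s * pi *+ 2)^-1 * pi = (4 * tanh_half s)^-1.
    rewrite -mulr_natr; move: (tanh_half s) t0 (pi : R) p0; clear => h h0 P P0.
    by field; rewrite !gt_eqF.
  rewrite /tanh_half; set a := expR _; rewrite -subr_ge0.
  have -> : (4 * ((1 - a) / (1 + a)))^-1 - a / (1 - a ^+ 2) = (1 - a) ^+ 2 / (4 * (1 - a ^+ 2)).
    by rewrite /a; field; rewrite !gt_eqF//; nra.
  by rewrite divr_ge0 ?sqr_ge0 ?mulr_ge0 ?(ltW b0).
- rewrite ler_expR.
  have -> : - (y - x) ^+ 2 / (2 * tanh_half s *+ 2) = - ((x - y) ^+ 2 / tanh_half s / 4).
    by rewrite -mulr_natr; move: (tanh_half s) t0; clear => h h0; field; rewrite gt_eqF.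
  rewrite lerN2 mulrDl lerDl divr_ge0// mulr_ge0 ?sqr_ge0 ?(ltW t0)//.
Qed.

Lemma int_mehler_le1 s x : 0 < s -> (\int[mu]_y (mehler s x y)%:E <= 1)%E.
Proof.
move=> s0; rewrite -(integral_normal_pdf x (Num.sqrt (2 * tanh_half s))).
by apply: le_int0 => y _; rewrite lee_fin ?mehler_ge0// mehler_le_normal.
Qed.

(** Completing the square in y: the product of the two Gaussians is a Gaussian
    in y, of mean m and variance sg^2, whose total mass is the Mehler kernel
    of a + b. *)
Lemma mehler_semigroup_pdf a b x z : 0 < a -> 0 < b -> exists m sg : R,
  forall y, mehler a x y * mehler b y z = mehler (a + b) x z * normal_pdf m sg y.
Proof.
move=> a0 b0.
have ab0 : 0 < a + b by exact: addr_gt0.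
pose A := expR (- a); pose B := expR (- b).
have [A0 A1] : 0 < A /\ A < 1 by split; [exact: decay_gt0|exact: decay_lt1].
have [B0 B1] : 0 < B /\ B < 1 by split; [exact: decay_gt0|exact: decay_lt1].
have AB : expR (- (a + b)) = A * B by rewrite opprD expRD.
have [A2 B2] : 0 < 1 - A ^+ 2 /\ 0 < 1 - B ^+ 2 by split; nra.
have ABl : A * B < 1 by nra.
have AB2 : 0 < 1 - (A * B) ^+ 2 by nra.
(* The coefficient of y^2 in the exponent is - 1 / (2 sg2), and the linear
   term fixes m. *)
pose sg2 := (1 - A ^+ 2) * (1 - B ^+ 2) / (2 * (1 - (A * B) ^+ 2)).
have sg20 : 0 < sg2 by rewrite divr_gt0 ?mulr_gt0.
pose m := sg2 * (x * (2 * A / (1 - A ^+ 2)) + z * (2 * B / (1 - B ^+ 2))).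
have p0 : 0 < pi :> R by exact: pi_gt0.
exists m, (Num.sqrt sg2) => y.
have sg0 : Num.sqrt sg2 != 0 by rewrite gt_eqF// sqrtr_gt0.
have e2 s : expR (- (2 * s)) = expR (- s) ^+ 2 by rewrite -expRM_natl mulrN.
rewrite normal_pdfE// /normal_fun /normal_peak sqr_sqrtr ?(ltW sg20)//.
rewrite /mehler !e2 AB -/A -/B.
have X0 : 0 <= sg2 * pi *+ 2 by rewrite mulrn_wge0// mulr_ge0 ?(ltW sg20) ?(ltW p0).
have [d1 [d2 d3]] : 0 <= A / (1 - A ^+ 2) /\ 0 <= B / (1 - B ^+ 2) /\ 0 <= A * B / (1 - (A * B) ^+ 2).
  by split; [|split]; rewrite divr_ge0 ?mulr_ge0 ?(ltW A0) ?(ltW B0) ?(ltW A2) ?(ltW B2) ?(ltW AB2).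
have pre : Num.sqrt (A / (1 - A ^+ 2)) * Num.sqrt (B / (1 - B ^+ 2)) =
   Num.sqrt pi * (Num.sqrt (A * B / (1 - (A * B) ^+ 2)) * (Num.sqrt (sg2 * pi *+ 2))^-1).
  rewrite -sqrtrV// -!sqrtrM// ?(ltW p0)//; congr Num.sqrt.
  rewrite -mulr_natr /sg2; move: (pi : R) p0 A2 B2 AB2; clear; move: A B => A B P P0 A2 B2 AB2.
  by field; rewrite !gt_eqF.
have sp0 : Num.sqrt pi != 0 :> R by rewrite gt_eqF// sqrtr_gt0.
transitivity ((Num.sqrt pi)^-1 ^+ 2 * (Num.sqrt (A / (1 - A ^+ 2)) * Num.sqrt (B / (1 - B ^+ 2))) *
  expR (- (((x - A * y) ^+ 2 + (y - A * x) ^+ 2) / (2 * (1 - A ^+ 2))) +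
        - (((y - B * z) ^+ 2 + (z - B * y) ^+ 2) / (2 * (1 - B ^+ 2))))).
  by rewrite expRD; ring.
rewrite pre.
transitivity ((Num.sqrt pi)^-1 * Num.sqrt (A * B / (1 - (A * B) ^+ 2)) * (Num.sqrt (sg2 * pi *+ 2))^-1 *
  expR (- (((x - A * B * z) ^+ 2 + (z - A * B * x) ^+ 2) / (2 * (1 - (A * B) ^+ 2))) +
    - (y - m) ^+ 2 / (sg2 *+ 2))); last by rewrite expRD; ring.
congr (_ * expR _).
  by rewrite expr2 -[LHS]mulrA mulKf// mulrA.
pose al := (1 - (A * B) ^+ 2) / ((1 - A ^+ 2) * (1 - B ^+ 2)).
pose a1 := A / (1 - A ^+ 2); pose b1 := B / (1 - B ^+ 2).
pose be := x * a1 + z * b1.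
pose ga := (1 + A ^+ 2) / (2 * (1 - A ^+ 2)) * x ^+ 2 + (1 + B ^+ 2) / (2 * (1 - B ^+ 2)) * z ^+ 2.
have al0 : al != 0 by rewrite /al gt_eqF// divr_gt0 ?mulr_gt0.
have e1 : ((x - A * y) ^+ 2 + (y - A * x) ^+ 2) / (2 * (1 - A ^+ 2)) =
    (1 + A ^+ 2) / (2 * (1 - A ^+ 2)) * (x ^+ 2 + y ^+ 2) - 2 * x * y * a1.
  by rewrite /a1; field; rewrite gt_eqF.
have e3 : ((y - B * z) ^+ 2 + (z - B * y) ^+ 2) / (2 * (1 - B ^+ 2)) =
    (1 + B ^+ 2) / (2 * (1 - B ^+ 2)) * (z ^+ 2 + y ^+ 2) - 2 * z * y * b1.
  by rewrite /b1; field; rewrite gt_eqF.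
have ca : al = (1 + A ^+ 2) / (2 * (1 - A ^+ 2)) + (1 + B ^+ 2) / (2 * (1 - B ^+ 2)).
  by rewrite /al; field; rewrite !gt_eqF.
have L1 : - (((x - A * y) ^+ 2 + (y - A * x) ^+ 2) / (2 * (1 - A ^+ 2))) +
    - (((y - B * z) ^+ 2 + (z - B * y) ^+ 2) / (2 * (1 - B ^+ 2))) =
    - (al * y ^+ 2 - 2 * be * y + ga).
  by rewrite e1 e3 ca /be /ga; ring.
have sgE : sg2 = (2 * al)^-1.
  by rewrite /sg2 /al; field; rewrite !gt_eqF.
have mE : m = be / al.
  by rewrite /m sgE /be /a1 /b1; field; rewrite al0 !gt_eqF.
have L2 : - (y - m) ^+ 2 / (sg2 *+ 2) = - (al * y ^+ 2 - 2 * be * y + be ^+ 2 / al).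
  by rewrite -mulr_natr mE sgE; move: al0; clear; move: al be => al be al0; field.
rewrite L1 L2.
have x2 : (1 + A ^+ 2) / (2 * (1 - A ^+ 2)) - a1 ^+ 2 / al = (1 + (A * B) ^+ 2) / (2 * (1 - (A * B) ^+ 2)).
  by rewrite /a1 /al; field; rewrite !gt_eqF.
have z2 : (1 + B ^+ 2) / (2 * (1 - B ^+ 2)) - b1 ^+ 2 / al = (1 + (A * B) ^+ 2) / (2 * (1 - (A * B) ^+ 2)).
  by rewrite /b1 /al; field; rewrite !gt_eqF.
have xz : a1 * b1 / al = A * B / (1 - (A * B) ^+ 2).
  by rewrite /a1 /b1 /al; field; rewrite !gt_eqF.
have L3 : ((x - A * B * z) ^+ 2 + (z - A * B * x) ^+ 2) / (2 * (1 - (A * B) ^+ 2)) =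
    (1 + (A * B) ^+ 2) / (2 * (1 - (A * B) ^+ 2)) * x ^+ 2 +
    (1 + (A * B) ^+ 2) / (2 * (1 - (A * B) ^+ 2)) * z ^+ 2 - 2 * x * z * (A * B / (1 - (A * B) ^+ 2)).
  by move: (A * B) ABl AB2 => c _ c2; field; rewrite gt_eqF.
rewrite L3 -{1}x2 -z2 -xz /ga /be.
move: al0; clear; move: al a1 b1 ((1 + A ^+ 2) / _) ((1 + B ^+ 2) / _) => al a1 b1 P Q al0.
by field.
Qed.

Lemma mehler_semigroup a b x z : 0 < a -> 0 < b ->
  (\int[mu]_y (mehler a x y * mehler b y z)%:E = (mehler (a + b) x z)%:E)%E.
Proof.
move=> a0 b0; have [m [sg h]] := mehler_semigroup_pdf x z a0 b0.
under eq_integral do rewrite h EFinM.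
rewrite ge0_integralZl_EFin ?integral_normal_pdf ?mule1//.
- by move=> y _; rewrite lee_fin normal_pdf_ge0.
- by apply/measurable_EFinP; exact: measurable_normal_pdf.
- by apply: mehler_ge0; exact: addr_gt0.
Qed.

Lemma tonelli (G : R * R -> \bar R) : measurable_fun setT G ->
  (forall p, 0 <= G p)%E ->
  (\int[mu]_x \int[mu]_y G (x, y) = \int[mu]_y \int[mu]_x G (x, y))%E.
Proof. by move=> mG G0; exact: (@fubini_tonelli _ _ _ _ _ mu mu _ mG G0). Qed.

Lemma Rintegral_fubini (G : R * R -> R) : measurable_fun setT G ->
  (forall x, mu.-integrable setT (fun y => (G (x, y))%:E)) ->
  (forall y, mu.-integrable setT (fun x => (G (x, y))%:E)) ->
  (\int[mu]_x \int[mu]_y `|G (x, y)|%:E < +oo)%E ->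
  \int[mu]_x \int[mu]_y G (x, y) = \int[mu]_y \int[mu]_x G (x, y).
Proof.
move=> mG i1 i2 fin.
have iG : (mu \x mu)%E.-integrable setT (EFin \o G).
  by apply/integrable12ltyP => //; exact/measurable_EFinP.
rewrite {1}/Rintegral [RHS]/Rintegral; congr fine.
under eq_integral => x _ do rewrite /Rintegral fineK ?(integrable_fin_num _ (i1 x))//.
under [in RHS]eq_integral => x _ do rewrite /Rintegral fineK ?(integrable_fin_num _ (i2 x))//.
exact: (Fubini iG).
Qed.

(** A class of functions that is stable under the semigroup, large enough to
    contain the good part of a Calderon-Zygmund decomposition, and on which
    every product is integrable; so Hilbert space arguments can be carried out
    by hand with [ip]. *)
Definition bounded_L1 u := [/\ measurable_fun setT u, mu.-integrable setT (EFin \o u)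
  & exists B : R, forall x, `|u x| <= B].

Fact heat_key : unit. Proof. by []. Qed.

(** Locked, so that comparing two values of the semigroup does not compare the
    integrals defining them. *)
Definition heat :=
  locked_with heat_key (fun s f y => \int[mu]_z (mehler s y z * f z)).

Lemma heatE s f y : heat s f y = \int[mu]_z (mehler s y z * f z).
Proof. by rewrite /heat unlock. Qed.

Definition ip u v : R := \int[mu]_x (u x * v x).

Lemma bounded_L1_prod u v : bounded_L1 u -> bounded_L1 v -> mu.-integrable setT (EFin \o (fun x => u x * v x)).
Proof.
move=> [mu_ iu _] [mv _ [B vB]].
apply: (@le_integrable _ _ _ mu setT measurableT _ (fun x => B%:E * (EFin \o u) x)%E).
- by apply/measurable_EFinP/mfM.
- move=> x _ /=; rewrite lee_fin !normrM mulrC ler_wpM2r//.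
  exact: le_trans (vB x) (ler_norm _).
- exact: integrableZl.
Qed.

Lemma bounded_L1_sub u v : bounded_L1 u -> bounded_L1 v -> bounded_L1 (fun x => u x - v x).
Proof.
move=> [mu_ iu [B uB]] [mv iv [B' vB]]; split.
- by apply: mfD => //; exact: mfN.
- by apply: (integrableB measurableT iu iv).
- by exists (B + B') => x; apply: le_trans (ler_normB _ _) _; exact: lerD.
Qed.

Lemma bounded_L1_tame u : bounded_L1 u -> tame u.
Proof. by case=> _ iu _; exact: tame_integrable. Qed.

Lemma ip_sub_sq u v : bounded_L1 u -> bounded_L1 v ->
  ip (fun x => u x - v x) (fun x => u x - v x) = ip u u - 2 * ip u v + ip v v.
Proof.
move=> bu bv.
have iuu := bounded_L1_prod bu bu; have iuv := bounded_L1_prod bu bv; have ivv := bounded_L1_prod bv bv.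
have i2uv : mu.-integrable setT (EFin \o (fun x => 2 * (u x * v x))).
  by have := integrableZl measurableT 2 iuv; apply: eq_integrable.
rewrite /ip -RintegralZl// -RintegralB//.
rewrite -RintegralD//; last first.
  by have := integrableB measurableT iuu i2uv; apply: eq_integrable.
by apply: eq_Rintegral => x _; ring.
Qed.

Lemma ip_ge0 u : 0 <= ip u u.
Proof. by apply: Rintegral_ge0 => x _; rewrite -expr2 sqr_ge0. Qed.

Lemma heat_abs_le s f y : 0 < s -> measurable_fun setT f ->
  (`|heat s f y|%:E <= \int[mu]_z (mehler s y z * `|f z|)%:E)%E.
Proof.
move=> s0 mf; case E : (\int[mu]_z (mehler s y z * `|f z|)%:E)%E => [c| |].
- rewrite lee_fin heatE; apply: (@Rint_le _ _ _ mu setT _ (fun z => (mehler s y z * `|f z|)%:E)).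
  + exact: measurableT.
  + by apply: mfM => //; exact: mf_mehler.
  + by move=> z _; rewrite lee_fin normrM ger0_norm ?mehler_ge0.
  + by rewrite E.
- by rewrite leey.
- have : (0 <= \int[mu]_z (mehler s y z * `|f z|)%:E)%E.
    by apply: integral_ge0 => z _; rewrite lee_fin mulr_ge0 ?mehler_ge0.
  by rewrite E.
Qed.

Lemma mf_mehler2 s : measurable_fun setT (fun p : R * R => mehler s p.1 p.2).
Proof. exact: mf_mehler. Qed.

Lemma mf_heat s f : measurable_fun setT f -> measurable_fun setT (heat s f).
Proof.
move=> mf; rewrite (_ : heat s f = fun y => \int[mu]_z (mehler s y z * f z)); last by apply/funext => y; exact: heatE.
apply: (@mf_Rintegral _ _ _ _ _ mu (fun p => mehler s p.1 p.2 * f p.2)).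
by apply: mfM; [exact: mf_mehler2|exact: (measurableT_comp mf measurable_snd)].
Qed.

Lemma heat_bounded s f (B : R) : 0 < s -> measurable_fun setT f ->
  (forall x, `|f x| <= B) -> forall y, `|heat s f y| <= B.
Proof.
move=> s0 mf fB y; rewrite -lee_fin; apply: (le_trans (heat_abs_le y s0 mf)).
have B0 : 0 <= B by apply: le_trans (fB 0).
apply: (@le_trans _ _ (\int[mu]_z (B%:E * (mehler s y z)%:E))%E).
  apply: le_int0 => z _; rewrite -?EFinM lee_fin ?mulr_ge0 ?mehler_ge0//.
  by rewrite mulrC ler_wpM2r ?mehler_ge0.
rewrite ge0_integralZl_EFin//.
- by rewrite -[leRHS]mule1 lee_wpmul2l ?lee_fin// int_mehler_le1.
- by move=> z _; rewrite lee_fin mehler_ge0.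
- by apply/measurable_EFinP/mf_mehler.
Qed.

Lemma heat_l1 s f : 0 < s -> measurable_fun setT f ->
  (\int[mu]_y `|heat s f y|%:E <= \int[mu]_z `|f z|%:E)%E.
Proof.
move=> s0 mf.
apply: (@le_trans _ _ (\int[mu]_y \int[mu]_z (mehler s y z * `|f z|)%:E)%E).
  by apply: le_int0 => y _; [rewrite lee_fin|exact: heat_abs_le].
have mF : measurable_fun setT (fun p : R * R => (mehler s p.1 p.2 * `|f p.2|)%:E).
  apply/measurable_EFinP/mfM; first exact: mf_mehler2.
  by apply: measurableT_comp => //; exact: (measurableT_comp mf measurable_snd).
have -> := tonelli mF (fun p => ltac:(by rewrite lee_fin mulr_ge0 ?mehler_ge0)) => /=.
apply: le_int0 => z _.
  by apply: integral_ge0 => y _; rewrite lee_fin mulr_ge0 ?mehler_ge0.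
under eq_integral => y _ do rewrite mulrC EFinM /= mehler_sym.
rewrite ge0_integralZl_EFin//.
- by rewrite -[leRHS]mule1 lee_wpmul2l ?lee_fin// int_mehler_le1.
- by move=> y _; rewrite lee_fin mehler_ge0.
- by apply/measurable_EFinP/mf_mehler.
Qed.

Lemma bounded_L1_heat s f : 0 < s -> bounded_L1 f -> bounded_L1 (heat s f).
Proof.
move=> s0 [mf /integrableP[_ fy] [B fB]]; split; first exact: mf_heat.
  apply/integrableP; split; first by apply/measurable_EFinP; exact: mf_heat.
  by apply: le_lt_trans fy => /=; exact: heat_l1.
by exists B; exact: heat_bounded.
Qed.

Lemma heat_sub s f g y : 0 < s -> bounded_L1 f -> bounded_L1 g ->
  heat s (fun x => f x - g x) y = heat s f y - heat s g y.
Proof.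
move=> s0 bf bg; rewrite !heatE -RintegralB//.
- by apply: eq_Rintegral => z _; rewrite mulrBr.
- exact: mehler_integrable (bounded_L1_tame bf) s0.
- exact: mehler_integrable (bounded_L1_tame bg) s0.
Qed.

(** Fubini and [mehler_semigroup]. *)
Lemma heat_semigroup a b f y : 0 < a -> 0 < b -> bounded_L1 f ->
  heat a (heat b f) y = heat (a + b) f y.
Proof.
move=> a0 b0 bf; have [mf fi [B fB]] := bf; have B0 : 0 <= B := le_trans (normr_ge0 _) (fB 0).
have ab0 : 0 < a + b by exact: addr_gt0.
pose G (p : R * R) := mehler a y p.1 * (mehler b p.1 p.2 * f p.2).
have mG : measurable_fun setT G.
  apply: mfM; first by apply: mf_mehler => //; exact: measurable_fst.
  by apply: mfM; [exact: mf_mehler2|exact: (measurableT_comp mf measurable_snd)].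
transitivity (\int[mu]_x \int[mu]_z G (x, z)).
  rewrite heatE; apply: eq_Rintegral => x _; rewrite /G/= heatE RintegralZl//.
  exact: mehler_integrable (bounded_L1_tame bf) b0.
have absG : (\int[mu]_x \int[mu]_z `|G (x, z)|%:E < +oo)%E.
  apply: (@le_lt_trans _ _ (\int[mu]_x (B%:E * (mehler a y x)%:E))%E).
    apply: le_int0 => x _; first by apply: integral_ge0 => z _; rewrite lee_fin.
    apply: (@le_trans _ _ (\int[mu]_z ((B * mehler a y x)%:E * (mehler b x z)%:E))%E).
      apply: le_int0 => z _; rewrite -?EFinM lee_fin// /G/= normrM.
      rewrite (ger0_norm (mehler_ge0 y x a0)) normrM (ger0_norm (mehler_ge0 x z b0)).
      rewrite mulrA mulrC -[leRHS]mulrA; apply: ler_wpM2r => //.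
      by rewrite mulr_ge0 ?mehler_ge0.
    rewrite ge0_integralZl_EFin ?mulr_ge0 ?mehler_ge0//.
    - by rewrite -EFinM -[leRHS]mule1 lee_wpmul2l ?lee_fin ?mulr_ge0 ?mehler_ge0// int_mehler_le1.
    - by move=> z _; rewrite lee_fin mehler_ge0.
    - by apply/measurable_EFinP/mf_mehler.
  rewrite ge0_integralZl_EFin//.
  - by apply: (le_lt_trans (lee_wpmul2l _ (int_mehler_le1 y a0))); rewrite ?lee_fin// mule1 ltry.
  - by move=> z _; rewrite lee_fin mehler_ge0.
  - by apply/measurable_EFinP/mf_mehler.
rewrite Rintegral_fubini//.
- rewrite heatE; apply: eq_Rintegral => z _; rewrite /G/=.
  have i1 : mu.-integrable setT (EFin \o (fun x => mehler a y x * mehler b x z)).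
    apply/integrableP; split; first by apply/measurable_EFinP/mfM; exact: mf_mehler.
    under eq_integral => x _ do rewrite /= ger0_norm ?mulr_ge0 ?mehler_ge0//.
    by rewrite mehler_semigroup// ltry.
  under eq_Rintegral do rewrite mulrA.
  by rewrite RintegralZr// /Rintegral mehler_semigroup.
- move=> x; rewrite /G/=.
  have := integrableZl measurableT (mehler a y x) (mehler_integrable x (bounded_L1_tame bf) b0).
  by apply: eq_integrable.
- move=> z; rewrite /G/=.
  have i1 : mu.-integrable setT (EFin \o (fun x => mehler a y x * mehler b x z)).
    apply/integrableP; split; first by apply/measurable_EFinP/mfM; exact: mf_mehler.
    under eq_integral => x _ do rewrite /= ger0_norm ?mulr_ge0 ?mehler_ge0//.
    by rewrite mehler_semigroup// ltry.
  have := integrableZl measurableT (f z) i1.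
  by apply: eq_integrable => // x _ /=; rewrite -EFinM; congr EFin; ring.
Qed.

Lemma heat_selfadjoint s f g : 0 < s -> bounded_L1 f -> bounded_L1 g ->
  ip (heat s f) g = ip f (heat s g).
Proof.
move=> s0 bf bg; have [mf fi [B fB]] := bf; have [mg gi [B' gB]] := bg.
have B0 : 0 <= B := le_trans (normr_ge0 _) (fB 0).
pose G (p : R * R) := mehler s p.1 p.2 * f p.2 * g p.1.
have mG : measurable_fun setT G.
  apply: mfM; last exact: (measurableT_comp mg measurable_fst).
  by apply: mfM; [exact: mf_mehler2|exact: (measurableT_comp mf measurable_snd)].
transitivity (\int[mu]_x \int[mu]_z G (x, z)).
  apply: eq_Rintegral => x _; rewrite /G/= heatE RintegralZr//.
  exact: mehler_integrable (bounded_L1_tame bf) s0.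
rewrite Rintegral_fubini//.
- apply: eq_Rintegral => z _; rewrite /G/= heatE.
  rewrite -RintegralZl//; last exact: mehler_integrable (bounded_L1_tame bg) s0.
  by apply: eq_Rintegral => x _; rewrite mehler_sym; ring.
- move=> x; rewrite /G/=.
  have := integrableZl measurableT (g x) (mehler_integrable x (bounded_L1_tame bf) s0).
  by apply: eq_integrable => // z _ /=; rewrite -EFinM; congr EFin; ring.
- move=> z; rewrite /G/=.
  have := integrableZl measurableT (f z) (mehler_integrable z (bounded_L1_tame bg) s0).
  by apply: eq_integrable => // x _ /=; rewrite -EFinM mehler_sym; congr EFin; ring.
- apply: (@le_lt_trans _ _ (\int[mu]_x (B%:E * `|g x|%:E))%E).
    apply: le_int0 => x _; first by apply: integral_ge0 => z _; rewrite lee_fin.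
    apply: (@le_trans _ _ (\int[mu]_z ((B * `|g x|)%:E * (mehler s x z)%:E))%E).
      apply: le_int0 => z _; rewrite -?EFinM lee_fin// /G/= normrM normrM.
      rewrite (ger0_norm (mehler_ge0 x z s0))// [leRHS]mulrC -mulrA; apply: ler_wpM2l; rewrite ?mehler_ge0//.
      exact: ler_wpM2r.
    rewrite ge0_integralZl_EFin ?mulr_ge0//.
    - by rewrite -EFinM -[leRHS]mule1 lee_wpmul2l ?lee_fin ?mulr_ge0// int_mehler_le1.
    - by move=> z _; rewrite lee_fin mehler_ge0.
    - by apply/measurable_EFinP/mf_mehler.
  rewrite ge0_integralZl_EFin//.
  - by rewrite lte_mul_pinfty//; case/integrableP: gi.
  - by apply/measurable_EFinP; exact: measurableT_comp.
Qed.

(** Write 2 f(y) f(z) <= f(y)^2 + f(z)^2 under the double integral; the kernel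
    is symmetric of total mass at most 1 in each variable. *)
Lemma heat_energy s f : 0 < s -> bounded_L1 f -> ip (heat s f) f <= ip f f.
Proof.
move=> s0 bf; have [mf fi [B fB]] := bf.
have b2 : bounded_L1 (fun x => f x * f x).
  split; [exact: mfM|exact: bounded_L1_prod|].
  by exists (B * B) => x; rewrite normrM; apply: ler_pM.
have [mh hi _] := bounded_L1_heat s0 b2.
have im y : mu.-integrable setT (EFin \o mehler s y).
  apply/integrableP; split; first by apply/measurable_EFinP/mf_mehler.
  apply: le_lt_trans (ltry 1); apply: le_trans (int_mehler_le1 y s0).
  by apply: le_int0 => z _ //=; rewrite lee_fin ger0_norm ?mehler_ge0.
have m1 y : \int[mu]_z mehler s y z <= 1.
  rewrite -lee_fin /Rintegral (fineK (integrable_fin_num measurableT (im y))).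
  exact: int_mehler_le1.
have iff := bounded_L1_prod bf bf.
have pt y : heat s f y * f y <= 2^-1 * (f y * f y) + 2^-1 * heat s (fun x => f x * f x) y.
  have i1 : mu.-integrable setT (EFin \o (fun z => 2^-1 * (f y * f y) * mehler s y z)).
    by have := integrableZl measurableT (2^-1 * (f y * f y)) (im y); apply: eq_integrable.
  have i2 : mu.-integrable setT (EFin \o (fun z => 2^-1 * (mehler s y z * (f z * f z)))).
    by have := integrableZl measurableT 2^-1 (mehler_integrable y (bounded_L1_tame b2) s0); apply: eq_integrable.
  rewrite !heatE -RintegralZr//; last exact: mehler_integrable (bounded_L1_tame bf) s0.
  apply: (@le_trans _ _ (\int[mu]_z (2^-1 * (f y * f y) * mehler s y z + 2^-1 * (mehler s y z * (f z * f z))))).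
    apply: le_Rintegral => //.
    - have := integrableZr measurableT (f y) (mehler_integrable y (bounded_L1_tame bf) s0).
      by apply: eq_integrable.
    - by have := integrableD measurableT i1 i2; apply: eq_integrable.
    - move=> z _; have m0 := mehler_ge0 y z s0.
      have -> : 2^-1 * (f y * f y) * mehler s y z + 2^-1 * (mehler s y z * (f z * f z)) =
        mehler s y z * (2^-1 * (f y * f y + f z * f z)) by ring.
      rewrite -mulrA; apply: ler_wpM2l => //.
      by have := sqr_ge0 (f y - f z); rewrite expr2; lra.
  rewrite RintegralD// (RintegralZl _ measurableT (im y)) (RintegralZl _ measurableT (mehler_integrable y (bounded_L1_tame b2) s0)).
  rewrite lerD2r -[leRHS]mulr1 ler_wpM2l// mulr_ge0//.
  by rewrite -expr2 sqr_ge0.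
have i1 : mu.-integrable setT (EFin \o (fun y => 2^-1 * (f y * f y))).
  by have := integrableZl measurableT 2^-1 iff; apply: eq_integrable.
have i2 : mu.-integrable setT (EFin \o (fun y => 2^-1 * heat s (fun x => f x * f x) y)).
  by have := integrableZl measurableT 2^-1 hi; apply: eq_integrable.
apply: (@le_trans _ _ (\int[mu]_y (2^-1 * (f y * f y) + 2^-1 * heat s (fun x => f x * f x) y))).
  apply: le_Rintegral => //; first exact: bounded_L1_prod (bounded_L1_heat s0 bf) bf.
  by have := integrableD measurableT i1 i2; apply: eq_integrable.
rewrite RintegralD// RintegralZl// RintegralZl// -/(ip f f).
suff : \int[mu]_y heat s (fun x => f x * f x) y <= ip f f by lra.
rewrite -lee_fin /ip /Rintegral !fineK; [|exact: integrable_fin_num..].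
have h0 y : 0 <= heat s (fun x => f x * f x) y.
  by rewrite heatE; apply: Rintegral_ge0 => z _; rewrite mulr_ge0 ?mehler_ge0// -expr2 sqr_ge0.
have mff : measurable_fun setT (fun x => f x * f x) by exact: mfM.
apply: (@le_trans _ _ (\int[mu]_y `|heat s (fun x => f x * f x)%R y|%:E)%E).
  by apply: le_int0 => y _ //=; rewrite lee_fin ?h0 ?ler_norm.
apply: (le_trans (heat_l1 s0 mff)); apply: le_int0 => z _ //=.
by rewrite lee_fin ger0_norm// -expr2 sqr_ge0.
Qed.

Lemma heat_comp a b f : 0 < a -> 0 < b -> bounded_L1 f -> heat a (heat b f) = heat (a + b) f.
Proof. by move=> a0 b0 bf; apply/funext => y; exact: heat_semigroup. Qed.

Lemma heat_ip_half a f : 0 < a -> bounded_L1 f ->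
  ip (heat a f) (heat a f) = ip (heat (a + a) f) f.
Proof. by move=> a0 bf; rewrite -heat_comp// (heat_selfadjoint a0 (bounded_L1_heat a0 bf) bf). Qed.

(** That is, W_s^2 <= W_s: with s = 2 r both sides are expressed by W_r f, and
    the inequality is [heat_energy] at W_r f. *)
Lemma heat_contraction_ip s f : 0 < s -> bounded_L1 f ->
  ip (heat s f) (heat s f) <= ip (heat s f) f.
Proof.
move=> s0 bf; have [r r0 <-] : exists2 r, 0 < r & r + r = s.
  by exists (s / 2); [rewrite divr_gt0|rewrite -splitr].
have br := bounded_L1_heat r0 bf.
rewrite -(heat_ip_half r0 bf) -(heat_comp r0 r0 bf) (heat_ip_half r0 br).
by apply: heat_energy => //; exact: addr_gt0.
Qed.

End heat_operator.

(** * Decay of the energy along the semigroup *)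

Section energy.
Context {R : realType}.
Local Notation mu := (@lebesgue_measure R).
Implicit Types (f g u v : R -> R) (r s t x y z e h : R).

Lemma ip_add_sq u v : bounded_L1 u -> bounded_L1 v ->
  ip (fun x => u x + v x) (fun x => u x + v x) = ip u u + 2 * ip u v + ip v v.
Proof.
move=> bu bv.
have iuu := bounded_L1_prod bu bu; have iuv := bounded_L1_prod bu bv; have ivv := bounded_L1_prod bv bv.
have i2uv : mu.-integrable setT (EFin \o (fun x => 2 * (u x * v x))).
  by have := integrableZl measurableT 2 iuv; apply: eq_integrable.
rewrite /ip -RintegralZl// -RintegralD//.
rewrite -RintegralD//; last first.
  by have := integrableD measurableT iuu i2uv; apply: eq_integrable.
by apply: eq_Rintegral => x _; ring.
Qed.

Definition energy f s := ip (heat s f) (heat s f).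

Lemma energy_le f a b : 0 < a -> a < b -> bounded_L1 f -> energy f b <= energy f a.
Proof.
move=> a0 ab bf; have c0 : 0 < b - a by rewrite subr_gt0.
rewrite /energy -[b in heat b](subrK a) -(heat_comp c0 a0 bf).
have ba := bounded_L1_heat a0 bf.
exact: le_trans (heat_contraction_ip c0 ba) (heat_energy c0 ba).
Qed.

Lemma energy_le0 f a : 0 < a -> bounded_L1 f -> energy f a <= ip f f.
Proof.
move=> a0 bf; exact: le_trans (heat_contraction_ip a0 bf) (heat_energy a0 bf).
Qed.

Definition incr e h f x := heat e f x - heat (e - h) f x.

Lemma bounded_L1_incr e h f : 0 < h -> h < e -> bounded_L1 f -> bounded_L1 (incr e h f).
Proof.
by move=> h0 he bf; apply: bounded_L1_sub; apply: bounded_L1_heat => //; [exact: lt_trans he|rewrite subr_gt0].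
Qed.

(** With g = (W_(e-h) - W_(e-2h)) f one has W_e f - W_(e-h) f = W_h g and
    W_e f - W_(e-2h) f = W_h g + g. Since ||W_h g||^2 <= <W_h g, g> <=
    ||g||^2, the square of ||W_h g + g|| is at least 4 ||W_h g||^2. *)
Lemma incr_doubling e h f : 0 < h -> 2 * h < e -> bounded_L1 f ->
  4 * ip (incr e h f) (incr e h f) <= ip (incr e (2 * h) f) (incr e (2 * h) f).
Proof.
move=> h0 he bf; pose g := incr (e - h) h f.
have he1 : 0 < e - h by lra.
have he2 : 0 < e - h - h by lra.
have bg : bounded_L1 g by apply: bounded_L1_incr => //; lra.
have hg : heat h g = incr e h f.
  apply/funext => y; rewrite /g /incr heat_sub//; [|exact: bounded_L1_heat..].
  rewrite (heat_semigroup y h0 he1 bf) (heat_semigroup y h0 he2 bf).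
  have -> : h + (e - h) = e by ring.
  by have -> : h + (e - h - h) = e - h by ring.
have -> : incr e (2 * h) f = (fun x => heat h g x + g x).
  apply/funext => y; rewrite hg /g /incr.
  have -> : e - 2 * h = e - h - h by ring.
  by ring.
rewrite (ip_add_sq (bounded_L1_heat h0 bg) bg).
have := heat_contraction_ip h0 bg; have := heat_energy h0 bg; rewrite hg; lra.
Qed.

Lemma incr_pow e h f n : 0 < h -> h < e -> bounded_L1 f ->
  4 ^+ n * ip (incr e (h / 2 ^+ n) f) (incr e (h / 2 ^+ n) f) <= ip (incr e h f) (incr e h f).
Proof.
move=> h0 he bf; elim: n => [|n IH]; first by rewrite !expr0 mul1r divr1.
apply: le_trans IH; rewrite exprSr -mulrA ler_pM2l ?exprn_gt0//.
have p0 : 0 < (2 : R) ^+ n by rewrite exprn_gt0.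
have p1 : 1 <= (2 : R) ^+ n by rewrite exprn_ege1// ler1n.
have e2 : 2 * (h / 2 ^+ n.+1) = h / 2 ^+ n.
  by rewrite exprS; move: (2 ^+ n) p0 => q q0; field; rewrite gt_eqF.
have := @incr_doubling e (h / 2 ^+ n.+1) f; rewrite e2; apply=> //.
  by rewrite divr_gt0// exprn_gt0.
by apply: le_lt_trans he; rewrite ler_pdivrMr// ler_peMr// ltW.
Qed.

(** For u = W_(e-h) f expand ||W_h u - u||^2 and use <W_h u, u> >=
    ||W_h u||^2. *)
Lemma incr_energy e h f : 0 < h -> h < e -> bounded_L1 f ->
  ip (incr e h f) (incr e h f) <= energy f (e - h) - energy f e.
Proof.
move=> h0 he bf; have eh : 0 < e - h by rewrite subr_gt0.
have e0 : 0 < e by exact: lt_trans he.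
rewrite ip_sub_sq; [|exact: bounded_L1_heat..].
have := heat_contraction_ip h0 (bounded_L1_heat eh bf).
by rewrite (heat_comp h0 eh bf) [h + _]addrC subrK /energy; lra.
Qed.

Fact dheat_key : unit. Proof. by []. Qed.

Definition dheat := locked_with dheat_key
  (fun e f y => \int[mu]_z (mehler e y z * dlog_mehler e y z * f z)).

Lemma dheatE e f y : dheat e f y = \int[mu]_z (mehler e y z * dlog_mehler e y z * f z).
Proof. by rewrite /dheat unlock. Qed.

(** Difference quotients along the sequence of steps h / 2^n, from the left. *)
Lemma incr_cvg e h f y : tame f -> 0 < e -> 0 < h ->
  (2 ^+ n * incr e (h / 2 ^+ n) f y) @[n --> \oo] --> h * dheat e f y.
Proof.
move=> tf e0 h0.
rewrite dheatE; have := cvg_dnbhs_at_left (@heat_derive_cvg R f e y tf e0) => /cvg_at_leftP/(_ (fun n => - (h / 2 ^+ n))).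
have c0 : - (h / 2 ^+ n) @[n --> \oo] --> (0 : R).
  rewrite -[X in _ --> X]oppr0; apply: cvgN.
  rewrite -[X in _ --> X](mulr0 h); apply: cvgMr.
  under eq_cvg do rewrite -exprVn.
  by apply: cvg_expr; rewrite ger0_norm ?invr_ge0// invf_lt1// ltr1n.
move=> /(_ (conj _ c0)) H.
have {}H := H (fun n => ltac:(by rewrite oppr_lt0 divr_gt0 ?exprn_gt0)).
apply: cvg_trans (cvgMr H); apply: near_eq_cvg; near=> n.
have p0 : 0 < (2 : R) ^+ n by rewrite exprn_gt0.
rewrite /incr !heatE /= [- _ + e]addrC /GRing.scale/=.
move: (\int[_]_z _) (\int[_]_z _) => a b; move: (2 ^+ n) p0 => q q0.
by field; rewrite !gt_eqF.
Unshelve. all: by end_near. Qed.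

Lemma mf_dheat e f : measurable_fun setT f -> measurable_fun setT (dheat e f).
Proof.
move=> mf; rewrite (_ : dheat e f = fun y => \int[mu]_z (mehler e y z * dlog_mehler e y z * f z)); last by apply/funext => y; exact: dheatE.
apply: (@mf_Rintegral _ _ _ _ _ mu (fun p => mehler e p.1 p.2 * dlog_mehler e p.1 p.2 * f p.2)).
apply: mfM; last exact: (measurableT_comp mf measurable_snd).
by apply: mfM; [exact: mf_mehler2|exact: mf_dlog_mehler].
Qed.

(** By [incr_pow] the difference quotients with step h / 2^n, multiplied by h,
    have norms bounded by that of the first one, for which [incr_energy]
    applies; Fatou's lemma carries the bound to the limit. *)
Lemma dheat_energy e h f : 0 < h -> h < e -> bounded_L1 f ->
  (\int[mu]_y ((h * dheat e f y) ^+ 2)%:E <= (energy f (e - h) - energy f e)%:E)%E.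
Proof.
move=> h0 he bf; have e0 : 0 < e by exact: lt_trans he.
have [mf _ _] := bf.
pose fn (n : nat) y := ((2 ^+ n * incr e (h / 2 ^+ n) f y) ^+ 2)%:E.
have hn n : h / 2 ^+ n <= h.
  by rewrite ler_pdivrMr ?exprn_gt0// ler_peMr ?exprn_ege1 ?ler1n// ltW.
have hn0 n : 0 < h / 2 ^+ n by rewrite divr_gt0 ?exprn_gt0.
have mfn n : measurable_fun setT (fn n).
  apply/measurable_EFinP/mfX/mfM => //.
  by have [] := bounded_L1_incr (hn0 n) (le_lt_trans (hn n) he) bf.
have fn0 n y : setT y -> (0 <= fn n y)%E by rewrite lee_fin sqr_ge0.
have E y : limn_einf (fn^~ y) = ((h * dheat e f y) ^+ 2)%:E.
  apply: (cvg_limn_einf_sup _).1.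
  apply: cvg_EFin; first by near=> n.
  rewrite /comp/=; under eq_cvg do rewrite expr2.
  by rewrite expr2; apply: cvgM; apply: incr_cvg => //; exact: bounded_L1_tame.
apply: (@le_trans _ _ (\int[mu]_x limn_einf (fn^~ x))%E).
  by apply: le_int0 => y _; rewrite ?E ?lee_fin ?sqr_ge0.
apply: (le_trans (fatou mu measurableT mfn fn0)).
rewrite limn_einf_lim; apply: lime_le; first exact: is_cvg_einfs.
near=> n; apply: (@le_trans _ _ (\int[mu]_y fn n y)%E).
  by apply: ereal_inf_lbound; exists n => //=.
have bn := bounded_L1_incr (hn0 n) (le_lt_trans (hn n) he) bf.
have := incr_energy h0 he bf; have := incr_pow n h0 he bf => /le_trans/[apply].
rewrite -lee_fin; apply: le_trans.
have ib := bounded_L1_prod bn bn.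
rewrite /ip -RintegralZl// /Rintegral fineK; last first.
  apply: integrable_fin_num => //.
  by have := integrableZl measurableT (4 ^+ n) ib; apply: eq_integrable.
apply: le_int0 => y _; rewrite ?fn0// lee_fin exprMn -exprM mulnC exprM expr2.
by rewrite -natrM.
Unshelve. all: by end_near. Qed.

End energy.

(** * The area integral in L^2 *)

Section cone_integrals.
Context {R : realType}.
Local Notation mu := (@lebesgue_measure R).
Local Notation m2 := ((@lebesgue_measure R) \x (@lebesgue_measure R))%E.
Implicit Types (H : R * R -> \bar R) (x y t : R).

Lemma measurable_lt d (T : measurableType d) (f g : T -> R) :
  measurable_fun setT f -> measurable_fun setT g -> measurable [set p | f p < g p].
Proof.
move=> mf mg; have := measurable_fun_ltr mf mg measurableT (Y := [set true]).
by rewrite setTI; apply.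
Qed.

Definition cone3 : set ((R * R) * R) :=
  [set p | area_cone p.1.1 (p.1.2, p.2)].

Lemma measurable_cone3 : measurable cone3.
Proof.
have -> : cone3 = [set p | 0 < p.2] `&` [set p | `|p.1.1 - p.1.2| < p.2].
  by apply/seteqP; split.
have m1 : measurable_fun setT (fun p : (R * R) * R => p.1.1).
  exact: measurableT_comp measurable_fst measurable_fst.
have m2 : measurable_fun setT (fun p : (R * R) * R => p.1.2).
  exact: measurableT_comp measurable_snd measurable_fst.
apply: measurableI; apply: measurable_lt => //.
by apply: measurableT_comp => //; exact: measurable_funB.
Qed.

Lemma measurable_cone x : measurable (area_cone x).
Proof.
have -> : area_cone x = [set p | 0 < p.2] `&` [set p | `|x - p.1| < p.2].
  by apply/seteqP; split.
apply: measurableI; apply: measurable_lt => //.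
by apply: measurableT_comp => //; exact: measurable_funB.
Qed.

Let K H (p : (R * R) * R) : \bar R := (H (p.1.2, p.2) * (\1_cone3 p)%:E)%E.

Let mK H : measurable_fun setT H -> measurable_fun setT (K H).
Proof.
move=> mH; apply: emeasurable_funM.
  apply: (measurableT_comp mH); apply: measurable_fun_pair => //.
  exact: measurableT_comp measurable_snd measurable_fst.
by apply/measurable_EFinP; exact: (measurable_indic measurable_cone3).
Qed.

Let K0 H : (forall p, 0 <= H p)%E -> forall p, (0 <= K H p)%E.
Proof. by move=> H0 p; rewrite mule_ge0// lee_fin. Qed.

Lemma cone_integralE H x : measurable_fun setT H -> (forall p, 0 <= H p)%E ->
  (\int[m2]_(p in area_cone x) H p = \int[mu]_y \int[mu]_t K H ((x, y), t))%E.
Proof.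
move=> mH H0; rewrite integral_mkcond epatch_indic fubini_tonelli1//.
- apply: emeasurable_funM => //; apply/measurable_EFinP.
  exact: (measurable_indic (measurable_cone x)).
- by move=> p; rewrite mule_ge0// lee_fin.
Qed.

Lemma mf_cone H : measurable_fun setT H -> (forall p, 0 <= H p)%E ->
  measurable_fun setT (fun x => \int[m2]_(p in area_cone x) H p)%E.
Proof.
move=> mH H0; under eq_fun do rewrite cone_integralE//.
apply: (measurable_fun_fubini_tonelli_F (m2 := mu) (fun q => \int[mu]_t K H (q, t))%E).
- by apply: (measurable_fun_fubini_tonelli_F (m2 := mu)); [exact: mK|exact: K0].
- by move=> q; apply: integral_ge0 => t _; exact: K0.
Qed.

(** The point (y, t) lies in the cones over x for x in an interval of length
    2 t. *)
Lemma integral_cone H : measurable_fun setT H -> (forall p, 0 <= H p)%E ->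
  (\int[mu]_x \int[m2]_(p in area_cone x) H p =
   \int[mu]_(t in `]0%R, +oo[) ((2 * t)%:E * \int[mu]_y H (y, t)))%E.
Proof.
move=> mH H0; under eq_integral do rewrite cone_integralE//.
rewrite (@tonelli _ (fun q => \int[mu]_t K H (q, t))%E); last 2 first.
- by apply: (measurable_fun_fubini_tonelli_F (m2 := mu)); [exact: mK|exact: K0].
- by move=> q; apply: integral_ge0 => t _; exact: K0.
transitivity (\int[mu]_y \int[mu]_t \int[mu]_x K H ((x, y), t))%E.
  apply: eq_integral => y _.
  rewrite (@tonelli _ (fun q => K H ((q.1, y), q.2)))//; last by move=> q; exact: K0.
  apply: (measurableT_comp (mK mH)); apply: measurable_fun_pair => //.
  exact: measurable_fun_pair.
transitivity (\int[mu]_y \int[mu]_t (H (y, t) * ((2 * t)%:E * (\1_`]0%R, +oo[ t)%:E)))%E.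
  apply: eq_integral => y _; apply: eq_integral => t _.
  have mi : measurable_fun setT ((fun x => \1_cone3 ((x, y), t)) : R -> R).
    apply: (measurableT_comp (measurable_indic measurable_cone3)).
    by apply: measurable_fun_pair => //; exact: measurable_fun_pair.
  rewrite /K/= ge0_integralZl//; last exact/measurable_EFinP.
  congr (_ * _)%E; rewrite indicE; case: (boolP (t \in _)) => [|/negP nt].
    rewrite inE/= in_itv/= andbT => t0; rewrite mule1.
    rewrite (_ : (fun x => (\1_cone3 (x, y, t))%:E) = (EFin \o \1_(ball y t)))//.
      rewrite integral_indic//; last exact: measurable_ball.
      rewrite setIT; apply: (eq_trans (lebesgue_measure_ball y (ltW t0))).
      by rewrite mulr_natl.
    apply/funext => x /=; congr (_%:E); rewrite !indicE; congr (_%:R).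
    have e : cone3 ((x, y), t) <-> ball y t x.
      rewrite /cone3 /ball/= distrC.
      by split=> [[]|xt]; [|split].
    have [h|h] := pselect (ball y t x); first by rewrite !mem_set//; exact/e.
    by rewrite !memNset// => /e.
  rewrite mule0; apply: integral0_eq => x _; rewrite indicE.
  case: (boolP (_ \in _)) => //; rewrite inE => -[/= t0 _].
  by exfalso; apply: nt; rewrite inE/= in_itv/= andbT.
rewrite (@tonelli _ (fun q => H q * ((2 * q.2)%:E * (\1_`]0%R, +oo[ q.2)%:E))%E); last 2 first.
- apply: emeasurable_funM => //; apply: emeasurable_funM; apply/measurable_EFinP.
    exact: mfM.
  by apply: measurableT_comp => //; exact: measurable_indic.
- move=> q; apply: mule_ge0 => //; rewrite indicE; case: (boolP (_ \in _)).
    by rewrite inE/= in_itv/= andbT => q0; rewrite mule1 lee_fin mulr_ge0// ltW.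
  by rewrite mule0.
rewrite [RHS]integral_mkcond epatch_indic; apply: eq_integral => t _ /=.
rewrite indicE; case: (boolP (_ \in _)) => [|_]; last first.
  by rewrite !mule0 integral0_eq// => y _; rewrite !mule0.
rewrite inE/= in_itv/= andbT => t0; rewrite !mule1.
under eq_integral do rewrite muleC.
rewrite ge0_integralZl//.
- by apply: (measurableT_comp mH); exact: measurable_fun_pair.
- by rewrite lee_fin mulr_ge0// ltW.
Qed.

End cone_integrals.

Section square_function.
Context {R : realType}.
Local Notation mu := (@lebesgue_measure R).
Local Notation m2 := ((@lebesgue_measure R) \x (@lebesgue_measure R))%E.
Implicit Types (f g : R -> R) (x y z t c : R).

Fact sdheat_key : unit. Proof. by []. Qed.

(** Parametrized by t with s = t^2, as on the cone; locked for the same reason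
    as [heat]. *)
Definition sdheat := locked_with sdheat_key
  (fun f t y => \int[mu]_z (sdmehler (t ^+ 2) y z * f z)).

Lemma sdheatE f t y : sdheat f t y = \int[mu]_z (sdmehler (t ^+ 2) y z * f z).
Proof. by rewrite /sdheat unlock. Qed.

Lemma sdheat_dheat f t y : tame f -> 0 < t -> sdheat f t y = t ^+ 2 * dheat (t ^+ 2) f y.
Proof.
move=> tf t0; have s0 : 0 < t ^+ 2 by rewrite exprn_gt0.
rewrite sdheatE dheatE -RintegralZl//.
  by apply: eq_Rintegral => z _; rewrite /sdmehler; move: (mehler _ _ _) (dlog_mehler _ _ _) => a b; ring.
have := integrableZl measurableT (t ^+ 2)^-1 (sdmehler_integrable y tf s0).
apply: eq_integrable => // z _; rewrite /= -EFinM /sdmehler; congr EFin.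
by move: (mehler _ _ _) (dlog_mehler _ _ _) => a b; field; rewrite gt_eqF.
Qed.

Lemma mf_sdheat d (T : measurableType d) (r u : T -> R) f : measurable_fun setT f ->
  measurable_fun setT r -> measurable_fun setT u ->
  measurable_fun setT (fun p => sdheat f (r p) (u p)).
Proof.
move=> mf mr mu_.
rewrite (_ : (fun p => _) = (fun p => \int[mu]_z (sdmehler (r p ^+ 2) (u p) z * f z))); last first.
  by apply/funext => p; rewrite sdheatE.
apply: (@mf_Rintegral _ _ _ _ _ mu (fun q => sdmehler (r q.1 ^+ 2) (u q.1) q.2 * f q.2)).
apply: mfM; last exact: (measurableT_comp mf measurable_snd).
apply: mf_sdmehler => //.
  by apply/mfX; exact: (measurableT_comp mr measurable_fst).
exact: (measurableT_comp mu_ measurable_fst).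
Qed.

Lemma sdheat_energy f t : 0 < t -> bounded_L1 f ->
  (\int[mu]_y (sdheat f t y ^+ 2)%:E <=
   (4 * (energy f (t ^+ 2 / 2) - energy f (t ^+ 2)))%:E)%E.
Proof.
move=> t0 bf; have s0 : 0 < t ^+ 2 by rewrite exprn_gt0.
have tf := bounded_L1_tame bf.
have := @dheat_energy R (t ^+ 2) (t ^+ 2 / 2) f.
have h0 : 0 < t ^+ 2 / 2 by rewrite divr_gt0.
have h1 : t ^+ 2 / 2 < t ^+ 2 by rewrite ltr_pdivrMr// ltr_pMr// ltr1n.
have -> : t ^+ 2 - t ^+ 2 / 2 = t ^+ 2 / 2 by rewrite {1}[t ^+ 2]splitr addrK.
move=> /(_ h0 h1 bf) H.
apply: (@le_trans _ _ (\int[mu]_y (4%:E * ((t ^+ 2 / 2 * dheat (t ^+ 2) f y) ^+ 2)%:E))%E).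
  apply: le_int0 => y _; rewrite -?EFinM lee_fin ?sqr_ge0//.
  by rewrite sdheat_dheat// le_eqVlt; apply/orP; left; apply/eqP; field.
rewrite ge0_integralZl_EFin//.
- by rewrite EFinM lee_wpmul2l.
- by move=> y _; rewrite lee_fin sqr_ge0.
- by apply/measurable_EFinP/mfX/mfM => //; apply: mf_dheat; case: tf.
Qed.

Definition slice f t : \bar R := (\int[mu]_y (sdheat f t y ^+ 2 / t)%:E)%E.

Lemma mf_slice f : measurable_fun setT f -> measurable_fun (`]0%R, +oo[ : set R) (slice f).
Proof.
move=> mf.
pose G (p : R * R) := (`|sdheat f p.1 p.2 ^+ 2 / p.1|)%:E.
have mG : measurable_fun setT G.
  apply/measurable_EFinP/measurableT_comp => //; apply: mfM; last exact: mfV.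
  by apply/mfX/mf_sdheat.
apply: (@eq_measurable_fun _ _ _ _ _ (fun t => \int[mu]_y G (t, y))%E).
  move=> t; rewrite inE/= in_itv/= andbT => t0; apply: eq_integral => y _.
  by rewrite /G/= ger0_norm// divr_ge0 ?sqr_ge0// ltW.
apply: (@measurable_funS _ _ _ _ setT) => //.
by apply: (measurable_fun_fubini_tonelli_F (m2 := mu) G) => // q; rewrite lee_fin.
Qed.

Lemma slice_le f t : 0 < t -> bounded_L1 f ->
  (slice f t <= (t^-1 * (4 * (energy f (t ^+ 2 / 2) - energy f (t ^+ 2))))%:E)%E.
Proof.
move=> t0 bf; have [mf _ _] := bf.
apply: (@le_trans _ _ (\int[mu]_y (t^-1%:E * (sdheat f t y ^+ 2)%:E))%E).
  apply: le_int0 => y _; first by rewrite lee_fin divr_ge0 ?sqr_ge0// ltW.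
  by rewrite -EFinM mulrC.
rewrite ge0_integralZl_EFin//.
- by rewrite EFinM lee_wpmul2l ?sdheat_energy// lee_fin invr_ge0 ltW.
- by move=> y _; rewrite lee_fin sqr_ge0.
- apply/measurable_EFinP/mfX.
  exact: mf_sdheat.
- by rewrite invr_ge0 ltW.
Qed.

Definition dyadic_energy f c k := energy f (c ^+ 2 / 4 * 4 ^+ k).

(** For c 2^k <= t < c 2^(k+1) monotonicity of the energy replaces its values
    at t^2 / 2 and t^2 by those at c^2 4^k / 4 and c^2 4^(k+1), which are two
    dyadic steps apart; hence the telescoping sum has two terms at each end. *)
Lemma slice_dyadic f c K : 0 < c -> bounded_L1 f ->
  (\int[mu]_(t in `[c, (c * 2 ^+ K)%R[) slice f t <= (4 * (dyadic_energy f c 0 + dyadic_energy f c 1 - dyadic_energy f c K - dyadic_energy f c K.+1))%:E)%E.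
Proof.
move=> c0 bf; set m := dyadic_energy f c; have [mf _ _] := bf.
have s0 t : (0 <= t)%R -> (0 <= slice f t)%E.
  by move=> t0; apply: integral_ge0 => y _; rewrite lee_fin divr_ge0 ?sqr_ge0.
elim: K => [|K IH].
  rewrite expr0 mulr1 set_itvco0 integral_set0 lee_fin.
  by rewrite (_ : 4 * _ = 0)//; ring.
have q0 : 0 < c * 2 ^+ K by rewrite mulr_gt0// exprn_gt0.
have cq : c <= c * 2 ^+ K by rewrite ler_peMr ?exprn_ege1 ?ler1n// ltW.
have qq : c * 2 ^+ K <= c * 2 ^+ K.+1.
  by rewrite exprS mulrCA ler_peMl ?ler1n// ltW.
have e4 : 4 ^+ K = (2 ^+ K) ^+ 2 :> R.
  by rewrite (_ : 4 = 2 ^+ 2); [rewrite -!exprM mulnC|rewrite -natrX].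
have step : (\int[mu]_(t in `[(c * 2 ^+ K)%R, (c * 2 ^+ K.+1)%R[) slice f t <=
    (4 * (m K - m K.+2))%:E)%E.
  apply: (@le_trans _ _ (\int[mu]_(t in `[(c * 2 ^+ K)%R, (c * 2 ^+ K.+1)%R[)
     ((c * 2 ^+ K)^-1 * (4 * (m K - m K.+2)))%:E)%E).
    apply: le_int0 => t; rewrite /= in_itv/= => /andP[qt tq].
      by apply: s0; exact: le_trans (ltW q0) qt.
    have t0 : 0 < t by exact: lt_le_trans qt.
    apply: (le_trans (slice_le t0 bf)); rewrite lee_fin.
    have e1 : c ^+ 2 / 4 * 4 ^+ K < t ^+ 2 / 2.
      have -> : c ^+ 2 / 4 * 4 ^+ K = (c * 2 ^+ K) ^+ 2 / 4.
        by rewrite exprMn e4; move: (2 ^+ K) => q; ring.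
      have : (c * 2 ^+ K) ^+ 2 <= t ^+ 2 by rewrite ler_sqr ?nnegrE// ltW.
      have : 0 < (c * 2 ^+ K) ^+ 2 by rewrite exprn_gt0.
      lra.
    have e2 : t ^+ 2 < c ^+ 2 / 4 * 4 ^+ K.+2.
      have -> : c ^+ 2 / 4 * 4 ^+ K.+2 = (c * 2 ^+ K.+1) ^+ 2.
        by rewrite (exprS 4 K.+1) (exprS 4 K) e4 (exprS 2 K); move: (2 ^+ K) => q; field.
      by rewrite ltr_sqr ?nnegrE// ltW// (lt_trans _ tq).
    have s4 : 0 < c ^+ 2 / 4 * 4 ^+ K by rewrite mulr_gt0 ?exprn_gt0// divr_gt0 ?exprn_gt0.
    have t2 : 0 < t ^+ 2 by rewrite exprn_gt0.
    have E1 := energy_le s4 e1 bf; have E2 := energy_le t2 e2 bf.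
    have E3 : energy f (t ^+ 2) <= energy f (t ^+ 2 / 2).
      by apply: energy_le => //; rewrite ?divr_gt0// ltr_pdivrMr// ltr_pMr// ltr1n.
    apply: ler_pM; rewrite ?invr_ge0 ?(ltW t0)//.
    - by rewrite mulr_ge0// subr_ge0.
    - by rewrite lef_pV2.
    - by rewrite ler_pM2l// lerB.
  rewrite integral_cst//= lebesgue_measure_itv/= lte_fin.
  have -> : c * 2 ^+ K < c * 2 ^+ K.+1.
    by rewrite exprS mulrCA ltr_pMl// ltr1n.
  rewrite -EFinD -EFinM lee_fin le_eqVlt; apply/orP; left; apply/eqP.
  by rewrite exprS; move: (2 ^+ K) q0 => q q0; field; rewrite !gt_eqF//; nra.
have -> : `[c, (c * 2 ^+ K.+1)%R[%classic =
    `[c, (c * 2 ^+ K)%R[ `|` `[(c * 2 ^+ K)%R, (c * 2 ^+ K.+1)%R[.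
  by rewrite -itv_bndbnd_setU// ?bnd_simp.
have sub : `[c, (c * 2 ^+ K)%R[ `|` `[(c * 2 ^+ K)%R, (c * 2 ^+ K.+1)%R[ `<=` `]0%R, +oo[%classic.
  move=> t; rewrite /= !in_itv/= andbT => -[/andP[h _]|/andP[h _]].
    exact: lt_le_trans h.
  exact: lt_le_trans h.
rewrite ge0_integral_setU//.
- apply: (le_trans (leeD IH step)); rewrite -EFinD lee_fin.
  by rewrite le_eqVlt; apply/orP; left; apply/eqP; ring.
- by apply: (measurable_funS _ sub (mf_slice mf)).
- by move=> t /sub; rewrite /= in_itv/= andbT => t0; apply: s0; exact: ltW.
- apply/disj_setPLR => t /=; rewrite !in_itv/= => /andP[_ h] /andP[h' _].
  by move: h; rewrite ltNge h'.
Qed.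

Lemma slice_total f : bounded_L1 f ->
  (\int[mu]_(t in `]0%R, +oo[) slice f t <= (8 * ip f f)%:E)%E.
Proof.
move=> bf; have [mf _ _] := bf.
(* Dyadic intervals exhausting the half line, in the form required by
   slice_dyadic. *)
pose S n : set (measurableTypeR R) := `[2 ^- n, 2 ^- n * 2 ^+ (n + n)[%classic.
have p0 n : 0 < (2 : R) ^- n by rewrite invr_gt0 exprn_gt0.
have pE n : (2 : R) ^- n * 2 ^+ (n + n) = 2 ^+ n.
  by rewrite exprD mulKf// expf_neq0.
have SE : `]0%R, +oo[%classic = \bigcup_n S n.
  apply/seteqP; split => t; rewrite /= in_itv/= ?andbT.
    move=> t0; pose n := (Num.truncn (t + t^-1)).+1.
    have nt : t + t^-1 < 2 ^+ n.
      apply: (lt_trans (truncnS_gt _)); rewrite -natrX ltr_nat.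
      exact: ltn_expl.
    have i0 : 0 < t^-1 by rewrite invr_gt0.
    exists n => //; rewrite /S/= in_itv/= pE; apply/andP; split; last by lra.
    rewrite -[t]invrK lef_pV2 ?posrE ?exprn_gt0//.
    by apply/ltW/(le_lt_trans _ nt); rewrite lerDr ltW.
  by move=> [n _]; rewrite /S/= in_itv/= => /andP[h _]; exact: lt_le_trans h.
have Spos n t : S n t -> `]0%R, +oo[%classic t.
  by rewrite /S/= !in_itv/= andbT => /andP[h _]; exact: lt_le_trans h.
have Sm : {homo S : n m / (n <= m)%N >-> (n <= m)%O}.
  move=> n m nm; apply/subsetPset => t; rewrite /S/= !in_itv/= !pE => /andP[h1 h2].
  have le2 : (2 : R) ^+ n <= 2 ^+ m by rewrite ler_eXn2l// ltr1n.
  apply/andP; split; last exact: lt_le_trans le2.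
  by apply: le_trans h1; rewrite lef_pV2 ?posrE ?exprn_gt0.
have := @ge0_nondecreasing_set_cvg_integral _ _ _ S (slice f) mu Sm
  (fun n => measurable_itv _) (fun n => measurable_funS _ (Spos n) (mf_slice mf)).
have s0 (n : nat) t : S n t -> (0 <= slice f t)%E.
  move=> /Spos; rewrite /= in_itv/= andbT => t0.
  by apply: integral_ge0 => y _; rewrite lee_fin divr_ge0 ?sqr_ge0// ltW.
rewrite -SE => /(_ (measurable_itv _) s0) H.
rewrite -(cvg_lim _ H)//; apply: lime_le; first exact: cvgP H.
near=> n; apply: (le_trans (slice_dyadic (n + n) (p0 n) bf)); rewrite lee_fin.
have pos k : 0 < (2 ^- n) ^+ 2 / 4 * 4 ^+ k :> R.
  by rewrite mulr_gt0 ?exprn_gt0// divr_gt0 ?exprn_gt0.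
have := energy_le0 (pos 0) bf; have := energy_le0 (pos 1) bf.
have := ip_ge0 (heat ((2 ^- n) ^+ 2 / 4 * 4 ^+ (n + n)) f).
have := ip_ge0 (heat ((2 ^- n) ^+ 2 / 4 * 4 ^+ (n + n).+1) f).
rewrite /dyadic_energy /energy; lra.
Unshelve. all: by end_near. Qed.

(** The square of the area function for q = 2, restricted to a set E of the
    half plane; the truncations by E enter in the good-lambda argument. *)
Definition area2 (E : set (R * R)) f x : \bar R :=
  (\int[m2]_(p in area_cone x `&` E) (sdheat f p.2 p.1 ^+ 2 / p.2 ^+ 2)%:E)%E.

Lemma area2_L2 f : bounded_L1 f -> (\int[mu]_x area2 setT f x <= (16 * ip f f)%:E)%E.
Proof.
move=> bf; have [mf _ _] := bf.
under eq_integral do rewrite /area2 setIT.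
rewrite integral_cone; last 2 first.
- apply/measurable_EFinP/mfM; first by apply/mfX; exact: mf_sdheat.
  by apply/mfV/mfX.
- by move=> p; rewrite lee_fin divr_ge0 ?sqr_ge0.
apply: (@le_trans _ _ (\int[mu]_(t in `]0%R, +oo[) (2%:E * slice f t))%E).
  apply: le_int0 => t; rewrite /= in_itv/= andbT => t0.
    apply: mule_ge0; first by rewrite lee_fin mulr_ge0// ltW.
    by apply: integral_ge0 => y _; rewrite lee_fin divr_ge0 ?sqr_ge0.
  rewrite EFinM -muleA; apply: lee_wpmul2l => //.
  rewrite -ge0_integralZl_EFin//.
  - apply: le_int0 => y _; rewrite -?EFinM lee_fin.
      by rewrite mulr_ge0// ?divr_ge0 ?sqr_ge0// ltW.
    by rewrite le_eqVlt; apply/orP; left; apply/eqP; field; rewrite gt_eqF.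
  - by move=> y _; rewrite lee_fin divr_ge0 ?sqr_ge0.
  - apply/measurable_EFinP/mfM => //; apply/mfX.
    exact: mf_sdheat.
  - exact: ltW.
rewrite ge0_integralZl//.
- have -> : 16 * ip f f = 2 * (8 * ip f f) by ring.
  by rewrite EFinM lee_wpmul2l// slice_total.
- exact: mf_slice.
- move=> t; rewrite /= in_itv/= andbT => t0.
  by apply: integral_ge0 => y _; rewrite lee_fin divr_ge0 ?sqr_ge0// ltW.
Qed.

End square_function.

(** * Components of open subsets of the line *)

Section components.
Context {R : realType}.
Local Notation mu := (@lebesgue_measure R).
Implicit Types (U : set R).

Lemma open_interval_finite (I : set R) : open I -> is_interval I -> (mu I < +oo)%E ->
  exists ab : R * R, ab.1 <= ab.2 /\ I = `]ab.1, ab.2[%classic.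
Proof.
move=> oI /is_intervalP iI fI.
have [I0|/set0P[c Ic]] := eqVneq I set0.
  by exists (0, 0) => /=; rewrite set_itvoo0.
have nlim l : I l -> exists2 e, 0 < e & I (l - e) /\ I (l + e).
  move=> Il; have /nbhs_ballP[e /= e0 be] := oI l Il.
  have e2 : 0 < e / 2 by rewrite divr_gt0.
  exists (e / 2) => //; split; apply: be; rewrite /ball/=.
    by rewrite opprB addrC subrK gtr0_norm// ltr_pdivrMr// ltr_pMr// ltr1n.
  by rewrite opprD addrA subrr sub0r normrN gtr0_norm// ltr_pdivrMr// ltr_pMr// ltr1n.
move: fI Ic nlim; rewrite iI; case: (Rhull I) => l r.
rewrite lebesgue_measure_itv.
case: l r => [[] l|[]] [[] r|[]]//=; rewrite ?in_itv/= ?lte_fin ?ltNyr ?ltry//=.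
- move=> _ /andP[lc cr] /(_ l).
  rewrite /= !in_itv/= lexx (le_lt_trans lc cr) => /(_ isT)[e e0].
  by rewrite !in_itv/= => -[/andP[h _] _]; move: h e0; clear; lra.
- move=> _ /andP[lc cr] /(_ l).
  rewrite /= !in_itv/= lexx (le_trans lc cr) => /(_ isT)[e e0].
  by rewrite !in_itv/= => -[/andP[h _] _]; move: h e0; clear; lra.
- by rewrite andbF.
- by move=> _ /andP[lc cr] _; exists (l, r) => /=; rewrite ltW// (lt_trans lc).
- move=> _ /andP[lc cr] /(_ r).
  rewrite /= !in_itv/= lexx (lt_le_trans lc cr) => /(_ isT)[e e0].
  by rewrite !in_itv/= => -[_ /andP[_ h]]; move: h e0; clear; lra.
- by rewrite andbF.
Qed.

(** Components of an open set of finite measure are bounded, and their end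
    points, which do not belong to the set, are the points where the negation
    of the condition defining the set can be used. The sequence may contain
    empty intervals, when there are finitely many components. *)
Lemma open_components U : open U -> (mu U < +oo)%E ->
  exists ab : nat -> R * R,
  [/\ forall i, (ab i).1 <= (ab i).2,
      trivIset setT (fun i => `](ab i).1, (ab i).2[%classic),
      U = \bigcup_i `](ab i).1, (ab i).2[%classic
    & forall i, (ab i).1 < (ab i).2 -> ~ U (ab i).1 /\ ~ U (ab i).2].
Proof.
move=> oU fU.
have [I [oI tI UI]] := OpenSetDisjointItvs.open_disjoint_itv oU.
have mI i : measurable (I i) by apply: open_measurable; exact: (oI i).1.
have fI i : (mu (I i) < +oo)%E.
  apply: le_lt_trans fU; apply: le_measure; rewrite ?inE//.
  - exact: mI.
  - exact: open_measurable.
  - by rewrite UI; exact: bigcup_sup.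
have /choice[ab abP] i := open_interval_finite (oI i).1 (oI i).2 (fI i).
have IE : I = fun i => `](ab i).1, (ab i).2[%classic by apply/funext => i; case: (abP i).
rewrite IE in oI tI UI mI; exists ab; split => //.
- by move=> i; case: (abP i).
- move=> i lti; rewrite UI.
  have key c d : ~ `](ab i).1, (ab i).2[%classic c -> 0 < d ->
      (forall e, 0 < e -> e < d -> `](ab i).1, (ab i).2[%classic (c - e) \/
        `](ab i).1, (ab i).2[%classic (c + e)) -> ~ (\bigcup_i `](ab i).1, (ab i).2[%classic) c.
    move=> nc d0 near [j _ Ijc].
    have ij : i != j by apply/eqP => ij; apply: nc; rewrite ij.
    have /nbhs_ballP[e /= e0 be] := (oI j).1 c Ijc.
    pose x := Num.min e d / 2.
    have m0 : 0 < Num.min e d by rewrite lt_min e0.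
    have x0 : 0 < x by rewrite divr_gt0.
    have xm : x < Num.min e d by rewrite ltr_pdivrMr// ltr_pMr// ltr1n.
    have [xe xd] : x < e /\ x < d by move: xm; rewrite lt_min => /andP[].
    have b1 : ball c e (c - x) by rewrite /ball/= opprB addrC subrK gtr0_norm.
    have b2 : ball c e (c + x) by rewrite /ball/= opprD addrA subrr sub0r normrN gtr0_norm.
    case: (near x x0 xd) => h.
      by move: (tI i j Logic.I Logic.I (ex_intro _ _ (conj h (be _ b1)))) ij => /eqP ->.
    by move: (tI i j Logic.I Logic.I (ex_intro _ _ (conj h (be _ b2)))) ij => /eqP ->.
  have d0 : 0 < (ab i).2 - (ab i).1 by rewrite subr_gt0.
  split; apply: (key _ _ _ d0); rewrite /= ?in_itv/= ?ltxx ?andbF// => e e0 ed.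
    by right; rewrite /= in_itv/=; apply/andP; split; lra.
  by left; rewrite /= in_itv/=; apply/andP; split; lra.
Qed.

End components.

(** * Pointwise control on the cone *)

Section series.
Context {R : realType}.
Implicit Types (u v : nat -> \bar R).

(** A series of signed extended reals need not converge; here it does, because
    a finite right-hand side makes it absolutely convergent. *)
Lemma abse_eseries_le u v : (forall i, `|u i| <= v i)%E ->
  (`| \sum_(0 <= i <oo) u i | <= \sum_(0 <= i <oo) v i)%E.
Proof.
move=> uv; have v0 i : (0 <= v i)%E := le_trans (abse_ge0 _) (uv i).
case E : (\sum_(0 <= i <oo) v i)%E => [B| |]; last 2 first.
- by rewrite leey.
- by have : (0 <= \sum_(0 <= i <oo) v i)%E := nneseries_ge0 (fun i _ _ => v0 i); rewrite E.
have vB i : (v i <= B%:E)%E by rewrite -E; exact: nneseries_ge_term.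
have /choice[r ur] i : exists r : R, u i = r%:E.
  have : u i \is a fin_num by rewrite -abse_fin_num ge0_fin_numE// (le_lt_trans (uv i))// (le_lt_trans (vB i))// ltry.
  by move=> /fineK <-; exists (fine (u i)).
have sumB n : \sum_(0 <= i < n) `|r i| <= B.
  rewrite -lee_fin -sumEFin -E; apply: le_trans (nneseries_lim_ge n _); last by [].
  by apply: lee_sum => i _; have := uv i; rewrite ur.
have cs : cvgn (series (fun i => r i)).
  apply: normed_cvg; apply: (@nondecreasing_is_cvgn R (fun n => \sum_(0 <= i < n) `|r i|)).
    by apply/nondecreasing_seqP => n; rewrite big_nat_recr//= lerDl.
  by exists B => _ [n _ <-]; exact: sumB.
have cE : (\sum_(0 <= i < n) u i)%E @[n --> \oo] --> (limn (series r))%:E.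
  rewrite (_ : (fun n => \sum_(0 <= i < n) u i)%E = EFin \o series r); last first.
    by apply/funext => n; rewrite /= /series/= -sumEFin; apply: eq_bigr => i _.
  by apply: cvg_EFin; [near=> n|exact: cs].
have cA : `|\sum_(0 <= i < n) u i|%E @[n --> \oo] --> `|(limn (series r))%:E|%E.
  exact: cvg_abse cE.
rewrite (cvg_lim _ cE)// -(cvg_lim _ cA)//; apply: lime_le; first exact: cvgP cA.
near=> n; apply: (le_trans (lee_abs_sum _ _ _)).
under eq_bigr do rewrite ur abse_EFin.
by rewrite sumEFin lee_fin.
Unshelve. all: by end_near. Qed.

End series.

Section sup_bound.
Context {R : realType}.
Local Notation mu := (@lebesgue_measure R).
Local Notation m2 := ((@lebesgue_measure R) \x (@lebesgue_measure R))%E.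
Local Notation HL := (@HL_maximal R).
Implicit Types (f g b : R -> R) (x y z t c : R).

Lemma sdheat_sub f g t y : 0 < t -> tame f -> tame g ->
  sdheat (fun z => f z - g z) t y = sdheat f t y - sdheat g t y.
Proof.
move=> t0 tf tg; have s0 : 0 < t ^+ 2 by rewrite exprn_gt0.
rewrite !sdheatE -RintegralB//; [|exact: sdmehler_integrable..].
by apply: eq_Rintegral => z _; rewrite mulrBr.
Qed.

Lemma sdheat_le f t y (g : R -> \bar R) : measurable_fun setT f ->
  (forall z, (`|sdmehler (t ^+ 2) y z * f z|%:E <= g z)%E) ->
  (`|sdheat f t y|%:E <= \int[mu]_z g z)%E.
Proof.
move=> mf fg; have g0 z : (0 <= g z)%E by apply: le_trans (fg z); rewrite lee_fin.
case E : (\int[mu]_z g z)%E => [c| |]; last 2 first.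
- by rewrite leey.
- by have := @integral_ge0 _ _ _ mu setT g (fun z _ => g0 z); rewrite E.
rewrite lee_fin sdheatE; apply: (@Rint_le _ _ _ mu setT _ g) => //.
  by apply: mfM => //; exact: mf_sdmehler.
by rewrite E.
Qed.

Lemma sdheat_le_poisson f t y : 0 < t -> measurable_fun setT f ->
  (`|sdheat f t y|%:E <= \int[mu]_z (sdmehler_cst * (t / (t ^+ 2 + (y - z) ^+ 2) * `|f z|))%:E)%E.
Proof.
move=> t0 mf; apply: sdheat_le => // z; have s0 : 0 < t ^+ 2 by rewrite exprn_gt0.
rewrite lee_fin normrM mulrA; apply: ler_wpM2r => //.
by have := sdmehler_size y z s0; rewrite sqrtr_sqr (gtr0_norm t0).
Qed.

(** Harnack's inequality for the Poisson kernel. *)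
Lemma poisson_change t x y z : 0 < t -> `|x - y| < 2 * t ->
  t / (t ^+ 2 + (y - z) ^+ 2) <= 9 * (t / (t ^+ 2 + (x - z) ^+ 2)).
Proof.
move=> t0 xy; have d1 : 0 < t ^+ 2 + (y - z) ^+ 2 by rewrite ltr_pwDl ?exprn_gt0 ?sqr_ge0.
have d2 : 0 < t ^+ 2 + (x - z) ^+ 2 by rewrite ltr_pwDl ?exprn_gt0 ?sqr_ge0.
rewrite mulrCA ler_pM2l// ler_pdivlMr// ler_pdivrMl//.
have : (x - y) ^+ 2 <= 4 * t ^+ 2.
  have -> : 4 * t ^+ 2 = (2 * t) ^+ 2 by ring.
  by rewrite -(real_normK (num_real (x - y))) ler_sqr ?nnegrE ?mulr_ge0 ?(ltW t0) ?(ltW xy).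
have := sqr_ge0 ((x - y) - (y - z)).
have -> : x - z = (x - y) + (y - z) by ring.
move: (x - y) (y - z) => u v; rewrite !expr2; nra.
Qed.

Definition sdheat_cst : R := 144 * sdmehler_cst.

Lemma sdheat_cst_gt0 : 0 < sdheat_cst.
Proof. by apply: mulr_gt0; [rewrite ltr0n|exact: sdmehler_cst_gt0]. Qed.

Lemma mf_poisson t x f : measurable_fun setT f ->
  measurable_fun setT (fun z => t / (t ^+ 2 + (x - z) ^+ 2) * `|f z|).
Proof.
move=> mf; apply: mfM; last exact: measurableT_comp.
by apply/mfM => //; apply/mfV/mfD => //; apply/mfX/mfD => //; exact: mfN.
Qed.

Lemma poisson_ge0 t x z : 0 < t -> 0 <= t / (t ^+ 2 + (x - z) ^+ 2).
Proof. by move=> t0; rewrite divr_ge0 ?(ltW t0)// addr_ge0 ?sqr_ge0. Qed.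

(** The pointwise bound that reduces every q >= 2 to q = 2. *)
Lemma sdheat_le_HL f t x y : tame f -> 0 < t -> `|x - y| < 2 * t ->
  (`|sdheat f t y|%:E <= sdheat_cst%:E * HL f x)%E.
Proof.
move=> tf t0 xy; have [mf _] := tf; apply: (le_trans (sdheat_le_poisson y t0 mf)).
have k0 : 0 <= sdmehler_cst :> R by exact/ltW/sdmehler_cst_gt0.
apply: (@le_trans _ _ (\int[mu]_z ((9 * sdmehler_cst)%:E * (t / (t ^+ 2 + (x - z) ^+ 2) * `|f z|)%:E))%E).
  apply: le_int0 => z _; rewrite -?EFinM lee_fin.
    by rewrite mulr_ge0// mulr_ge0// poisson_ge0.
  apply: (@le_trans _ _ (sdmehler_cst * (9 * (t / (t ^+ 2 + (x - z) ^+ 2)) * `|f z|))).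
    by apply: ler_wpM2l => //; apply: ler_wpM2r => //; exact: poisson_change.
  by move: sdmehler_cst (_ / _) => k q; rewrite le_eqVlt; apply/orP; left; apply/eqP; ring.
rewrite ge0_integralZl_EFin//; last first.
- by rewrite mulr_ge0.
- by apply/measurable_EFinP; exact: mf_poisson.
- by move=> z _; rewrite lee_fin mulr_ge0// poisson_ge0.
have -> : sdheat_cst = 9 * sdmehler_cst * 16 by rewrite /sdheat_cst; ring.
rewrite [(9 * sdmehler_cst * 16)%:E]EFinM -muleA; apply: lee_wpmul2l.
  by rewrite lee_fin mulr_ge0.
exact: HL_poisson (tame_loc tf) t0.
Qed.

Lemma HL_one x : (HL (cst 1%R) x <= 1)%E.
Proof.
apply: ge_ereal_sup => _ [r r0 <-]; rewrite /iavg.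
move: r0; rewrite /= in_itv/= andbT => r0.
under eq_integral do rewrite /= normr1.
have mb : measurable (ball x r) by exact: measurable_ball.
rewrite integral_cst//= mul1e !lebesgue_measure_ball ?(ltW r0)//.
by rewrite inver gt_eqF ?mulrn_wgt0// -EFinM mulVf// gt_eqF ?mulrn_wgt0.
Qed.

Lemma int_weight_lty : (\int[mu]_z (`|1 : R| / (1 + z ^+ 2))%:E < +oo)%E.
Proof.
under eq_integral do rewrite normr1 mul1r.
rewrite ge0_symfun_integralT.
- rewrite (_ : [set x | 0 <= x] = `[0, +oo[%classic); last first.
    by apply/seteqP; split => z; rewrite /= in_itv/= andbT.
  by rewrite integral0y_oneDsqr -EFinM ltry.
- by move=> z; rewrite invr_ge0 addr_ge0// sqr_ge0.
- move=> z; apply: cvgV; first by rewrite gt_eqF// ltr_wpDr ?sqr_ge0.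
  by apply: cvgD; [exact: cvg_cst|exact: exprn_continuous].
- by move=> z /=; rewrite sqrrN.
Qed.

(** The integral is pi; the maximal function of the constant 1 gives a bound
    without computing it. *)
Lemma int_poisson1 t x : 0 < t -> (\int[mu]_z (t / (t ^+ 2 + (x - z) ^+ 2))%:E <= 16%:E)%E.
Proof.
move=> t0; have l1 : locally_integrable setT (cst 1 : R -> R).
  by apply: tame_loc; split => //; exact: int_weight_lty.
apply: (@le_trans _ _ (16%:E * HL (cst 1%R) x)%E).
  apply: le_trans (HL_poisson x l1 t0).
  by apply: le_int0 => z _; rewrite lee_fin ?poisson_ge0// normr1 mulr1.
by rewrite -[leRHS]mule1 lee_wpmul2l// HL_one.
Qed.

(** Regions cut out of a cone have horizontal sections of known length, so
    Tonelli reduces their integrals to one variable. *)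
Lemma int_section_le (S : set (R * R)) (phi w : R -> R) : measurable S ->
  measurable_fun setT phi -> (forall t, 0 <= phi t) ->
  (forall t, (mu [set y | S (y, t)] <= (w t)%:E)%E) ->
  (\int[m2]_(p in S) (phi p.2)%:E <= \int[mu]_t (phi t * w t)%:E)%E.
Proof.
move=> mS mphi p0 wS; rewrite integral_mkcond epatch_indic.
have mi : measurable_fun setT (fun p : R * R => \1_S p : R) by exact: measurable_indic.
rewrite fubini_tonelli2//; last 2 first.
- apply: emeasurable_funM; apply/measurable_EFinP => //.
  exact: (measurableT_comp mphi measurable_snd).
- by move=> p; rewrite mule_ge0// lee_fin.
apply: le_int0 => t _.
  by apply: integral_ge0 => y _; rewrite mule_ge0// lee_fin.
rewrite /fubini_G/= ge0_integralZl//; last 2 first.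
- by apply/measurable_EFinP; exact: (measurableT_comp mi (measurable_pair2 t)).
- by rewrite lee_fin.
rewrite EFinM lee_wpmul2l ?lee_fin//.
rewrite (_ : (fun y => (\1_S (y, t))%:E) = (EFin \o \1_[set y | S (y, t)])); last first.
  by apply/funext => y /=; rewrite !indicE.
rewrite integral_indic ?setIT//; last by have := measurable_pair2 t measurableT mS; rewrite setTI.
exact: wS.
Qed.

End sup_bound.

(** * The weak type estimate *)

Section bad_part.
Context {R : realType}.
Local Notation mu := (@lebesgue_measure R).
Local Notation m2 := ((@lebesgue_measure R) \x (@lebesgue_measure R))%E.
Context (ab : nat -> R * R) (ab_le : forall i, (ab i).1 <= (ab i).2).
Let I i : set (measurableTypeR R) := `](ab i).1, (ab i).2[%classic.
Let h i : R := (ab i).2 - (ab i).1.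
Let m i : R := ((ab i).1 + (ab i).2) / 2.
Let q i (x : R) : R := h i ^+ 2 + (m i - x) ^+ 2.

Let h0 i : 0 <= h i. Proof. by rewrite subr_ge0. Qed.

Let q0 i x : 0 < h i -> 0 < q i x.
Proof. by move=> hi; rewrite ltr_pwDl ?exprn_gt0 ?sqr_ge0. Qed.

Definition bad_cst : R := sdmehler_cst * 324.

Lemma bad_cst_gt0 : 0 < bad_cst.
Proof. by apply: mulr_gt0; [exact: sdmehler_cst_gt0|rewrite ltr0n]. Qed.

Let far_dist (t H M x y c : R) : 0 < t -> `|x - y| < t -> 0 <= H -> H <= `|M - x| ->
  `|c - M| <= H / 2 -> t ^+ 2 + (H ^+ 2 + (M - x) ^+ 2) <= 18 * (t ^+ 2 + (y - c) ^+ 2).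
Proof.
move=> t0 xy H0 Hx cM.
have hD : `|M - x| <= `|c - M| + (`|y - c| + `|x - y|).
  have -> : M - x = - ((c - M) + ((y - c) + (x - y))) by ring.
  by rewrite normrN; apply: (le_trans (ler_normD _ _)); rewrite lerD2l ler_normD.
rewrite -(real_normK (num_real (M - x))) -(real_normK (num_real (y - c))).
move: (`|M - x|) (normr_ge0 (M - x)) (`|y - c|) (normr_ge0 (y - c)) (`|x - y|) xy (`|c - M|) cM Hx hD.
move=> D D0 Y Y0 X Xt Z ZH HD hD.
have D2 : D <= 2 * t + 2 * Y by lra.
have DD : D ^+ 2 <= (2 * t + 2 * Y) ^+ 2 by rewrite ler_sqr ?nnegrE//; lra.
have HH : H ^+ 2 <= D ^+ 2 by rewrite ler_sqr ?nnegrE.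
have := sqr_ge0 (t - Y); move: DD HH; rewrite !expr2; nra.
Qed.

(** For x outside the doubled interval, and (y, t) in the cone over x, the sum
    t + |y - c| is at least a multiple of t + h i + |x - m i| for every point
    c of the interval. *)
Lemma bad_kernel i t x y z : 0 < t -> `|x - y| < t -> h i <= `|m i - x| -> I i z ->
  `|sdmehler (t ^+ 2) y z - sdmehler (t ^+ 2) y (m i)| <=
  bad_cst * (t ^+ 2 / (t ^+ 2 + q i x) ^+ 2 * h i).
Proof.
move=> t0 xy hx; rewrite /I/= in_itv/= => /andP[az zb].
have s0 : 0 < t ^+ 2 by rewrite exprn_gt0.
have [c cm] := sdmehler_lipschitz y z (m i) s0.
have zm : `|z - m i| <= h i / 2.
  by rewrite ler_norml /m /h; apply/andP; split; lra.
have d0 : 0 < t ^+ 2 + (y - c) ^+ 2 by rewrite ltr_pwDl ?sqr_ge0.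
have Q0 : 0 <= q i x by rewrite addr_ge0 ?sqr_ge0.
have d1 : 0 < t ^+ 2 + q i x by rewrite ltr_pwDl.
have far := far_dist t0 xy (h0 i) hx (le_trans cm zm).
have k0 : 0 <= sdmehler_cst :> R by exact/ltW/sdmehler_cst_gt0.
move=> /le_trans; apply; rewrite /bad_cst; move: sdmehler_cst k0 => k k0.
apply: (@le_trans _ _ (k * (324 * (t ^+ 2 / (t ^+ 2 + q i x) ^+ 2)) * h i)); last first.
  by rewrite le_eqVlt; apply/orP; left; apply/eqP; ring.
apply: ler_pM => //.
- by apply: mulr_ge0 => //; rewrite divr_ge0 ?(ltW s0) ?sqr_ge0.
- apply: ler_wpM2l => //.
  rewrite mulrCA ler_pM2l// ler_pdivlMr ?exprn_gt0// ler_pdivrMl ?exprn_gt0//.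
  have -> : (t ^+ 2 + (y - c) ^+ 2) ^+ 2 * 324 = (18 * (t ^+ 2 + (y - c) ^+ 2)) ^+ 2 by ring.
  by rewrite ler_sqr ?nnegrE ?mulr_ge0 ?(ltW d0) ?(ltW d1).
- by apply: (le_trans zm); rewrite ler_pdivrMr// ler_peMr// ler1n.
Qed.

Context (b : R -> R) (beta : nat -> R).
Context (tI : trivIset setT I) (ib : mu.-integrable setT (EFin \o b))
  (b_supp : forall z, ~ (\bigcup_i I i) z -> b z = 0)
  (b_mean : forall i, \int[mu]_(z in I i) b z = 0)
  (b_beta : forall i, (\int[mu]_(z in I i) `|b z|%:E <= (beta i)%:E)%E).

Let mb : measurable_fun setT b.
Proof. by case/integrableP : ib => /measurable_EFinP. Qed.

Let mI i : measurable (I i). Proof. exact: measurable_itv. Qed.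

Lemma beta_ge0 i : 0 <= beta i.
Proof. by rewrite -lee_fin; apply: le_trans (b_beta i); apply: integral_ge0 => z _; rewrite lee_fin. Qed.

(** As b has mean zero on each interval, the kernel may be replaced there by
    its difference with the value at the centre. *)
Lemma sdheat_bad t x y : 0 < t -> `|x - y| < t -> (forall i, h i <= `|m i - x|) ->
  (`|sdheat b t y|%:E <= \sum_(0 <= i <oo)
     (bad_cst * (t ^+ 2 / (t ^+ 2 + q i x) ^+ 2 * h i) * beta i)%:E)%E.
Proof.
move=> t0 xy hx; have s0 : 0 < t ^+ 2 by rewrite exprn_gt0.
have ihb := sdmehler_integrable y (tame_integrable ib) s0.
have -> : `|sdheat b t y|%:E = `|\int[mu]_z (sdmehler (t ^+ 2) y z * b z)%:E|%E.
  by rewrite sdheatE -abse_EFin /Rintegral fineK//; exact: integrable_fin_num.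
have -> : (\int[mu]_z (sdmehler (t ^+ 2) y z * b z)%:E =
    \int[mu]_(z in \bigcup_i I i) (sdmehler (t ^+ 2) y z * b z)%:E)%E.
  rewrite [RHS]integral_mkcond; apply: eq_integral => z _; rewrite patchE.
  by case: ifPn => // /negP; rewrite inE => /b_supp ->; rewrite mulr0.
have mU : measurable (\bigcup_i I i) by exact: bigcup_measurable.
rewrite (integral_bigcup tI mI (integrableS measurableT mU (@subsetT _ _) ihb)).
apply: abse_eseries_le => i.
have ihi : mu.-integrable (I i) (fun z => (sdmehler (t ^+ 2) y z * b z)%:E) by exact: (integrableS measurableT (mI i) (@subsetT _ _) ihb).
have ibi : mu.-integrable (I i) (EFin \o b) by exact: (integrableS measurableT (mI i) (@subsetT _ _) ib).
have -> : (\int[mu]_(z in I i) (sdmehler (t ^+ 2) y z * b z)%:E =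
   (\int[mu]_(z in I i) ((sdmehler (t ^+ 2) y z - sdmehler (t ^+ 2) y (m i)) * b z))%:E)%E.
  have icb : mu.-integrable (I i) (EFin \o (fun z => sdmehler (t ^+ 2) y (m i) * b z)).
    by have := integrableZl (mI i) (sdmehler (t ^+ 2) y (m i)) ibi; apply: eq_integrable.
  under eq_Rintegral do rewrite mulrBl.
  rewrite RintegralB// (RintegralZl _ (mI i) ibi) b_mean mulr0 subr0.
  by rewrite /Rintegral fineK//; exact: integrable_fin_num.
rewrite abse_EFin lee_fin.
pose c := bad_cst * (t ^+ 2 / (t ^+ 2 + q i x) ^+ 2 * h i).
have c0 : 0 <= c.
  by rewrite mulr_ge0 ?(ltW bad_cst_gt0)// mulr_ge0// divr_ge0 ?sqr_ge0// ltW.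
apply: (@Rint_le _ _ _ mu (I i) _ (fun z => c%:E * `|b z|%:E)%E) => //.
- apply: (@measurable_funS _ _ _ _ setT) => //; apply: mfM => //.
  by apply: mfD; [exact: mf_sdmehler|exact: measurable_cst].
- move=> z Iz; rewrite -EFinM lee_fin normrM; apply: ler_wpM2r => //.
  exact: bad_kernel.
- rewrite ge0_integralZl_EFin//.
  + by rewrite -/c (EFinM c); apply: lee_wpmul2l.
  + apply/measurable_EFinP; apply: (@measurable_funS _ _ _ _ setT) => //.
    exact: measurableT_comp.
Qed.

(** A sum of Poisson kernels at heights h i centred at m i, with masses
    beta i: integrable, and an upper bound for the contribution of the bad
    part away from the intervals. *)
Definition bad_majorant x : \bar R := (\sum_(0 <= i <oo) (beta i * (h i / q i x))%:E)%E.

Let term_le i t x : 0 < t -> t ^+ 2 / (t ^+ 2 + q i x) ^+ 2 * h i <= h i / q i x.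
Proof.
move=> t0; have := h0 i; rewrite le_eqVlt => /predU1P[<-|hi]; first by rewrite mulr0 mul0r.
rewrite mulrC; apply: ler_wpM2l => //; have := q0 x hi; move: (q i x) => Q Q0.
have s0 : 0 < t ^+ 2 by rewrite exprn_gt0.
rewrite -[leRHS]div1r ler_pdivlMr// mulrAC ler_pdivrMr ?exprn_gt0 ?addr_gt0// mul1r.
by move: (t ^+ 2) s0 => s s0; rewrite expr2; nra.
Qed.

Let aux_rt (r t : R) : 0 < r -> 0 < t ->
  t *+ 2 <= (t ^+ 2 + r ^+ 2) ^+ 2 * ((r ^+ 2)^-1 * (r / (r ^+ 2 + t ^+ 2))).
Proof.
move=> r0 t0; have d0 : 0 < r ^+ 2 + t ^+ 2 by rewrite addr_gt0 ?exprn_gt0.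
have -> : (t ^+ 2 + r ^+ 2) ^+ 2 * ((r ^+ 2)^-1 * (r / (r ^+ 2 + t ^+ 2))) = (t ^+ 2 + r ^+ 2) / r.
  by field; rewrite !gt_eqF.
rewrite ler_pdivlMr// -mulr_natr !expr2; have := sqr_ge0 (t - r); rewrite expr2; nra.
Qed.

Let bad_term_int i (x k : R) : 0 <= k ->
  (\int[m2]_(p in area_cone x) (k * (h i / (p.2 ^+ 2 + q i x) ^+ 2))%:E <=
    (k * (16 * (h i / q i x)))%:E)%E.
Proof.
move=> k0; have := h0 i; rewrite le_eqVlt => /predU1P[<-|hi].
  by under eq_integral do rewrite mul0r mulr0; rewrite integral0 !mul0r !mulr0.
have Q0 := q0 x hi; move: (q i x) Q0 => Q Q0.
pose phi t := k * (h i / (t ^+ 2 + Q) ^+ 2).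
pose w (t : R) := if 0 < t then t *+ 2 else 0.
have r0 : 0 < Num.sqrt Q by rewrite sqrtr_gt0.
have rQ : Num.sqrt Q ^+ 2 = Q by rewrite sqr_sqrtr// ltW.
apply: (@le_trans _ _ (\int[mu]_t (phi t * w t)%:E)%E).
  apply: (@int_section_le R (area_cone x) phi w).
  - exact: measurable_cone.
  - by apply: mfM => //; apply: mfM => //; apply/mfV/mfX/mfD => //; exact: mfX.
  - by move=> t; rewrite mulr_ge0// divr_ge0// sqr_ge0.
  - move=> t; rewrite /w; case: ifPn => [t0|nt].
      rewrite -(lebesgue_measure_ball x (ltW t0)); apply: le_measure; rewrite ?inE.
      + have := measurable_pair2 t measurableT (@measurable_cone R x); rewrite setTI; exact.
      + exact: measurable_ball.
      + by move=> y [].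
    rewrite (_ : [set y | _] = set0) ?measure0//.
    by apply/seteqP; split => // y [/= t0]; rewrite t0 in nt.
apply: (@le_trans _ _ (\int[mu]_t ((k * (h i / Q))%:E *
    (Num.sqrt Q / (Num.sqrt Q ^+ 2 + (0 - t) ^+ 2))%:E))%E).
  apply: le_int0 => t _; rewrite -?EFinM lee_fin /phi /w; case: ifPn => t0.
  - by rewrite mulr_ge0 ?mulrn_wge0 ?(ltW t0)// mulr_ge0// divr_ge0// sqr_ge0.
  - by rewrite mulr0.
  - rewrite sub0r sqrrN rQ; have d0 : 0 < t ^+ 2 + Q by rewrite ltr_pwDr ?sqr_ge0.
    rewrite -!mulrA; apply: ler_wpM2l => //; apply: ler_wpM2l => //.
    rewrite ler_pdivrMl ?exprn_gt0//.
    by have := aux_rt r0 t0; rewrite rQ.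
  - rewrite mulr0; apply: mulr_ge0; last exact: poisson_ge0.
    by apply: mulr_ge0 => //; rewrite divr_ge0 ?(ltW Q0) ?(ltW hi).
rewrite ge0_integralZl_EFin//.
- have -> : k * (16 * (h i / Q)) = k * (h i / Q) * 16 by ring.
  rewrite [(_ * 16)%:E]EFinM; apply: lee_wpmul2l.
    by rewrite lee_fin mulr_ge0// divr_ge0 ?(ltW Q0).
  exact: int_poisson1.
- by move=> t _; rewrite lee_fin poisson_ge0.
- apply/measurable_EFinP; apply: mfM => //; apply/mfV/mfD => //.
  by apply/mfX/mfD => //; exact: mfN.
- by rewrite mulr_ge0// divr_ge0 ?(ltW Q0).
Qed.

(** Of the two factors of F^2 one is bounded, uniformly in t, by a multiple of
    the majorant; integrating the other one over the cone gives the majorant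
    again. *)
Lemma area2_bad x : (forall i, h i <= `|m i - x|) ->
  (area2 setT b x <= (16 * bad_cst ^+ 2)%:E * (bad_majorant x * bad_majorant x))%E.
Proof.
move=> hx; have k0 : 0 < bad_cst := bad_cst_gt0.
have tq0 i : (0 <= beta i * (h i / q i x))%R.
  by rewrite mulr_ge0 ?beta_ge0// divr_ge0// addr_ge0 ?sqr_ge0.
case E : (bad_majorant x) => [s| |]; last 2 first.
- by rewrite mulyy gt0_muley ?leey// lte_fin mulr_gt0// exprn_gt0.
- have : (0 <= bad_majorant x)%E by apply: nneseries_ge0 => i _ _; rewrite lee_fin.
  by rewrite E.
have s0 : 0 <= s.
  by rewrite -lee_fin -E; apply: nneseries_ge0 => i _ _; rewrite lee_fin.
pose k := bad_cst ^+ 2 * s.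
have kk0 : 0 <= k by rewrite mulr_ge0// exprn_ge0// ltW.
pose G i (p : R * R) := ((k * beta i) * (h i / (p.2 ^+ 2 + q i x) ^+ 2))%:E.
have G0 i p : (0 <= G i p)%E.
  rewrite lee_fin; apply: mulr_ge0; first by apply: mulr_ge0 => //; exact: beta_ge0.
  by rewrite divr_ge0 ?sqr_ge0.
apply: (@le_trans _ _ (\int[m2]_(p in area_cone x) \sum_(0 <= i <oo) G i p)%E).
  rewrite /area2 setIT; apply: le_int0 => -[y t] /= [t0 xy].
    by rewrite lee_fin divr_ge0 ?sqr_ge0.
  have FB := sdheat_bad t0 xy hx.
  have FB2 : (`|sdheat b t y|%:E <= (bad_cst * s)%:E)%E.
    apply: (le_trans FB); rewrite EFinM -E -nneseriesZl; last by move=> i _; rewrite lee_fin.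
    apply: lee_nneseries => [i _ _|i _]; rewrite -?EFinM lee_fin.
      rewrite mulr_ge0 ?beta_ge0// mulr_ge0 ?(ltW k0)// mulr_ge0// divr_ge0 ?sqr_ge0//.
    rewrite -mulrA; apply: ler_wpM2l; first exact: ltW.
    by rewrite mulrC; apply: ler_wpM2l; [exact: beta_ge0|exact: term_le].
  rewrite lee_fin in FB2.
  apply: (@le_trans _ _ ((bad_cst * s / t ^+ 2)%:E * `|sdheat b t y|%:E)%E).
    rewrite -EFinM lee_fin [leRHS]mulrAC; apply: ler_wpM2r; first by rewrite invr_ge0 sqr_ge0.
    by rewrite -(real_normK (num_real (sdheat b t y))) expr2 ler_wpM2r.
  apply: (@le_trans _ _ ((bad_cst * s / t ^+ 2)%:E * \sum_(0 <= i <oo)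
     (bad_cst * (t ^+ 2 / (t ^+ 2 + q i x) ^+ 2 * h i) * beta i)%:E)%E).
    by apply: lee_wpmul2l => //; rewrite lee_fin divr_ge0 ?sqr_ge0// mulr_ge0// ltW.
  rewrite -nneseriesZl; last first.
    move=> i _; rewrite lee_fin mulr_ge0 ?beta_ge0// mulr_ge0 ?(ltW k0)// mulr_ge0//.
    by rewrite divr_ge0 ?sqr_ge0.
  rewrite le_eqVlt; apply/orP; left; apply/eqP; apply: eq_eseriesr => i _.
  rewrite -EFinM /G /k /=; congr EFin.
  have Q0 : 0 <= q i x by rewrite addr_ge0 ?sqr_ge0.
  have tt : 0 < t ^+ 2 by rewrite exprn_gt0.
  have d0 : 0 < t ^+ 2 + q i x by rewrite ltr_pwDl.
  move: (q i x) (bad_cst) (beta i) (h i) d0 => Q B be H d0.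
  by field; rewrite !gt_eqF.
have mG i : measurable_fun (area_cone x) (G i).
  apply: (@measurable_funS _ _ _ _ setT) => //; apply/measurable_EFinP.
  by apply: mfM => //; apply: mfM => //; apply/mfV/mfX/mfD => //; exact: mfX.
rewrite integral_nneseries//; last exact: measurable_cone.
apply: (@le_trans _ _ (\sum_(0 <= i <oo) ((16 * k)%:E * (beta i * (h i / q i x))%:E))%E).
  apply: lee_nneseries => [i _ _|i _].
    by apply: integral_ge0 => p _; exact: G0.
  rewrite -EFinM; have kb : 0 <= k * beta i by rewrite mulr_ge0 ?beta_ge0.
  apply: (le_trans (bad_term_int i x kb)); rewrite lee_fin le_eqVlt; apply/orP; left.
  by apply/eqP; ring.
rewrite nneseriesZl; last by move=> i _; rewrite lee_fin.
rewrite -/(bad_majorant x) E -!EFinM lee_fin le_eqVlt; apply/orP; left; apply/eqP.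
by rewrite /k; ring.
Qed.

Lemma mf_bad_majorant : measurable_fun setT bad_majorant.
Proof.
apply: ge0_emeasurable_sum => [i x _ _|i _].
  by rewrite lee_fin mulr_ge0 ?beta_ge0// divr_ge0// addr_ge0 ?sqr_ge0.
apply/measurable_EFinP; apply: mfM => //; apply: mfM => //; apply/mfV/mfD => //.
by apply/mfX/mfD => //; exact: mfN.
Qed.

(** Every Poisson kernel has mass at most 16 by [int_poisson1]. *)
Lemma int_bad_majorant : (\int[mu]_x bad_majorant x <= 16%:E * \sum_(0 <= i <oo) (beta i)%:E)%E.
Proof.
rewrite integral_nneseries//; last 2 first.
- move=> i; apply/measurable_EFinP; apply: mfM => //; apply: mfM => //; apply/mfV/mfD => //.
  by apply/mfX/mfD => //; exact: mfN.
- by move=> i x _; rewrite lee_fin mulr_ge0 ?beta_ge0// divr_ge0// addr_ge0 ?sqr_ge0.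
rewrite -nneseriesZl; last by move=> i _; rewrite lee_fin beta_ge0.
apply: lee_nneseries => [i _ _|i _].
  apply: integral_ge0 => x _.
  by rewrite lee_fin mulr_ge0 ?beta_ge0// divr_ge0// addr_ge0 ?sqr_ge0.
under eq_integral do rewrite EFinM.
rewrite ge0_integralZl_EFin ?beta_ge0//; last 2 first.
- by move=> x _; rewrite lee_fin divr_ge0// addr_ge0 ?sqr_ge0.
- apply/measurable_EFinP; apply: mfM => //; apply/mfV/mfD => //.
  by apply/mfX/mfD => //; exact: mfN.
rewrite muleC; apply: lee_wpmul2r; first by rewrite lee_fin beta_ge0.
have := h0 i; rewrite le_eqVlt => /predU1P[<-|hi]; last exact: int_poisson1.
by under eq_integral do rewrite mul0r; rewrite integral0.
Qed.

End bad_part.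

Section area_basic.
Context {R : realType}.
Local Notation mu := (@lebesgue_measure R).
Local Notation m2 := ((@lebesgue_measure R) \x (@lebesgue_measure R))%E.
Implicit Types (f g : R -> R) (x y z t : R) (E : set (R * R)).

Lemma mf_density f : measurable_fun setT f ->
  measurable_fun setT (fun p : R * R => (sdheat f p.2 p.1 ^+ 2 / p.2 ^+ 2)%:E).
Proof.
move=> mf; apply/measurable_EFinP/mfM; first by apply/mfX; exact: mf_sdheat.
by apply/mfV/mfX.
Qed.

Lemma density_ge0 f (p : R * R) : (0 <= (sdheat f p.2 p.1 ^+ 2 / p.2 ^+ 2)%:E)%E.
Proof. by rewrite lee_fin divr_ge0 ?sqr_ge0. Qed.

Lemma area2_ge0 E f x : (0 <= area2 E f x)%E.
Proof. by apply: integral_ge0 => p _; exact: density_ge0. Qed.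

Lemma mf_area2 E f : measurable E -> measurable_fun setT f -> measurable_fun setT (area2 E f).
Proof.
move=> mE mf; rewrite /area2; under eq_fun do rewrite integral_mkcondr.
apply: mf_cone.
- rewrite epatch_indic; apply: emeasurable_funM; first exact: mf_density.
  by apply/measurable_EFinP; exact: measurable_indic.
- by move=> p; rewrite patchE; case: ifPn => // _; exact: density_ge0.
Qed.

Lemma area2_split E f f1 f2 x : measurable E ->
  measurable_fun setT f1 -> measurable_fun setT f2 ->
  (forall t y, 0 < t -> sdheat f t y = sdheat f1 t y + sdheat f2 t y) ->
  (area2 E f x <= 2%:E * area2 E f1 x + 2%:E * area2 E f2 x)%E.
Proof.
move=> mE m1 m2_ FD.
have mD : measurable (area_cone x `&` E) by apply: measurableI => //; exact: measurable_cone.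
have mH g : measurable_fun setT g ->
    measurable_fun (area_cone x `&` E) (fun p : R * R => (sdheat g p.2 p.1 ^+ 2 / p.2 ^+ 2)%:E).
  by move=> mg; apply: (@measurable_funS _ _ _ _ setT) => //; exact: mf_density.
rewrite /area2 -!ge0_integralZl_EFin//; try by move=> p _; exact: density_ge0.
- rewrite -ge0_integralD//.
  + apply: le_int0 => -[y t] [[/= t0 _] _]; first by rewrite lee_fin divr_ge0 ?sqr_ge0.
    rewrite -!EFinM -EFinD lee_fin FD// !mulrA -mulrDl ler_wpM2r ?invr_ge0 ?sqr_ge0//.
    by have := sqr_ge0 (sdheat f1 t y - sdheat f2 t y); move: (sdheat f1 t y) (sdheat f2 t y) => u v; rewrite !expr2; nra.
  + by move=> p _; rewrite mule_ge0// density_ge0.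
  + by apply: emeasurable_funM => //; exact: mH.
  + by move=> p _; rewrite mule_ge0// density_ge0.
  + by apply: emeasurable_funM => //; exact: mH.
- exact: mH.
- exact: mH.
Qed.

Lemma area2_subset E E' f x : E `<=` E' -> (area2 E f x <= area2 E' f x)%E.
Proof. by move=> EE; apply: le_int0_set => [p [? /EE]|p _]; [|exact: density_ge0]. Qed.

Lemma sdheat_ae f g t y : measurable_fun setT f -> measurable_fun setT g ->
  {ae mu, forall z, f z = g z} -> sdheat f t y = sdheat g t y.
Proof.
move=> mf mg fg; rewrite !sdheatE /Rintegral; congr fine; apply: ae_eq_integral => //.
- by apply/measurable_EFinP/mfM => //; exact: mf_sdmehler.
- by apply/measurable_EFinP/mfM => //; exact: mf_sdmehler.
- by apply: negligibleS fg => z nq e; apply: nq => _; rewrite e.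
Qed.

End area_basic.

Section calderon_zygmund.
Context {R : realType}.
Local Notation mu := (@lebesgue_measure R).
Local Notation HL := (@HL_maximal R).
Implicit Types (f g : R -> R) (x y z t l : R).

Lemma open_HL f l : locally_integrable setT f -> open [set x | (l%:E < HL f x)%E].
Proof. by move=> lf; move: (lower_semicontinuous_HL_maximal lf) => /lower_semicontinuousP; apply. Qed.

(** Lebesgue's differentiation theorem: |f| <= Mf almost everywhere. It is
    stated for one level l, the one of the decomposition. *)
Lemma HL_ae f l : locally_integrable setT f ->
  {ae mu, forall x, ~ (~ (l%:E < HL f x)%E /\ l < `|f x|)}.
Proof.
move=> lf; apply: negligibleS (lebesgue_differentiation lf) => x /= /contrapT.
move=> [/negP]; rewrite -leNgt => Hx lx fx.
have d0 : 0 < `|f x| - l by rewrite subr_gt0.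
have mf : measurable_fun setT f by case: lf.
have key r : 0 < r -> ((`|f x| - l)%:E <= davg f x r)%E.
  move=> r0; have mb : measurable (ball x r) by exact: measurable_ball.
  have r20 : 0 < r *+ 2 by rewrite mulrn_wgt0.
  have mbS g : measurable_fun setT g -> measurable_fun (ball x r) (fun z => (`|g z|)%:E).
    move=> mg; apply/measurable_EFinP; apply: (@measurable_funS _ _ _ _ setT) => //.
    exact: measurableT_comp.
  have mub : mu (ball x r) = (r *+ 2)%:E := lebesgue_measure_ball x (ltW r0).
  have iE : (\int[mu]_(z in ball x r) `|f x|%:E = (r *+ 2)%:E * `|f x|%:E)%E.
    by rewrite integral_cst// muleC; congr (_ * _)%E.
  have J1 : ((r *+ 2)%:E * `|f x|%:E <= \int[mu]_(z in ball x r) `|f z - f x|%:E +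
      \int[mu]_(z in ball x r) `|f z|%:E)%E.
    rewrite -iE -ge0_integralD//.
    - apply: le_int0 => z _; rewrite -?EFinD lee_fin//.
      by have := ler_normB (f z) (f z - f x); rewrite subKr; lra.
    - by apply: mbS; apply: mfD.
    - exact: mbS.
  have J2 : (\int[mu]_(z in ball x r) `|f z|%:E <= ((r *+ 2) * l)%:E)%E.
    apply: (le_trans (HL_ball x lf r0)); rewrite mulr_natl [((r *+ 2) * l)%:E]EFinM.
    by apply: lee_wpmul2l => //; rewrite lee_fin ltW.
  have main : ((r *+ 2)%:E * (`|f x| - l)%:E <= \int[mu]_(z in ball x r) `|f z - f x|%:E)%E.
    have j0 : (0 <= \int[mu]_(z in ball x r) `|f z - f x|%:E)%E.
      by apply: integral_ge0 => z _; rewrite lee_fin.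
    case E : (\int[mu]_(z in ball x r) `|f z - f x|%:E)%E => [j| |].
    - have := le_trans J1 (leeD (lexx _) J2); rewrite E -!EFinM -EFinD !lee_fin mulrBr; lra.
    - by rewrite leey.
    - by rewrite E in j0.
  rewrite /davg/iavg mub inver gt_eqF//.
  apply: (@le_trans _ _ (((r *+ 2)^-1)%:E * ((r *+ 2)%:E * (`|f x| - l)%:E))%E).
    by rewrite -!EFinM mulKf ?gt_eqF.
  by apply: lee_wpmul2l => //; rewrite lee_fin invr_ge0 ltW.
have : ((`|f x| - l)%:E <= 0)%E.
  apply: (cvge_ge _ fx); near=> r; apply: key; near: r; exact: nbhs_right_gt.
by rewrite lee_fin leNgt d0.
Unshelve. all: by end_near. Qed.

Lemma measurable_superlevel (g : R -> \bar R) (c : \bar R) : measurable_fun setT g ->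
  measurable [set x | (c < g x)%E].
Proof. by move=> mg; rewrite -[X in measurable X]setTI; exact: emeasurable_fun_o_infty. Qed.

Context (f : R -> R) (l : R) (l0 : 0 < l) (jf : mu.-integrable setT (EFin \o f)).
Context (ab : nat -> R * R) (ab_le : forall i, (ab i).1 <= (ab i).2).
Let I i : set (measurableTypeR R) := `](ab i).1, (ab i).2[%classic.
Let h i : R := (ab i).2 - (ab i).1.
Let U : set (measurableTypeR R) := \bigcup_i I i.
Context (tI : trivIset setT I) (UE : [set x | (l%:E < HL f x)%E] = U)
  (U_end : forall i, (ab i).1 < (ab i).2 -> ~ U (ab i).1 /\ ~ U (ab i).2).

Let mf : measurable_fun setT f. Proof. by case/integrableP : jf => /measurable_EFinP. Qed.
Let lf : locally_integrable setT f. Proof. exact: tame_loc (tame_integrable jf). Qed.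
Let mI i : measurable (I i). Proof. exact: measurable_itv. Qed.
Let mU : measurable U. Proof. exact: bigcup_measurable. Qed.
Let jfI i : mu.-integrable (I i) (EFin \o f).
Proof. exact: (integrableS measurableT (mI i) (@subsetT _ _) jf). Qed.

Let av i : R := (\int[mu]_(z in I i) f z) / h i.
(** The averages of f over the components. The component of a point is chosen;
    as components are disjoint, the choice does not matter. *)
Let pc (z : R) : R := if pselect (U z) is left Uz then av (projT1 (cid2 Uz)) else 0.

Let pcI i z : I i z -> pc z = av i.
Proof.
move=> Iz; rewrite /pc; case: pselect => [Uz|[]]; last by exists i.
case: (cid2 Uz) => j /= _ Jz; congr av.
by apply: (tI Logic.I Logic.I); exists z.
Qed.

Let pcN z : ~ U z -> pc z = 0. Proof. by rewrite /pc; case: pselect. Qed.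

Let mpc : measurable_fun setT pc.
Proof.
rewrite -(setvU U) setUC; apply/measurable_funU => //; first exact: measurableC.
split.
  apply/measurable_fun_bigcup => // i.
  apply: (@eq_measurable_fun _ _ _ _ _ (cst (av i))) => // z; rewrite inE => Iz.
  by rewrite (pcI Iz).
apply: (@eq_measurable_fun _ _ _ _ _ (cst (0 : R))) => // z; rewrite inE => nU.
by rewrite (pcN nU).
Qed.

Let int_I i : (\int[mu]_(z in I i) `|f z|%:E <= (2 * h i * l)%:E)%E.
Proof.
have := ab_le i; rewrite le_eqVlt => /predU1P[e|lti].
  by rewrite /I e set_itvoo0 integral_set0 /h e subrr mulr0 mul0r.
have [nU _] := U_end lti.
have h0 : 0 < h i by rewrite subr_gt0.
(* The ball is centred at an end point, which lies outside U, so that the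
   maximal function there is at most l. *)
apply: (@le_trans _ _ (\int[mu]_(z in ball (ab i).1 (h i)) `|f z|%:E)%E).
  apply: le_int0_set => [z|z _]; last by rewrite lee_fin.
  rewrite /I/= in_itv/= => /andP[az zb]; rewrite /ball/= ltr_norml /h.
  by apply/andP; split; lra.
apply: (le_trans (HL_ball _ lf h0)); rewrite [(_ * l)%:E]EFinM; apply: lee_wpmul2l.
  by rewrite lee_fin mulr_ge0// ltW.
by rewrite leNgt; apply/negP => ?; apply: nU; rewrite -UE.
Qed.

Let h_eq0 i : h i = 0 -> I i = set0.
Proof. by move=> /subr0_eq e; rewrite /I e set_itvoo0. Qed.

Let muI i : mu (I i) = (h i)%:E.
Proof.
rewrite lebesgue_measure_itv/= lte_fin; case: ltP => [|h0]; first by rewrite EFinB.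
by rewrite /h; congr EFin; apply/eqP; rewrite eq_sym subr_eq0 eq_le h0 ab_le.
Qed.

Let int_cst_I i (c : R) : (\int[mu]_(z in I i) c%:E = (c * h i)%:E)%E.
Proof. by rewrite integral_cst// EFinM; congr (_ * _)%E; exact: muI. Qed.

Let av_le i : (`|av i|%:E * (h i)%:E <= \int[mu]_(z in I i) `|f z|%:E)%E.
Proof.
have h0 : 0 <= h i by rewrite subr_ge0.
move: h0; rewrite le_eqVlt => /predU1P[<-|h0].
  by rewrite mule0; apply: integral_ge0 => z _; rewrite lee_fin.
rewrite -EFinM /av normrM normfV (gtr0_norm h0) divfK ?gt_eqF//.
case E : (\int[mu]_(z in I i) `|f z|%:E)%E => [c| |].
- by rewrite lee_fin; apply: (@Rint_le _ _ _ mu (I i) _ (fun z => `|f z|%:E)) => //;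
    [exact: (@measurable_funS _ _ _ _ setT)|rewrite E].
- by rewrite leey.
- by have : (0 <= \int[mu]_(z in I i) `|f z|%:E)%E; [apply: integral_ge0 => z _; rewrite lee_fin|rewrite E].
Qed.

Let av_bound i : 0 < h i -> `|av i| <= 2 * l.
Proof.
move=> h0; have := le_trans (av_le i) (int_I i); rewrite -EFinM lee_fin.
by rewrite mulrAC ler_pM2r.
Qed.

(* Off U, where |f| <= l only almost everywhere, f is truncated on the
   exceptional null set, so that the good part is bounded everywhere. *)
Let V : set (measurableTypeR R) := ~` U `&` [set z | `|f z| <= l].
Let good z : R := pc z + f z * \1_V z.
Let bad z : R := f z * \1_U z - pc z.

Let mgood : measurable_fun setT good.
Proof.
apply: mfD => //; apply: mfM => //; apply: measurable_indic.
apply: measurableI; first exact: measurableC.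
rewrite (_ : [set z | _] = ~` [set z | l < `|f z|]).
  by apply/measurableC/measurable_lt => //; exact: measurableT_comp.
by apply/seteqP; split => z /=; rewrite leNgt => /negP.
Qed.

Let mbad : measurable_fun setT bad.
Proof. by apply: mfD; [apply: mfM => //; exact: measurable_indic|exact: mfN]. Qed.

Let goodI i z : I i z -> good z = av i.
Proof.
move=> Iz; have Uz : U z by exists i.
rewrite /good (pcI Iz) indicE memNset ?mulr0 ?addr0//.
by move=> [].
Qed.

Let goodN z : ~ U z -> `|good z| <= `|f z| /\ `|good z| <= l.
Proof.
move=> nU; rewrite /good pcN// add0r indicE; have [lz|lz] := leP `|f z| l.
  by rewrite mem_set ?mulr1//; split.
rewrite memNset; first by rewrite mulr0 normr0; split => //; exact: ltW.
by move=> [_] /=; rewrite leNgt lz.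
Qed.

Let badI i z : I i z -> bad z = f z - av i.
Proof. by move=> Iz; rewrite /bad (pcI Iz) indicE mem_set ?mulr1//; exists i. Qed.

Let badN z : ~ U z -> bad z = 0.
Proof. by move=> nU; rewrite /bad pcN// indicE memNset// mulr0 subrr. Qed.

Let good_bound z : `|good z| <= 2 * l.
Proof.
have [[i _ Iz]|nU] := pselect (U z); last first.
  by apply: (le_trans (goodN nU).2); rewrite ler_peMl ?ler1n// ltW.
rewrite (goodI Iz); apply: av_bound; rewrite subr_gt0.
by move: Iz; rewrite /I/= in_itv/= => /andP[]; exact: lt_trans.
Qed.

Let sumI : (\int[mu]_(z in U) `|f z|%:E = \sum_(0 <= i <oo) \int[mu]_(z in I i) `|f z|%:E)%E.
Proof.
rewrite ge0_integral_bigcup//.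
- apply: (@measurable_funS _ _ _ _ setT) => //; apply/measurable_EFinP.
  exact: measurableT_comp.
Qed.

Let good_l1 : (\int[mu]_z `|good z|%:E <= \int[mu]_z `|f z|%:E)%E.
Proof.
have mabs g (D : set (measurableTypeR R)) : measurable D -> measurable_fun setT g -> measurable_fun D (fun z => `|g z|%:E).
  move=> mD mg; apply: (@measurable_funS _ _ _ _ setT) => //; apply/measurable_EFinP.
  exact: measurableT_comp.
have split g : measurable_fun setT g -> (\int[mu]_z `|g z|%:E =
    \int[mu]_(z in U) `|g z|%:E + \int[mu]_(z in ~` U) `|g z|%:E)%E.
  move=> mg; rewrite -{1}(setvU U) setUC ge0_integral_setU//; first exact: measurableC.
  - by apply: mabs => //; apply: measurableU => //; exact: measurableC.
  - by apply/disj_setPS => z [].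
rewrite (split _ mgood) (split _ mf); apply: leeD; last first.
  by apply: le_int0 => z nU; rewrite lee_fin//; exact: (goodN nU).1.
rewrite sumI ge0_integral_bigcup//; last exact: mabs.
apply: lee_nneseries => [i _ _|i _]; first by apply: integral_ge0 => z _; rewrite lee_fin.
apply: le_trans (av_le i).
apply: (@le_trans _ _ (\int[mu]_(z in I i) `|av i|%:E)%E).
  by apply: le_int0 => z Iz; rewrite lee_fin// (goodI Iz).
by rewrite int_cst_I EFinM.
Qed.

Let bounded_L1_good : bounded_L1 good.
Proof.
split=> //; last by exists (2 * l); exact: good_bound.
apply/integrableP; split; first exact/measurable_EFinP.
by apply: (le_lt_trans good_l1); case/integrableP : jf.
Qed.

Let ip_good : ((ip good good)%:E <= (2 * l)%:E * \int[mu]_z `|f z|%:E)%E.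
Proof.
have ig := bounded_L1_prod bounded_L1_good bounded_L1_good.
rewrite /ip /Rintegral fineK; last exact: integrable_fin_num.
apply: (@le_trans _ _ (\int[mu]_z ((2 * l)%:E * `|good z|%:E))%E).
  apply: le_int0 => z _; rewrite -?EFinM lee_fin -?expr2 ?sqr_ge0//.
  by rewrite -(real_normK (num_real (good z))) expr2 ler_wpM2r// good_bound.
have l20 : 0 <= 2 * l by rewrite mulr_ge0// ltW.
rewrite ge0_integralZl_EFin//; last by apply/measurable_EFinP; exact: measurableT_comp.
by apply: lee_wpmul2l; rewrite ?lee_fin// good_l1.
Qed.

Let ibad : mu.-integrable setT (EFin \o bad).
Proof.
have [_ ig _] := bounded_L1_good.
have := integrableD measurableT (integrable_abse jf) (integrable_abse ig).
apply: le_integrable => //; first exact/measurable_EFinP.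
move=> z _; rewrite /= lee_fin; apply: (@le_trans _ _ (`|f z| + `|good z|)); last exact: ler_norm.
have [[i _ Iz]|nU] := pselect (U z); last by rewrite badN// normr0 addr_ge0.
by rewrite (badI Iz) (goodI Iz); exact: ler_normB.
Qed.

Let beta i : R := fine (2%:E * \int[mu]_(z in I i) `|f z|%:E)%E.

Let betaE i : (beta i)%:E = (2%:E * \int[mu]_(z in I i) `|f z|%:E)%E.
Proof.
rewrite fineK// ge0_fin_numE.
  by rewrite lte_mul_pinfty//; case/integrableP : (jfI i).
by apply: mule_ge0 => //; apply: integral_ge0 => z _; rewrite lee_fin.
Qed.

Let bad_mean i : \int[mu]_(z in I i) bad z = 0.
Proof.
have -> : \int[mu]_(z in I i) bad z = \int[mu]_(z in I i) (f z - av i).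
  by apply: eq_Rintegral => z; rewrite inE => Iz; rewrite (badI Iz).
have ic : mu.-integrable (I i) (EFin \o cst (av i)).
  apply/integrableP; split; first by apply/measurable_EFinP.
  by under eq_integral do rewrite /=; rewrite int_cst_I ltry.
rewrite RintegralB// {2}/Rintegral int_cst_I /=.
have [h0|h0] := eqVneq (h i) 0.
  by rewrite h0 mulr0 subr0 (h_eq0 h0) /Rintegral integral_set0.
by rewrite /av divfK// subrr.
Qed.

Let bad_beta i : (\int[mu]_(z in I i) `|bad z|%:E <= (beta i)%:E)%E.
Proof.
rewrite betaE; apply: (@le_trans _ _ (\int[mu]_(z in I i) (`|f z|%:E + `|av i|%:E))%E).
  apply: le_int0 => z Iz; rewrite -?EFinD lee_fin// (badI Iz).
  exact: ler_normB.
rewrite ge0_integralD//.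
- rewrite int_cst_I (_ : 2%:E = 1 + 1)%E// ge0_muleDl//.
  by rewrite mul1e; apply: leeD => //; rewrite EFinM; exact: av_le.
- apply: (@measurable_funS _ _ _ _ setT) => //; apply/measurable_EFinP.
  exact: measurableT_comp.
Qed.

Let sum_beta : (\sum_(0 <= i <oo) (beta i)%:E <= 2%:E * \int[mu]_z `|f z|%:E)%E.
Proof.
under eq_eseriesr do rewrite betaE.
rewrite nneseriesZl; last by move=> i _; apply: integral_ge0 => z _; rewrite lee_fin.
apply: lee_wpmul2l => //; rewrite -sumI.
by apply: le_int0_set => // z _; rewrite lee_fin.
Qed.

Let sdheat_good_bad t y : 0 < t -> sdheat f t y = sdheat good t y + sdheat bad t y.
Proof.
move=> t0; have -> : sdheat f t y = sdheat (fun z => good z - (- bad z)) t y.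
  apply: sdheat_ae => //; first by apply: mfD => //; apply: mfN; apply: mfN.
  apply: negligibleS (HL_ae l lf) => z /= neq nz; apply: neq; rewrite opprK /good /bad.
  have [Uz|nU] := pselect (U z).
    have nV : ~ V z by case.
    by rewrite !indicE (mem_set Uz) (memNset nV) mulr0 mulr1; ring.
  have [lz|lz] := leP `|f z| l; last by exfalso; apply: nz; split => // ?; apply: nU; rewrite -UE.
  have Vz : V z by split.
  by rewrite pcN// !indicE (memNset nU) (mem_set Vz) mulr1 mulr0; ring.
have tb : tame bad := tame_integrable ibad.
have tnb : tame (fun z => - bad z).
  by apply: tame_le tb => [|z]; [exact: mfN|rewrite normrN].
rewrite sdheat_sub//; last exact: bounded_L1_tame.
suff -> : sdheat (fun z => - bad z) t y = - sdheat bad t y by rewrite opprK.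
rewrite !sdheatE; have s0 : 0 < t ^+ 2 by rewrite exprn_gt0.
have -> : (fun z => sdmehler (t ^+ 2) y z * - bad z) = (fun z => -1 * (sdmehler (t ^+ 2) y z * bad z)).
  by apply/funext => z; ring.
by rewrite RintegralZl ?mulN1r//; exact: sdmehler_integrable.
Qed.

Let m i : R := ((ab i).1 + (ab i).2) / 2.
(** The doubled intervals, away from which the bad part is estimated. *)
Let Us : set (measurableTypeR R) := \bigcup_i ball (m i) (h i).

Let mUs : measurable Us.
Proof. by apply: bigcup_measurable => i _; exact: measurable_ball. Qed.

Let muUs : (mu Us <= 2%:E * mu U)%E.
Proof.
apply: (@le_trans _ _ (\sum_(0 <= i <oo) mu (ball (m i) (h i)))%E).
  apply: measure_sigma_subadditive => //.
  by move=> i; exact: measurable_ball.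
have -> : mu U = (\sum_(0 <= i <oo) mu (I i))%E.
  rewrite /U measure_bigcup//.
  by apply: eq_eseriesl => i; rewrite in_setT.
rewrite -nneseriesZl; last by move=> i _; exact: measure_ge0.
apply: lee_nneseries => [i _ _|i _]; first exact: measure_ge0.
rewrite lebesgue_measure_ball ?subr_ge0// muI -EFinM lee_fin.
by rewrite mulr_natl.
Qed.

(** The coefficients 128, 6 and 32 k stand for the good part, the doubled
    intervals and the bad part; 134 = 128 + 6. *)
Definition weak_cst : R := 134 + 32 * (2 * (4 * bad_cst)).

(** The Calderon-Zygmund estimate, for a given enumeration of the components
    of the set where the maximal function exceeds l. *)
Lemma area2_weak_CZ : (mu [set x | ((l ^+ 2)%:E < area2 setT f x)%E] <=
  (weak_cst / l)%:E * \int[mu]_z `|f z|%:E)%E.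
Proof.
set nf := (\int[mu]_z `|f z|%:E)%E.
have nf0 : (0 <= nf)%E by apply: integral_ge0 => z _; rewrite lee_fin.
(* The value of k makes 16 bad_cst^2 (l / k)^2 equal to l^2 / 4. *)
pose k := (2 * (4 * bad_cst)) : R.
have bc0 : 0 < bad_cst :> R := bad_cst_gt0.
have k0 : 0 < k by rewrite mulr_gt0// mulr_gt0.
pose S := @bad_majorant R ab beta.
pose G := [set x | ((l ^+ 2 / 4)%:E < area2 setT good x)%E].
pose B := [set x | ((l / k)%:E < S x)%E].
have mS : measurable_fun setT S := mf_bad_majorant ab_le bad_beta.
have mG : measurable G.
  by apply: measurable_superlevel; exact: mf_area2.
have S0 x : (0 <= S x)%E.
  apply: nneseries_ge0 => i _ _; rewrite lee_fin mulr_ge0 ?(beta_ge0 bad_beta)//.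
  by rewrite divr_ge0 ?subr_ge0// addr_ge0 ?sqr_ge0.
have mB : measurable B by exact: measurable_superlevel.
have sub : [set x | ((l ^+ 2)%:E < area2 setT f x)%E] `<=` G `|` (Us `|` B).
  move=> x /= lA; have [Gx|nG] := pselect (G x); [by left|right].
  have [Ux|nU] := pselect (Us x); [by left|right].
  have hx i : h i <= `|m i - x|.
    by rewrite leNgt; apply/negP => ?; apply: nU; exists i.
  move/negP: nG; rewrite -leNgt => nG.
  rewrite /B/= ltNge; apply/negP => Sx.
  have AB := area2_bad ab_le tI ibad badN bad_mean bad_beta hx.
  have AB' : (area2 setT bad x <= (l ^+ 2 / 4)%:E)%E.
    apply: (le_trans AB); apply: (@le_trans _ _ ((16 * bad_cst ^+ 2)%:E * ((l / k)%:E * (l / k)%:E))%E).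
      by apply: lee_wpmul2l; [rewrite lee_fin mulr_ge0// sqr_ge0|exact: lee_pmul].
    rewrite -!EFinM lee_fin le_eqVlt; apply/orP; left; apply/eqP.
    by rewrite /k; move: bad_cst bc0 => c c0; field; rewrite gt_eqF.
  have := area2_split x measurableT mgood mbad sdheat_good_bad.
  move=> /(lt_le_trans lA); rewrite ltNge => /negP; apply.
  apply: (le_trans (leeD (lee_wpmul2l _ nG) (lee_wpmul2l _ AB'))) => //.
  by rewrite -!EFinM -EFinD lee_fin; lra.
have muU : (mu U <= (3 / l)%:E * nf)%E.
  by rewrite -UE; exact: maximal_inequality.
have mA : measurable [set x | ((l ^+ 2)%:E < area2 setT f x)%E].
  by apply: measurable_superlevel; exact: mf_area2.
apply: (@le_trans _ _ (mu (G `|` (Us `|` B)))).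
  by apply: le_measure; rewrite ?inE//; apply: measurableU => //; exact: measurableU.
apply: (le_trans (measureU2 _ _ _)) => //; first exact: measurableU.
apply: (le_trans (leeD (lexx _) (measureU2 _ _ _))) => //.
have muG : (mu G <= (128 / l)%:E * nf)%E.
  have l4 : 0 < l ^+ 2 / 4 by rewrite divr_gt0 ?exprn_gt0.
  apply: (le_trans (@ge0_markov _ _ _ mu (area2 setT good) (l ^+ 2 / 4) (fun x => area2_ge0 _ _ x) l4 mG)).
  apply: (@le_trans _ _ ((l ^+ 2 / 4)^-1%:E * (16%:E * ((2 * l)%:E * nf)))%E).
    apply: lee_wpmul2l; first by rewrite lee_fin invr_ge0 ltW.
    apply: (le_trans (area2_L2 bounded_L1_good)); rewrite EFinM.
    by apply: lee_wpmul2l => //; exact: ip_good.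
  rewrite !muleA -!EFinM; apply: lee_wpmul2r => //.
  by rewrite lee_fin le_eqVlt; apply/orP; left; apply/eqP; field; rewrite gt_eqF.
have muB : (mu B <= (32 * k / l)%:E * nf)%E.
  have lk : 0 < l / k by rewrite divr_gt0.
  apply: (le_trans (@ge0_markov _ _ _ mu S (l / k) S0 lk mB)).
  apply: (@le_trans _ _ ((l / k)^-1%:E * (16%:E * (2%:E * nf)))%E).
    apply: lee_wpmul2l; first by rewrite lee_fin invr_ge0 ltW.
    apply: (le_trans (int_bad_majorant ab_le bad_beta)).
    by apply: lee_wpmul2l => //; exact: sum_beta.
  rewrite !muleA -!EFinM; apply: lee_wpmul2r => //.
  by rewrite lee_fin le_eqVlt; apply/orP; left; apply/eqP; field; rewrite !gt_eqF.
have muUs' : (mu Us <= (6 / l)%:E * nf)%E.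
  apply: (le_trans muUs); apply: (@le_trans _ _ (2%:E * ((3 / l)%:E * nf))%E).
    exact: lee_wpmul2l.
  rewrite muleA -EFinM; apply: lee_wpmul2r => //.
  by rewrite lee_fin le_eqVlt; apply/orP; left; apply/eqP; field; rewrite gt_eqF.
apply: (le_trans (leeD muG (leeD muUs' muB))).
have c1 : (0 <= (128 / l)%:E)%E by rewrite lee_fin divr_ge0 ?(ltW l0).
have c2 : (0 <= (6 / l)%:E)%E by rewrite lee_fin divr_ge0 ?(ltW l0).
have c3 : (0 <= (32 * k / l)%:E)%E.
  by rewrite lee_fin; apply: divr_ge0; [apply: mulr_ge0 => //; exact: ltW|exact: ltW].
rewrite -(ge0_muleDl _ c2 c3) -(ge0_muleDl _ c1 (adde_ge0 c2 c3)).
apply: lee_wpmul2r => //; rewrite -!EFinD lee_fin le_eqVlt; apply/orP; left; apply/eqP.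
by rewrite /weak_cst /k; field; rewrite gt_eqF.
Qed.

End calderon_zygmund.

(** * The good-lambda inequality *)

Section good_lambda_tools.
Context {R : realType}.
Local Notation mu := (@lebesgue_measure R).
Local Notation m2 := ((@lebesgue_measure R) \x (@lebesgue_measure R))%E.
Local Notation HL := (@HL_maximal R).
Implicit Types (f g : R -> R) (x y z t l a b : R) (E : set (R * R)).

Lemma measurable_le d (T : measurableType d) (f g : T -> R) :
  measurable_fun setT f -> measurable_fun setT g -> measurable [set p | f p <= g p].
Proof.
move=> mf mg; rewrite (_ : [set p | _] = ~` [set p | g p < f p]).
  by apply: measurableC; exact: measurable_lt.
by apply/seteqP; split => p /=; rewrite leNgt => /negP.
Qed.

(** This weight and the next one are dominated by a Poisson kernel, so
    [int_poisson1] bounds their integrals. *)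
Lemma tail_weight c h t : 0 < h -> h < t ->
  c ^+ 2 / t ^+ 2 * h <= 2 * c ^+ 2 * (h / (h ^+ 2 + t ^+ 2)).
Proof.
move=> h0 ht; have t0 : 0 < t by exact: lt_trans ht.
have d0 : 0 < h ^+ 2 + t ^+ 2 by rewrite addr_gt0 ?exprn_gt0.
rewrite -subr_ge0; have -> : 2 * c ^+ 2 * (h / (h ^+ 2 + t ^+ 2)) - c ^+ 2 / t ^+ 2 * h =
    c ^+ 2 * (h * (t ^+ 2 - h ^+ 2)) / (t ^+ 2 * (h ^+ 2 + t ^+ 2)).
  by field; rewrite !gt_eqF.
apply: divr_ge0; last by rewrite mulr_ge0 ?sqr_ge0// ltW.
apply: mulr_ge0; first exact: sqr_ge0.
by rewrite mulr_ge0 ?(ltW h0)// subr_ge0 ler_sqr ?nnegrE ltW.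
Qed.

Lemma small_weight c h t : 0 < t -> t <= h ->
  c ^+ 2 / h ^+ 2 * (t *+ 2) <= 4 * c ^+ 2 * (h / (h ^+ 2 + t ^+ 2)).
Proof.
move=> t0 th; have h0 : 0 < h by exact: lt_le_trans th.
have d0 : 0 < h ^+ 2 + t ^+ 2 by rewrite addr_gt0 ?exprn_gt0.
rewrite (_ : t *+ 2 = t * 2); last by rewrite mulr_natr.
rewrite -subr_ge0.
have -> : 4 * c ^+ 2 * (h / (h ^+ 2 + t ^+ 2)) - c ^+ 2 / h ^+ 2 * (t * 2) =
    c ^+ 2 * (2 * ((h - t) * h ^+ 2 + (h ^+ 3 - t ^+ 3))) / (h ^+ 2 * (h ^+ 2 + t ^+ 2)).
  by field; rewrite !gt_eqF.
apply: divr_ge0; last by rewrite mulr_ge0 ?sqr_ge0// ltW.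
apply: mulr_ge0; first exact: sqr_ge0.
rewrite mulr_ge0// addr_ge0//; first by rewrite mulr_ge0 ?sqr_ge0// subr_ge0.
by rewrite subr_ge0 lerXn2r ?nnegrE ?(ltW t0) ?(ltW h0).
Qed.

Lemma weak_cst_gt0 : 0 < weak_cst :> R.
Proof. by rewrite /weak_cst addr_gt0// mulr_gt0// mulr_gt0// mulr_gt0// bad_cst_gt0. Qed.

Lemma area2_weak f l : mu.-integrable setT (EFin \o f) -> 0 < l ->
  (mu [set x | ((l ^+ 2)%:E < area2 setT f x)%E] <=
   (weak_cst / l)%:E * \int[mu]_z `|f z|%:E)%E.
Proof.
move=> jf l0; have lf := tame_loc (tame_integrable jf).
have oU := @open_HL R f l lf.
have fU : (mu [set x | (l%:E < HL f x)%E] < +oo)%E.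
  apply: (le_lt_trans (maximal_inequality lf l0)).
  by rewrite lte_mul_pinfty ?lee_fin ?divr_ge0 ?(ltW l0)//; case/integrableP : jf.
have [ab [ab_le tI UE Uend]] := open_components oU fU.
apply: (area2_weak_CZ l0 jf ab_le tI UE) => i lti.
by rewrite -UE; exact: Uend.
Qed.

(** By monotone convergence the integral over a slightly smaller cone still
    exceeds l, and that cone is contained in the cones over all points near x. *)
Lemma open_area2 E f l : measurable E -> measurable_fun setT f ->
  open [set x | (l%:E < area2 E f x)%E].
Proof.
move=> mE mf.
pose S x (n : nat) : set (measurableTypeR R * measurableTypeR R) := [set p : R * R | `|x - p.1| < p.2 - n.+1%:R^-1] `&` E.
have mS x n : measurable (S x n).
  apply: measurableI => //; apply: measurable_lt.
    by apply: measurableT_comp => //; exact: measurable_funB.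
  exact: measurable_funB.
have SE x : area_cone x `&` E = \bigcup_n S x n.
  apply/seteqP; split => [[y t] [[/= t0 xy] Ep]|[y t] [n _ [/= xy Ep]]].
    have d0 : 0 < t - `|x - y| by rewrite subr_gt0.
    pose n := Num.truncn (t - `|x - y|)^-1.
    exists n => //; split => //=.
    have : (t - `|x - y|)^-1 < n.+1%:R by exact: truncnS_gt.
    by rewrite invf_plt ?posrE//; move: (n.+1%:R^-1) => u; lra.
  have n0 : 0 < (n.+1%:R : R)^-1 by rewrite invr_gt0.
  split => //; move: (normr_ge0 (x - y)) (n.+1%:R^-1) n0 xy => ny u u0 xy.
  by split => /=; lra.
rewrite openE => x /= lA.
have Sn : {homo S x : n k / (n <= k)%N >-> (n <= k)%O}.
  move=> n k nk; apply/subsetPset => -[y t] [/= xy Ep]; split => //=.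
  apply: (lt_le_trans xy); rewrite lerD2l lerN2 lef_pV2 ?posrE//.
  by rewrite ler_nat.
have := @ge0_nondecreasing_set_cvg_integral _ _ _ (S x)
  (fun p : R * R => (sdheat f p.2 p.1 ^+ 2 / p.2 ^+ 2)%:E) m2 Sn (mS x)
  (fun n => measurable_funS measurableT (@subsetT _ _) (mf_density mf))
  (fun n p _ => density_ge0 f p).
rewrite -SE => cA.
have [n ln] : exists n, (l%:E < \int[m2]_(p in S x n) (sdheat f p.2 p.1 ^+ 2 / p.2 ^+ 2)%:E)%E.
  apply: contrapT => /forallNP h; move: lA; rewrite ltNge => /negP; apply.
  apply: (cvge_le _ cA); near=> n; by have /negP := h n; rewrite -leNgt.
apply/nbhs_ballP; exists n.+1%:R^-1 => /=; first by rewrite invr_gt0.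
move=> x' xx'; apply: (lt_le_trans ln).
apply: le_int0_set; last by move=> p _; exact: density_ge0.
move=> [y t] [/= xy Ep].
have xx2 : `|x - x'| < n.+1%:R^-1 by exact: xx'.
have tr : `|x' - y| <= `|x - x'| + `|x - y|.
  have -> : x' - y = - (x - x') + (x - y) by ring.
  by apply: (le_trans (ler_normD _ _)); rewrite normrN.
have n0 : 0 < (n.+1%:R : R)^-1 by rewrite invr_gt0.
have ny := normr_ge0 (x - y).
by split => //; split => /=; move: (n.+1%:R^-1) n0 xx2 xy => u; lra.
Unshelve. all: by end_near. Qed.

(** Truncation to a box makes the measure of the superlevel sets finite,
    uniformly in the level, as the absorption in [good_lambda_int] requires. *)
Definition box (N : nat) : set (R * R) := [set p | `|p.1| <= N%:R /\ p.2 <= N%:R].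

Lemma measurable_box N : measurable (box N).
Proof.
by apply: measurableI; apply: measurable_le => //; exact: measurableT_comp.
Qed.

Lemma area2_box_support N f l : 0 < l -> measurable_fun setT f ->
  (mu [set x | (l%:E < area2 (box N) f x)%E] <= (N%:R *+ 4)%:E)%E.
Proof.
move=> l0 mf; have N0 : (0 : R) <= N%:R *+ 2 by rewrite mulrn_wge0.
apply: (@le_trans _ _ (mu (ball 0 (N%:R *+ 2)))); last first.
  by rewrite lebesgue_measure_ball// -mulrnA.
apply: le_measure; rewrite ?inE.
- by apply: measurable_superlevel; apply: mf_area2 => //; exact: measurable_box.
- exact: measurable_ball.
move=> x /= lA; rewrite /ball/= sub0r normrN ltNge; apply/negP => Nx.
move: lA; rewrite /area2 (_ : _ `&` _ = set0); first by rewrite integral_set0 lte_fin ltNge ltW.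
apply/seteqP; split => // -[y t] [[/= t0 xy] [/= yN tN]].
have := ler_normD (x - y) y; rewrite subrK; move: Nx; rewrite mulr2n.
by move: (N%:R) yN tN => M; lra.
Qed.

(** Above height h the part of the cone over x that is not covered by the cone
    over a has sections of length at most h, so that it contributes at most
    the integral of c^2 h / t^2 over t > h. *)
Lemma area2_tail E f a x h c : measurable E -> measurable_fun setT f -> 0 < h ->
  a < x -> x - a <= h -> 0 <= c ->
  (forall t y, 0 < t -> `|x - y| < t -> `|sdheat f t y| <= c) ->
  (area2 (E `&` [set p | (h < p.2)%R]) f x <= area2 E f a + (32 * c ^+ 2)%:E)%E.
Proof.
move=> mE mf h0 ax xah c0 Fc.
pose S := [set p : R * R | h < p.2] `&` [set p | `|x - p.1| < p.2] `&` ~` [set p | `|a - p.1| < p.2].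
have md u : measurable_fun setT (fun p : R * R => `|u - p.1|).
  by apply: measurableT_comp => //; exact: measurable_funB.
have mSet : measurable S.
  by apply: measurableI; [apply: measurableI|apply: measurableC]; apply: measurable_lt.
have mcE : measurable (area_cone a `&` E) by apply: measurableI => //; exact: measurable_cone.
have mD (D : set (R * R)) : measurable_fun D (fun p : R * R => (sdheat f p.2 p.1 ^+ 2 / p.2 ^+ 2)%:E).
  by apply: (@measurable_funS _ _ _ _ setT) => //; exact: mf_density.
apply: (@le_trans _ _ (\int[m2]_(p in (area_cone a `&` E) `|` S) (sdheat f p.2 p.1 ^+ 2 / p.2 ^+ 2)%:E)%E).
  apply: le_int0_set; last by move=> p _; exact: density_ge0.
  move=> p [[p0 xp] [Ep hp]]; have [ap|nap] := pselect (`|a - p.1| < p.2); first by left; split.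
  by right; split.
have dis : [disjoint area_cone a `&` E & S].
  by apply/disj_setPS => p [[[_ ap] _] [_]].
rewrite (ge0_integral_setU m2 mcE mSet (mD _) (fun p _ => density_ge0 f p) dis).
apply: leeD; first exact: lexx.
pose phi (t : R) := c ^+ 2 / t ^+ 2.
pose w (t : R) := if h < t then h else 0.
apply: (@le_trans _ _ (\int[m2]_(p in S) (phi p.2)%:E)%E).
  apply: le_int0 => -[y t] [[/= ht xy] _]; first by rewrite lee_fin divr_ge0 ?sqr_ge0.
  have t0 : 0 < t by exact: lt_trans ht.
  rewrite lee_fin /phi/= ler_wpM2r ?invr_ge0 ?sqr_ge0//.
  by rewrite -(real_normK (num_real (sdheat f t y))) ler_sqr ?nnegrE// Fc.
apply: (@le_trans _ _ (\int[mu]_t (phi t * w t)%:E)%E).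
  apply: int_section_le => //.
  - by apply: mfM => //; apply/mfV/mfX.
  - by move=> t; rewrite divr_ge0 ?sqr_ge0.
  - move=> t; rewrite /w; case: ifPn => [ht|nt]; last first.
      rewrite (_ : [set y | _] = set0) ?measure0//.
      by apply/seteqP; split => // y [[/= ht _] _]; rewrite ht in nt.
    apply: (@le_trans _ _ (mu `[a + t, x + t])); last first.
      rewrite lebesgue_measure_itv/= lte_fin ltrD2r ax -EFinB lee_fin; lra.
    apply: le_measure; rewrite ?inE.
    + by have := measurable_pair2 t measurableT mSet; rewrite setTI.
    + exact: measurable_itv.
    + move=> y [[/= _]]; rewrite ltr_norml => /andP[h1 h2] h3.
      rewrite in_itv/=; apply/andP; split; last by lra.
      rewrite leNgt; apply/negP => h4; apply: h3; rewrite ltr_norml.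
      by apply/andP; split; lra.
apply: (@le_trans _ _ (\int[mu]_t ((2 * c ^+ 2)%:E * (h / (h ^+ 2 + (0 - t) ^+ 2))%:E))%E).
  apply: le_int0 => t _; rewrite -?EFinM lee_fin /phi /w; case: ifPn => ht.
  - by rewrite mulr_ge0 ?(ltW h0)// divr_ge0 ?sqr_ge0.
  - by rewrite mulr0.
  - by rewrite sub0r sqrrN; exact: tail_weight.
  - by rewrite mulr0 mulr_ge0 ?poisson_ge0// mulr_ge0// sqr_ge0.
rewrite ge0_integralZl_EFin//.
- rewrite (_ : 32 * c ^+ 2 = (2 * c ^+ 2) * 16); last by ring.
  rewrite [((2 * c ^+ 2) * 16)%:E]EFinM; apply: lee_wpmul2l; last exact: int_poisson1.
  by rewrite lee_fin mulr_ge0// sqr_ge0.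
- by move=> t _; rewrite lee_fin poisson_ge0.
- apply/measurable_EFinP; apply: mfM => //; apply/mfV/mfD => //.
  by apply/mfX/mfD => //; exact: mfN.
- by rewrite mulr_ge0// sqr_ge0.
Qed.

(** The factor t / h makes the integral of (c t / h)^2 / t^2 over the part of
    the cone below height h bounded. *)
Lemma area2_small_scale g x h c : measurable_fun setT g -> 0 < h -> 0 <= c ->
  (forall t y, 0 < t -> t <= h -> `|x - y| < t -> `|sdheat g t y| <= t / h * c) ->
  (area2 [set p | (p.2 <= h)%R] g x <= (64 * c ^+ 2)%:E)%E.
Proof.
move=> mg h0 c0 Fc.
pose phi (t : R) := c ^+ 2 / h ^+ 2.
pose w (t : R) := if (0 < t) && (t <= h) then t *+ 2 else 0.
pose S := area_cone x `&` [set p : R * R | p.2 <= h].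
have mS : measurable S.
  apply: measurableI; first exact: measurable_cone.
  exact: measurable_le.
apply: (@le_trans _ _ (\int[m2]_(p in S) (phi p.2)%:E)%E).
  apply: le_int0 => -[y t] [[/= t0 xy] th]; first by rewrite lee_fin divr_ge0 ?sqr_ge0.
  rewrite lee_fin /phi/= ler_pdivrMr ?exprn_gt0//.
  rewrite -(real_normK (num_real (sdheat g t y))).
  have -> : c ^+ 2 / h ^+ 2 * t ^+ 2 = (t / h * c) ^+ 2 by rewrite !exprMn exprVn; ring.
  by rewrite ler_sqr ?nnegrE ?Fc// mulr_ge0// divr_ge0// ltW.
apply: (@le_trans _ _ (\int[mu]_t (phi t * w t)%:E)%E).
  apply: int_section_le => //.
  - exact: measurable_cst.
  - by move=> t; rewrite divr_ge0 ?sqr_ge0.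
  - move=> t; rewrite /w; case: ifPn => [/andP[t0 th]|nt]; last first.
      rewrite (_ : [set y | _] = set0) ?measure0//.
      by apply/seteqP; split => // y [[/= t0 _] th]; rewrite t0 th in nt.
    rewrite -(lebesgue_measure_ball x (ltW t0)); apply: le_measure; rewrite ?inE.
    + by have := measurable_pair2 t measurableT mS; rewrite setTI.
    + exact: measurable_ball.
    + by move=> y [[]].
apply: (@le_trans _ _ (\int[mu]_t ((4 * c ^+ 2)%:E * (h / (h ^+ 2 + (0 - t) ^+ 2))%:E))%E).
  apply: le_int0 => t _; rewrite -?EFinM lee_fin /phi /w; case: ifPn => [/andP[t0 th]|nt].
  - by rewrite mulr_ge0 ?mulrn_wge0 ?(ltW t0)// divr_ge0 ?sqr_ge0.
  - by rewrite mulr0.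
  - by rewrite sub0r sqrrN; exact: small_weight.
  - by rewrite mulr0 mulr_ge0 ?poisson_ge0// mulr_ge0// sqr_ge0.
rewrite ge0_integralZl_EFin//.
- rewrite (_ : 64 * c ^+ 2 = (4 * c ^+ 2) * 16); last by ring.
  rewrite [((4 * c ^+ 2) * 16)%:E]EFinM; apply: lee_wpmul2l; last exact: int_poisson1.
  by rewrite lee_fin mulr_ge0// sqr_ge0.
- by move=> t _; rewrite lee_fin poisson_ge0.
- apply/measurable_EFinP; apply: mfM => //; apply/mfV/mfD => //.
  by apply/mfX/mfD => //; exact: mfN.
- by rewrite mulr_ge0// sqr_ge0.
Qed.

(** A point (y, t) with t <= h sees the part of f at distance at least h
    through the Poisson kernel at height t, which there is at most a multiple
    of t / h times the one over x at height h. *)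
Lemma sdheat_far f x x0 h t y : tame f -> 0 < h -> 0 < t -> t <= h -> `|x - y| < t ->
  `|x - x0| < h ->
  (`|sdheat (fun z => f z * \1_(~` ball x0 (3 * h)) z) t y|%:E <=
   (t / h)%:E * (sdheat_cst%:E * HL f x))%E.
Proof.
move=> tf h0 t0 th xy xx0; have [mf _] := tf.
have mb : measurable (~` ball x0 (3 * h)) by apply: measurableC; exact: measurable_ball.
have mi : measurable_fun setT (\1_(~` ball x0 (3 * h)) : R -> R) by exact: measurable_indic.
have k0 : 0 <= sdmehler_cst :> R by exact/ltW/sdmehler_cst_gt0.
have H0 : (0 <= HL f x)%E by exact: HL_maximalT_ge0 (tame_loc tf) x.
apply: (@le_trans _ _ ((sdmehler_cst * (5 * (t / h)))%:E * (16%:E * HL f x))%E); last first.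
  rewrite !muleA -!EFinM; apply: lee_wpmul2r => //; rewrite lee_fin /sdheat_cst.
  have : 0 <= sdmehler_cst * (t / h) by rewrite mulr_ge0// divr_ge0 ?ltW.
  by move: sdmehler_cst k0 (t / h) => k k0 u; nra.
apply: (le_trans (sdheat_le_poisson y t0 (mfM mf mi))).
apply: (@le_trans _ _ (\int[mu]_z ((sdmehler_cst * (5 * (t / h)))%:E *
    (h / (h ^+ 2 + (x - z) ^+ 2) * `|f z|)%:E))%E).
  apply: le_int0 => z _; rewrite -?EFinM lee_fin.
    by rewrite mulr_ge0// mulr_ge0// poisson_ge0.
  move: sdmehler_cst k0 => k k0; rewrite -[k * _ * _]mulrA; apply: ler_wpM2l => //.
  rewrite [leRHS]mulrA normrM indicE.
  case: (boolP (z \in _)) => [|_]; last first.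
    rewrite normr0 !mulr0; apply: mulr_ge0 => //; apply: mulr_ge0; last exact: poisson_ge0.
    by rewrite mulr_ge0// divr_ge0 ?ltW.
  rewrite inE /= /ball/= => /negP; rewrite -leNgt => zb; rewrite normr1 mulr1.
  apply: ler_wpM2r => //.
  have yz : h <= `|y - z|.
    have := ler_distD x x0 z; have := ler_distD y x z; rewrite (distrC x0 x); lra.
  have xz : `|x - z| <= 2 * `|y - z|.
    have := ler_distD y x z; lra.
  have dd : h ^+ 2 + (x - z) ^+ 2 <= 5 * (t ^+ 2 + (y - z) ^+ 2).
    rewrite -(real_normK (num_real (x - z))) -(real_normK (num_real (y - z))).
    have h1 : h ^+ 2 <= `|y - z| ^+ 2 by rewrite ler_sqr ?nnegrE// ltW.
    have h2 : `|x - z| ^+ 2 <= (2 * `|y - z|) ^+ 2 by rewrite ler_sqr ?nnegrE// mulr_ge0.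
    have := sqr_ge0 t; move: h1 h2; rewrite exprMn; lra.
  have d1 : 0 < h ^+ 2 + (x - z) ^+ 2 by rewrite ltr_pwDl ?exprn_gt0 ?sqr_ge0.
  have d2 : 0 < t ^+ 2 + (y - z) ^+ 2 by rewrite ltr_pwDl ?exprn_gt0 ?sqr_ge0.
  have -> : 5 * (t / h) * (h / (h ^+ 2 + (x - z) ^+ 2)) = t * (5 / (h ^+ 2 + (x - z) ^+ 2)).
    by field; rewrite !gt_eqF.
  rewrite ler_pM2l// ler_pdivlMr// ler_pdivrMl//.
  by rewrite mulrC.
have c0 : 0 <= sdmehler_cst * (5 * (t / h)) by rewrite mulr_ge0// mulr_ge0// divr_ge0 ?ltW.
rewrite ge0_integralZl_EFin//.
- by apply: lee_wpmul2l; [rewrite lee_fin|exact: HL_poisson (tame_loc tf) h0].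
- by move=> z _; rewrite lee_fin mulr_ge0// poisson_ge0.
- by apply/measurable_EFinP; exact: mf_poisson.
Qed.

End good_lambda_tools.

Section good_lambda_inequality.
Context {R : realType}.
Local Notation mu := (@lebesgue_measure R).
Local Notation m2 := ((@lebesgue_measure R) \x (@lebesgue_measure R))%E.
Local Notation HL := (@HL_maximal R).
Implicit Types (f g : R -> R) (x y z t l a b : R) (E : set (R * R)).

Lemma sdheat_add f g t y : 0 < t -> tame f -> tame g ->
  sdheat (fun z => f z + g z) t y = sdheat f t y + sdheat g t y.
Proof.
move=> t0 tf tg; have s0 : 0 < t ^+ 2 by rewrite exprn_gt0.
rewrite !sdheatE -RintegralD//; [|exact: sdmehler_integrable..].
by apply: eq_Rintegral => z _; rewrite mulrDr.
Qed.

Lemma tame_indic f (D : set (measurableTypeR R)) : measurable D -> tame f ->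
  tame (fun z => f z * \1_D z).
Proof.
move=> mD tf; have [mf _] := tf; apply: tame_le tf => [|z].
  by apply: mfM => //; exact: measurable_indic.
by rewrite normrM indicE; case: (_ \in _); rewrite ?normr1 ?normr0 ?mulr1 ?mulr0.
Qed.

(** The ball contains the component to which x0 belongs and its neighbourhood
    at the scale h of its length. *)
Definition near_part f x0 h z : R := f z * \1_(ball x0 (3 * h)) z.

(** Below height h: the far part of f is handled by [sdheat_far], and the near
    part is kept. *)
Lemma area2_near f x x0 h c : tame f -> 0 < h -> `|x - x0| < h -> 0 <= c ->
  (sdheat_cst%:E * HL f x <= c%:E)%E ->
  (area2 [set p | (p.2 <= h)%R] f x <=
   2%:E * area2 setT (near_part f x0 h) x + (128 * c ^+ 2)%:E)%E.
Proof.
move=> tf h0 xx0 c0 Hc.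
have mb : measurable (ball x0 (3 * h)) by exact: measurable_ball.
pose f2 z := f z * \1_(~` ball x0 (3 * h)) z.
have t1 : tame (near_part f x0 h) by exact: tame_indic.
have t2 : tame f2 by apply: tame_indic => //; exact: measurableC.
have mE : measurable [set p : R * R | p.2 <= h] by exact: measurable_le.
have FD t y : 0 < t -> sdheat f t y = sdheat (near_part f x0 h) t y + sdheat f2 t y.
  move=> t0; rewrite -sdheat_add//; congr (sdheat _ t y); apply/funext => z.
  rewrite /near_part /f2 -mulrDr !indicE in_setC.
  by case: (z \in _); rewrite /= ?addr0 ?add0r mulr1.
apply: (le_trans (area2_split x mE t1.1 t2.1 FD)).
apply: leeD.
  by apply: lee_wpmul2l => //; exact: area2_subset.
rewrite (_ : 128 * c ^+ 2 = 2 * (64 * c ^+ 2)); last by ring.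
rewrite [(2 * _)%:E]EFinM; apply: lee_wpmul2l => //.
apply: area2_small_scale => //; first exact: t2.1.
move=> t y t0 th xy; rewrite -lee_fin.
apply: (le_trans (sdheat_far tf h0 t0 th xy xx0)); rewrite [(_ * c)%:E]EFinM.
by apply: lee_wpmul2l => //; rewrite lee_fin divr_ge0// ltW.
Qed.

(** The cone over x is cut at height h: the upper part is compared with the
    cone over a, the lower part with the near part of f. *)
Lemma area2_pointwise E f a x x0 h c : measurable E -> tame f -> 0 < h ->
  a < x -> x - a <= h -> `|x - x0| < h -> 0 <= c ->
  (sdheat_cst%:E * HL f x <= c%:E)%E ->
  (area2 E f x <= area2 E f a + (160 * c ^+ 2)%:E + 2%:E * area2 setT (near_part f x0 h) x)%E.
Proof.
move=> mE tf h0 ax xa xx0 c0 Hc; have [mf _] := tf.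
have mhi : measurable [set p : R * R | h < p.2] by exact: measurable_lt.
have mlo : measurable [set p : R * R | p.2 <= h] by exact: measurable_le.
have mD1 : measurable (area_cone x `&` (E `&` [set p : R * R | h < p.2])).
  by apply: measurableI; [exact: measurable_cone|exact: measurableI].
have mD2 : measurable (area_cone x `&` [set p : R * R | p.2 <= h]).
  by apply: measurableI => //; exact: measurable_cone.
have dis : [disjoint area_cone x `&` (E `&` [set p : R * R | h < p.2])
    & area_cone x `&` [set p : R * R | p.2 <= h]].
  by apply/disj_setPS => p [[_ [_ /= hp]] [_ /=]]; rewrite leNgt hp.
have mD (D : set (R * R)) : measurable_fun D (fun p : R * R => (sdheat f p.2 p.1 ^+ 2 / p.2 ^+ 2)%:E).
  by apply: (@measurable_funS _ _ _ _ setT) => //; exact: mf_density.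
have split : (area2 E f x <= area2 (E `&` [set p | (h < p.2)%R]) f x + area2 [set p | (p.2 <= h)%R] f x)%E.
  rewrite /area2 -(ge0_integral_setU m2 mD1 mD2 (mD _) (fun p _ => density_ge0 f p) dis).
  apply: le_int0_set; last by move=> p _; exact: density_ge0.
  by move=> p [cp Ep]; have [hp|hp] := ltP h p.2; [left|right].
have Fc t y : 0 < t -> `|x - y| < t -> `|sdheat f t y| <= c.
  move=> t0 xy; rewrite -lee_fin; apply: le_trans Hc; apply: sdheat_le_HL => //.
  by apply: (lt_trans xy); rewrite ltr_pMl// ltr1n.
apply: (le_trans split).
apply: (le_trans (leeD (area2_tail mE mf h0 ax xa c0 Fc) (area2_near tf h0 xx0 c0 Hc))).
rewrite addeACA [leRHS]addeAC; apply: leeD => //; rewrite -EFinD lee_fin; lra.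
Qed.

(** If [area2] is at most l at the end point a and exceeds 8 l at x, then by
    [area2_pointwise] it exceeds l at x for the near part of f. The weak type
    estimate bounds the measure of such x by the L^1 norm of the near part,
    which is small by the condition on the maximal function at one point x0. *)
Lemma component_measure E f a b l d : measurable E -> tame f -> a < b -> 0 < l -> 0 < d ->
  160 * (sdheat_cst * d) ^+ 2 <= 1 -> (area2 E f a <= l%:E)%E ->
  (mu (`]a, b[ `&` [set x | ((8 * l)%:E < area2 E f x)%E] `&`
     [set x | (HL f x <= (d * Num.sqrt l)%:E)%E]) <= (6 * weak_cst * d * (b - a))%:E)%E.
Proof.
move=> mE tf ab l0 d0 dF Aa; have [mf _] := tf; have lf := tame_loc tf.
have sl0 : 0 < Num.sqrt l by rewrite sqrtr_gt0.
have sl2 : Num.sqrt l ^+ 2 = l by rewrite sqr_sqrtr// ltW.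
set S := (X in mu X); pose h := b - a; have h0 : 0 < h by rewrite subr_gt0.
have [S0|/set0P[x0 Sx0]] := eqVneq S set0.
  by rewrite S0 measure0 lee_fin !mulr_ge0 ?(ltW d0) ?(ltW h0) ?(ltW weak_cst_gt0).
have [[/= x0I _] Hx0] := Sx0.
pose f1 := near_part f x0 h.
have mb : measurable (ball x0 (3 * h)) by exact: measurable_ball.
have [mf1 _] : tame f1 by exact: tame_indic.
have n1 : (\int[mu]_z `|f1 z|%:E <= (6 * h * (d * Num.sqrt l))%:E)%E.
  apply: (@le_trans _ _ (\int[mu]_(z in ball x0 (3 * h)) `|f z|%:E)%E).
    rewrite [leRHS]integral_mkcond; apply: le_int0 => z _; first by rewrite lee_fin.
    rewrite patchE /f1 /near_part indicE; case: ifPn => _; first by rewrite mulr1.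
    by rewrite mulr0 normr0.
  have h3 : 0 < 3 * h by rewrite mulr_gt0.
  apply: (le_trans (HL_ball x0 lf h3)).
  rewrite (_ : 6 * h * (d * Num.sqrt l) = 2 * (3 * h) * (d * Num.sqrt l)); last by ring.
  rewrite [leRHS]EFinM; apply: lee_wpmul2l => //.
  by rewrite lee_fin mulr_ge0// ltW.
have jf1 : mu.-integrable setT (EFin \o f1).
  apply/integrableP; split; first exact/measurable_EFinP.
  by apply: (le_lt_trans n1); rewrite ltry.
have sub : S `<=` [set x | ((Num.sqrt l ^+ 2)%:E < area2 setT f1 x)%E].
  move=> x [[/= xI Ax] Hx]; rewrite sl2 ltNge; apply/negP => A1.
  move: x0I xI; rewrite !in_itv/= => /andP[ax0 x0b] /andP[ax xb].
  have c0 : 0 <= sdheat_cst * (d * Num.sqrt l).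
    by rewrite mulr_ge0 ?(ltW sdheat_cst_gt0)// mulr_ge0 ?(ltW d0) ?(ltW sl0).
  have xx0 : `|x - x0| < h by rewrite ltr_norml /h; apply/andP; split; lra.
  have xah : x - a <= h by rewrite /h; lra.
  have Hc : (sdheat_cst%:E * HL f x <= (sdheat_cst * (d * Num.sqrt l))%:E)%E.
    by rewrite [leRHS]EFinM; apply: lee_wpmul2l => //; rewrite lee_fin ltW// sdheat_cst_gt0.
  have := area2_pointwise mE tf h0 ax xah xx0 c0 Hc; rewrite -/f1 => Ap.
  have : (area2 E f x <= l%:E + (160 * (sdheat_cst * (d * Num.sqrt l)) ^+ 2)%:E + 2%:E * l%:E)%E.
    by apply: (le_trans Ap); apply: leeD; [apply: leeD|exact: lee_wpmul2l].
  move=> /(lt_le_trans Ax); rewrite -EFinM -!EFinD lte_fin.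
  rewrite (_ : 160 * (sdheat_cst * (d * Num.sqrt l)) ^+ 2 = 160 * (sdheat_cst * d) ^+ 2 * l); last first.
    by clear -sl2; move: (Num.sqrt l) sl2 sdheat_cst => s <- k; ring.
  have : 160 * (sdheat_cst * d) ^+ 2 * l <= 1 * l by rewrite ler_pM2r.
  by move: (160 * _ * l) => u; lra.
apply: (@le_trans _ _ (mu [set x | ((Num.sqrt l ^+ 2)%:E < area2 setT f1 x)%E])).
  apply: le_measure; rewrite ?inE//.
  - apply: measurableI; first apply: measurableI.
    + exact: measurable_itv.
    + by apply: measurable_superlevel; exact: mf_area2.
    + rewrite (_ : [set x | _] = ~` [set x | ((d * Num.sqrt l)%:E < HL f x)%E]).
        by apply: measurableC; apply: measurable_superlevel; exact: measurable_HL_maximal.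
      by apply/seteqP; split => x /=; rewrite leNgt => /negP.
  - by apply: measurable_superlevel; exact: mf_area2.
apply: (le_trans (area2_weak jf1 sl0)).
apply: (@le_trans _ _ ((weak_cst / Num.sqrt l)%:E * (6 * h * (d * Num.sqrt l))%:E)%E).
  by apply: lee_wpmul2l => //; rewrite lee_fin divr_ge0 ?(ltW sl0) ?(ltW weak_cst_gt0).
rewrite -EFinM lee_fin le_eqVlt; apply/orP; left; apply/eqP.
by rewrite /h; move: weak_cst => W; field; rewrite gt_eqF.
Qed.

(** The set where [area2] > l is open of finite measure, and
    [component_measure] applies on each of its components. *)
Lemma good_lambda N f l d : tame f -> 0 < l -> 0 < d ->
  160 * (sdheat_cst * d) ^+ 2 <= 1 ->
  (mu [set x | ((8 * l)%:E < area2 (box N) f x)%E] <=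
   (6 * weak_cst * d)%:E * mu [set x | (l%:E < area2 (box N) f x)%E] +
   mu [set x | ((d * Num.sqrt l)%:E < HL f x)%E])%E.
Proof.
move=> tf l0 d0 dF; have [mf _] := tf; have lf := tame_loc tf.
have mE := @measurable_box R N.
set U := [set x | (l%:E < _)%E]; set L := [set x | ((8 * l)%:E < _)%E].
set H := [set x | (_ < HL f x)%E].
have oU : open U by exact: open_area2.
have fU : (mu U < +oo)%E by apply: (le_lt_trans (area2_box_support N l0 mf)); rewrite ltry.
have [ab [ab_le tI UE Uend]] := open_components oU fU.
have mL : measurable L by apply: measurable_superlevel; exact: mf_area2.
have mH : measurable H by apply: measurable_superlevel; exact: measurable_HL_maximal.
pose J i : set (measurableTypeR R) := `](ab i).1, (ab i).2[ `&` L `&` [set x | (HL f x <= (d * Num.sqrt l)%:E)%E].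
have HCE : [set x | (HL f x <= (d * Num.sqrt l)%:E)%E] = ~` H.
  by apply/seteqP; split => x /=; rewrite leNgt => /negP.
have mJ i : measurable (J i).
  rewrite /J HCE; apply: measurableI; last exact: measurableC.
  by apply: measurableI => //; exact: measurable_itv.
have sub : L `<=` (\bigcup_i J i) `|` H.
  move=> x Lx; have [Hx|nHx] := pselect (H x); [by right|left].
  have : U x.
    by apply: le_lt_trans Lx; rewrite lee_fin ler_peMl ?ler1n// ltW.
  rewrite UE => -[i _ Ix]; exists i => //; split => //.
  by rewrite /= leNgt; apply/negP.
apply: (@le_trans _ _ (mu ((\bigcup_i J i) `|` H))).
  by apply: le_measure; rewrite ?inE//; apply: measurableU => //; exact: bigcup_measurable.
apply: (le_trans (measureU2 _ _ _)) => //; first exact: bigcup_measurable.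
apply: leeD => //.
apply: (@le_trans _ _ (\sum_(0 <= i <oo) mu (J i))%E).
  apply: measure_sigma_subadditive => //; exact: bigcup_measurable.
have -> : mu U = (\sum_(0 <= i <oo) mu `](ab i).1, (ab i).2[)%E.
  rewrite UE measure_bigcup//.
  by apply: eq_eseriesl => i; rewrite in_setT.
rewrite -nneseriesZl; last by move=> i _; exact: measure_ge0.
apply: lee_nneseries => [i _ _|i _]; first exact: measure_ge0.
have := ab_le i; rewrite le_eqVlt => /predU1P[e|lti].
  by rewrite /J e set_itvoo0 !set0I !measure0 mule0.
have [nU _] := Uend i lti.
have Aa : (area2 (box N) f (ab i).1 <= l%:E)%E by rewrite leNgt; apply/negP => ?; apply: nU.
apply: (le_trans (component_measure mE tf lti l0 d0 dF Aa)).
by rewrite lebesgue_measure_itv/= lte_fin lti -EFinB -EFinM.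
Qed.

(** The constant d of the good-lambda inequality is chosen small enough for
    the absorption in [good_lambda_int]; afterwards the truncation is removed
    by monotone convergence. *)
Lemma area2_strong r : 0 < r -> exists2 C, 0 < C & forall f, tame f ->
  (\int[mu]_x area2 setT f x `^ r <= C%:E * \int[mu]_x HL f x `^ (2 * r))%E.
Proof.
move=> r0; pose b : R := 8^-1.
have b0 : 0 < b by rewrite invr_gt0.
have b1 : b < 1 by rewrite invf_lt1// ltr1n.
have rho0 : 0 < b `^ r by rewrite powR_gt0.
have rho1 : b `^ r < 1 by exact: rho_lt1.
have F0 : 0 < sdheat_cst :> R by exact: sdheat_cst_gt0.
have W0 : 0 < weak_cst :> R by exact: weak_cst_gt0.
(* The choice d = 1 / K makes d * sdheat_cst at most 1 / 13, where 13^2 > 160,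
   and 6 * weak_cst * d at most half of b ^ r. *)
pose K := 1 + 13 * sdheat_cst + 12 * weak_cst / b `^ r.
have K1 : 0 < 12 * weak_cst / b `^ r by rewrite divr_gt0// mulr_gt0.
have K0 : 0 < K by rewrite /K !addr_gt0// mulr_gt0.
pose d := K^-1; have d0 : 0 < d by rewrite invr_gt0.
have dK : d * K = 1 by rewrite mulVf// gt_eqF.
have dF : 160 * (sdheat_cst * d) ^+ 2 <= 1.
  have u0 : 0 <= sdheat_cst * d by rewrite mulr_ge0 ?(ltW F0) ?(ltW d0).
  have u1 : 13 * (sdheat_cst * d) <= 1.
    have : d * (13 * sdheat_cst) <= d * K.
      by rewrite ler_pM2l// /K; move: K1; move: (12 * _ / _) => k k0; lra.
    rewrite dK; lra.
  move: (sdheat_cst * d) u0 u1 => u u0 u1; rewrite expr2; nra.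
pose e := 6 * weak_cst * d.
have e0 : 0 <= e by rewrite !mulr_ge0 ?(ltW W0) ?(ltW d0).
have eb : e <= b `^ r / 2.
  have : d * (12 * weak_cst / b `^ r) <= d * K.
    by rewrite ler_pM2l// /K; move: F0; move: (12 * _ / _) => k; move: sdheat_cst => k' k0; lra.
  rewrite dK mulrA ler_pdivrMr// mul1r /e; lra.
pose C := 2 / (b `^ r * (1 - b `^ r)) * (8 / d ^+ 2) `^ r.
have C0 : 0 < C.
  rewrite mulr_gt0 ?powR_gt0 ?divr_gt0 ?mulr_gt0 ?exprn_gt0// subr_gt0//.
exists C => // f tf; have [mf _] := tf; have lf := tame_loc tf.
have H0 x : (0 <= HL f x)%E by exact: HL_maximalT_ge0.
have mHL := measurable_HL_maximal lf.
(* The condition Mf > d sqrt (b l) is rewritten as Nf > l, with b = 1 / 8. *)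
pose Nf x := ((8 / d ^+ 2)%:E * HL f x `^ 2)%E.
have k0 : 0 < 8 / d ^+ 2 by rewrite divr_gt0// exprn_gt0.
have mHr s : measurable_fun setT (fun x => HL f x `^ s)%E.
  by apply: (measurableT_comp (measurable_poweR _)).
have Nf0 x : (0 <= Nf x)%E by rewrite mule_ge0 ?poweR_ge0// lee_fin ltW.
have mN : measurable_fun setT Nf.
  by apply: emeasurable_funM => //; exact: measurable_cst.
have trunc N : (\int[mu]_x area2 (box N) f x `^ r <= C%:E * \int[mu]_x HL f x `^ (2 * r))%E.
  have mE := @measurable_box R N.
  have gl (l : R) : 0 < l -> (mu [set x | (l%:E < area2 (box N) f x)%E] <=
      e%:E * mu [set x | ((b * l)%:E < area2 (box N) f x)%E] + mu [set x | (l%:E < Nf x)%E])%E.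
    move=> l0; have bl0 : 0 < b * l by rewrite mulr_gt0.
    have := good_lambda N tf bl0 d0 dF.
    have -> : 8 * (b * l) = l by rewrite mulrA divff ?mul1r.
    move=> /le_trans; apply; apply: leeD => //.
    apply: le_measure; rewrite ?inE.
    - exact: measurable_superlevel.
    - exact: measurable_superlevel.
    move=> x /=; rewrite /Nf; case E : (HL f x) => [v| |]//= hv; last first.
      by rewrite pnatr_eq0/= gt0_muley ?lte_fin// ltry.
    rewrite lte_fin in hv; have v0 : 0 <= v by have := H0 x; rewrite E lee_fin.
    rewrite powR_mulrn// -EFinM lte_fin.
    have dv : 0 <= d * Num.sqrt (b * l) by rewrite mulr_ge0 ?(ltW d0) ?sqrtr_ge0.
    have : (d * Num.sqrt (b * l)) ^+ 2 < v ^+ 2 by rewrite ltr_sqr ?nnegrE.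
    rewrite exprMn sqr_sqrtr ?(ltW bl0)// [8 / _ * _]mulrAC ltr_pdivlMr ?exprn_gt0// /b.
    by move: (d ^+ 2) (v ^+ 2) => D V; lra.
  have := @good_lambda_int _ (measurableTypeR R) R mu b r b0 b1 r0 (area2 (box N) f) Nf e (N%:R *+ 4)
     (fun x => area2_ge0 (box N) f x) (mf_area2 mE mf) Nf0 mN e0 eb
     (fun l (hl : 0 < l) => area2_box_support N hl mf) gl.
  move=> /le_trans; apply; rewrite /C [(_ * _ `^ r)%:E]EFinM -muleA; apply: lee_wpmul2l.
    by rewrite lee_fin divr_ge0// mulr_ge0 ?(ltW rho0)// subr_ge0 ltW.
  rewrite -ge0_integralZl_EFin ?powR_ge0//.
  - apply: le_int0 => x _; rewrite ?poweR_ge0// /Nf poweRM ?poweR_ge0 ?lee_fin ?(ltW k0)//.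
    by rewrite poweRrM poweR_EFin.
  - by move=> x _; exact: poweR_ge0.
  - exact: mHr.
apply: (@int_poweR_sup _ _ (measurableTypeR R) mu r (area2 setT f) (fun N => area2 (box N) f) _
  r0 (area2_ge0 setT f) (fun N => area2_ge0 (box N) f)
  (fun N => mf_area2 (@measurable_box R N) mf)) => //.
- move=> n k x nk; apply: area2_subset => p [p1 p2].
  have nk' : (n%:R : R) <= k%:R by rewrite ler_nat.
  by split; [exact: le_trans nk'|exact: le_trans nk'].
- move=> x c cA.
  pose S n : set (measurableTypeR R * measurableTypeR R) := area_cone x `&` box n.
  have mS n : measurable (S n) by apply: measurableI; [exact: measurable_cone|exact: measurable_box].
  have SE : area_cone x `&` setT = \bigcup_n S n.
    apply/seteqP; split => [[y t] [cp _]|p [n _ [cp _]]]; last by split.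
    exists (Num.truncn (`|y| + `|t|)).+1 => //; split => //=.
    have := truncnS_gt (`|y| + `|t|); have := normr_ge0 y; have := ler_norm t.
    have := normr_ge0 t; rewrite /box/=; move: (_.+1%:R) => M h1 h2 h3 h4.
    by split => /=; lra.
  have Sn : {homo S : n k / (n <= k)%N >-> (n <= k)%O}.
    move=> n k nk; apply/subsetPset => p [cp [p1 p2]].
    have nk' : (n%:R : R) <= k%:R by rewrite ler_nat.
    by split => //; split; [exact: le_trans nk'|exact: le_trans nk'].
  have := @ge0_nondecreasing_set_cvg_integral _ _ _ S
    (fun p : R * R => (sdheat f p.2 p.1 ^+ 2 / p.2 ^+ 2)%:E) m2 Sn mS
    (fun n => measurable_funS measurableT (@subsetT _ _) (mf_density mf))
    (fun n p _ => density_ge0 f p).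
  rewrite -SE => cvA; apply: contrapT => /forallNP h.
  move: cA; rewrite ltNge => /negP; apply.
  by apply: (cvge_le _ cvA); near=> n; have /negP := h n; rewrite -leNgt.
Unshelve. all: by end_near. Qed.

End good_lambda_inequality.

(** * Exponents above 2 and complex values *)

Section powers.
Context {R : realType}.
Implicit Types (x y : \bar R) (r : R).
Local Open Scope ereal_scope.

Lemma le_poweR r x y : (0 <= r)%R -> 0 <= x -> x <= y -> x `^ r <= y `^ r.
Proof.
move=> r0 x0 xy; apply: gt0_ler_poweR => //; rewrite in_itv/= ?leey ?andbT//.
exact: le_trans xy.
Qed.

Lemma powR_subK r (s : R) : (0 < r)%R -> (0 <= s)%R -> (s `^ r = s `^ (r - 2) * s ^+ 2)%R.
Proof.
move=> r0 s0; rewrite -[(s ^+ 2)%R]powR_mulrn// -powRD ?subrK//.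
by rewrite gt_eqF.
Qed.

Lemma poweRK r x : (r != 0)%R -> 0 <= x -> (x `^ r) `^ r^-1 = x.
Proof. by move=> r0 x0; rewrite -poweRrM mulfV// poweRe1. Qed.

Lemma poweR_le r x y : (0 < r)%R -> 0 <= x -> 0 <= y -> x `^ r <= y `^ r -> x <= y.
Proof.
move=> r0 x0 y0 h; rewrite -(@poweRK r x) ?gt_eqF// -(@poweRK r y) ?gt_eqF//.
by apply: le_poweR => //; [rewrite invr_ge0 ltW|exact: poweR_ge0].
Qed.

Lemma poweRD_le r x y : (0 < r)%R -> 0 <= x -> 0 <= y ->
  (x + y) `^ r <= (2 `^ r)%:E * (x `^ r + y `^ r).
Proof.
move=> r0; wlog xy : x y / x <= y => [H|] x0 y0.
  have [xy|/ltW yx] := leP x y; first exact: H.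
  by rewrite addeC [X in _ * X]addeC; exact: H.
apply: (@le_trans _ _ ((2%:E * y) `^ r)).
  apply: le_poweR; rewrite ?(ltW r0) ?adde_ge0//.
  by rewrite (_ : 2%:E = 1 + 1) ?ge0_muleDl ?mul1e ?leeD2r.
rewrite poweRM// poweR_EFin; apply: lee_wpmul2l; first by rewrite lee_fin powR_ge0.
by rewrite leeDr// poweR_ge0.
Qed.

End powers.

Section complex_area_function.
Context {R : realType}.
Local Notation mu := (@lebesgue_measure R).
Local Notation m2 := ((@lebesgue_measure R) \x (@lebesgue_measure R))%E.
Local Notation HL := (@HL_maximal R).
Implicit Types (f : R -> R[i]) (x y z t q : R) (p : R * R).

Definition re f z : R := complex.Re (f z).
Definition im f z : R := complex.Im (f z).

Lemma cmodE (z : R[i]) : cmod z = Num.sqrt (complex.Re z ^+ 2 + complex.Im z ^+ 2).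
Proof. by case: z. Qed.

Lemma re_le_cmod f z : `|re f z| <= cmod (f z).
Proof.
rewrite cmodE -sqrtr_sqr /re; apply: ler_wsqrtr; by rewrite lerDl sqr_ge0.
Qed.

Lemma im_le_cmod f z : `|im f z| <= cmod (f z).
Proof.
rewrite cmodE -sqrtr_sqr /im; apply: ler_wsqrtr; by rewrite lerDr sqr_ge0.
Qed.

Lemma hermite_heatE r f y : hermite_heat r f y =
  Complex (\int[mu]_z (mehler r y z * re f z)) (\int[mu]_z (mehler r y z * im f z)).
Proof.
rewrite /hermite_heat /cintegral; congr Complex; apply: eq_Rintegral => z _;
by rewrite /re /im; case: (f z) => a b /=; rewrite mul0r ?subr0 ?addr0.
Qed.

Lemma sdsE f t y : 0 < t -> tame (re f) -> tame (im f) ->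
  cmod (hermite_heat_sds f (t ^+ 2) y) =
  Num.sqrt (sdheat (re f) t y ^+ 2 + sdheat (im f) t y ^+ 2).
Proof.
move=> t0 tr ti; have s0 : 0 < t ^+ 2 by rewrite exprn_gt0.
rewrite !sdheat_dheat// !dheatE -!heat_derive// /hermite_heat_sds /cderive1.
have -> : (fun r => complex.Re (hermite_heat r f y)) =
    (fun r => \int[mu]_z (mehler r y z * re f z)).
  by apply/funext => r; rewrite hermite_heatE.
have -> : (fun r => complex.Im (hermite_heat r f y)) =
    (fun r => \int[mu]_z (mehler r y z * im f z)).
  by apply/funext => r; rewrite hermite_heatE.
by rewrite cmodE; move: (derive1 _ _) (derive1 _ _) => a b /=; rewrite !mul0r subr0 addr0.
Qed.

Definition carea2 f x : \bar R := (area2 setT (re f) x + area2 setT (im f) x)%E.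
Definition cmaximal f x : \bar R := (sdheat_cst%:E * (HL (re f) x + HL (im f) x))%E.

Definition density q f (p : R * R) : \bar R :=
  (Num.sqrt (sdheat (re f) p.2 p.1 ^+ 2 + sdheat (im f) p.2 p.1 ^+ 2) `^ q / p.2 ^+ 2)%:E.

Lemma density2_ge0 q f p : (0 <= density q f p)%E.
Proof. by rewrite lee_fin divr_ge0 ?sqr_ge0 ?powR_ge0. Qed.

Lemma area_gE q f x : tame (re f) -> tame (im f) ->
  (area_g q f x = (\int[m2]_(p in area_cone x) density q f p) `^ q^-1)%E.
Proof.
move=> tr ti.
have E p : p \in area_cone x ->
    (cmod (hermite_heat_sds f (p.2 ^+ 2) p.1) `^ q / p.2 ^+ 2)%:E = density q f p.
  by rewrite inE => -[p0 _]; rewrite /density (sdsE _ p0 tr ti).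
by rewrite /area_g; apply: (f_equal (fun u => u `^ q^-1)%E); apply: eq_integral => p; exact: E.
Qed.

Lemma area_g_ge0 q f x : (0 <= area_g q f x)%E. Proof. exact: poweR_ge0. Qed.

Lemma mf_area_g q f : tame (re f) -> tame (im f) -> measurable_fun setT (area_g q f).
Proof.
move=> tr ti; have [mr _] := tr; have [mi _] := ti.
rewrite (_ : area_g q f = fun x => (\int[m2]_(p in area_cone x) density q f p) `^ q^-1)%E; last first.
  by apply/funext => x; exact: area_gE.
apply: (measurableT_comp (measurable_poweR _)).
apply: mf_cone; last exact: density2_ge0.
apply/measurable_EFinP; apply: mfM; last by apply/mfV/mfX.
apply: (measurableT_comp (measurable_powR q)).
by apply: mfsqrt; apply: mfD; apply: mfX; exact: mf_sdheat.
Qed.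

(** With s^2 = F(re f)^2 + F(im f)^2 one has s <= M on the cone, hence
    s^q <= M^(q-2) s^2 and area_g^q <= M^(q-2) A. The larger of M and sqrt A
    then dominates area_g. *)
Lemma area_g_le q f x : 2 <= q -> tame (re f) -> tame (im f) ->
  (area_g q f x <= cmaximal f x)%E \/ (area_g q f x <= carea2 f x `^ 2^-1)%E.
Proof.
move=> q2 tr ti; have [mr _] := tr; have [mi _] := ti.
have q0 : 0 < q by lra.
have A20 : (0 <= carea2 f x)%E by apply: adde_ge0; exact: area2_ge0.
case EM : (cmaximal f x) => [M| |]; last 2 first.
- by left; rewrite leey.
- have : (0 <= cmaximal f x)%E.
    by rewrite mule_ge0 ?lee_fin ?(ltW sdheat_cst_gt0)// adde_ge0//; exact/HL_maximalT_ge0/tame_loc.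
  by rewrite EM.
case EA : (carea2 f x) => [A| |]; last 2 first.
- by right; rewrite /= invr_eq0 pnatr_eq0 /= leey.
- by rewrite EA in A20.
rewrite EA lee_fin in A20.
have FM t y : 0 < t -> `|x - y| < t -> Num.sqrt (sdheat (re f) t y ^+ 2 + sdheat (im f) t y ^+ 2) <= M.
  move=> t0 xy; have xy2 : `|x - y| < 2 * t by apply: (lt_trans xy); rewrite ltr_pMl// ltr1n.
  have h1 := sdheat_le_HL tr t0 xy2; have h2 := sdheat_le_HL ti t0 xy2.
  have : (`|sdheat (re f) t y|%:E + `|sdheat (im f) t y|%:E <= M%:E)%E.
    have Hr := HL_maximalT_ge0 (tame_loc tr) x.
    have Hi := HL_maximalT_ge0 (tame_loc ti) x.
    rewrite -EM /cmaximal (ge0_muleDr _ Hr Hi); exact: leeD.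
  rewrite -EFinD lee_fin; apply: le_trans.
  move: (sdheat _ t y) (sdheat _ t y) => a b.
  rewrite -(real_normK (num_real a)) -(real_normK (num_real b)).
  apply: (@le_trans _ _ (Num.sqrt ((`|b| + `|a|) ^+ 2))); last first.
    by rewrite sqrtr_sqr [X in X <= _]ger0_norm ?addr_ge0.
  apply: ler_wsqrtr.
  have := mulr_ge0 (normr_ge0 a) (normr_ge0 b); rewrite !expr2; lra.
have M0 : 0 <= M.
  by apply: le_trans (FM 1 x ltr01 _); rewrite ?sqrtr_ge0// subrr normr0.
have qm : 0 <= q - 2 by rewrite subr_ge0.
have key : (\int[m2]_(p in area_cone x) density q f p <= (M `^ (q - 2) * A)%:E)%E.
  rewrite EFinM -EA /carea2 /area2 !setIT -ge0_integralD//; last 5 first.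
  - exact: measurable_cone.
  - by move=> p _; exact: density_ge0.
  - by apply: (@measurable_funS _ _ _ _ setT) => //; exact: mf_density.
  - by move=> p _; exact: density_ge0.
  - by apply: (@measurable_funS _ _ _ _ setT) => //; exact: mf_density.
  rewrite -ge0_integralZl_EFin ?powR_ge0//; last 3 first.
  - exact: measurable_cone.
  - by move=> p _; apply: adde_ge0; exact: density_ge0.
  - apply: (@measurable_funS _ _ _ _ setT) => //.
    by apply: emeasurable_funD; exact: mf_density.
  apply: le_int0 => -[y t] [/= t0 xy]; first exact: density2_ge0.
  rewrite /density/= -EFinD -EFinM lee_fin -mulrDl mulrA.
  rewrite ler_wpM2r ?invr_ge0 ?sqr_ge0//.
  have := FM t y t0 xy; move: (sdheat _ t y) (sdheat _ t y) => b a.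
  have s0 : 0 <= a ^+ 2 + b ^+ 2 by rewrite addr_ge0 ?sqr_ge0.
  rewrite -[X in _ <= _ * X](sqr_sqrtr s0); move: (Num.sqrt _) (sqrtr_ge0 (a ^+ 2 + b ^+ 2)) => s s0' sM.
  rewrite (powR_subK q0 s0').
  by apply: ler_wpM2r; [exact: sqr_ge0|apply: ge0_ler_powR; rewrite ?nnegrE].
have qi : 0 <= q^-1 by rewrite invr_ge0 ltW.
have i0 : (0 <= \int[m2]_(p in area_cone x) density q f p)%E.
  by apply: integral_ge0 => p _; exact: density2_ge0.
rewrite area_gE//.
have Mq := powR_subK q0 M0.
have [MA|AM] := leP (M ^+ 2) A; [right|left].
- rewrite -(@poweRK _ q (A%:E `^ 2^-1)%E) ?gt_eqF ?poweR_ge0//.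
  apply: le_poweR => //; apply: (le_trans key).
  have sA : (A `^ 2^-1) ^+ 2 = A by rewrite -powR_mulrn ?powR_ge0// -powRrM mulVf// powRr1.
  rewrite -poweRrM poweR_EFin lee_fin powRrM (powR_subK q0 (powR_ge0 _ _)) sA.
  apply: ler_wpM2r => //; apply: ge0_ler_powR; rewrite ?nnegrE ?powR_ge0//.
  by rewrite -(@ler_sqr R) ?nnegrE ?powR_ge0// sA.
- rewrite -(@poweRK _ q M%:E) ?gt_eqF ?lee_fin//.
  apply: le_poweR => //; apply: (le_trans key); rewrite poweR_EFin lee_fin Mq.
  by apply: ler_wpM2l; [exact: powR_ge0|exact: ltW].
Qed.

End complex_area_function.

Section norms.
Context {R : realType}.
Local Notation mu := (@lebesgue_measure R).
Local Notation HL := (@HL_maximal R).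
Implicit Types (f : R -> R[i]) (u : R -> R) (p q : R).

Definition cpow p f : \bar R := (\int[mu]_z (cmod (f z) `^ p)%:E)%E.

Lemma cmod_ge0 (z : R[i]) : 0 <= cmod z.
Proof. by rewrite cmodE sqrtr_ge0. Qed.

Lemma cpowE p f : 0 < p -> (cLnorm p f `^ p = cpow p f)%E.
Proof.
move=> p0; rewrite /cLnorm powR_Lnorm ?gt_eqF//; apply: eq_integral => z _.
by rewrite gee0_abs ?lee_fin ?cmod_ge0// poweR_EFin.
Qed.

Lemma cLnorm_ge0 p f : (0 <= cLnorm p f)%E. Proof. exact: Lnorm_ge0. Qed.

Lemma cpow_ge0 p f : (0 <= cpow p f)%E.
Proof. by apply: integral_ge0 => z _; rewrite lee_fin powR_ge0. Qed.

Lemma inLp_cpow p f : 0 < p -> inLp p f -> (cpow p f < +oo)%E.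
Proof.
move=> p0 [_ _]; rewrite -cpowE//; have := cLnorm_ge0 p f.
by case: (cLnorm p f) => [r| |]//= _ _; rewrite ltry.
Qed.

Lemma int_pow_le p f u : 0 < p -> (forall z, `|u z| <= cmod (f z)) ->
  (\int[mu]_z (`|u z| `^ p)%:E <= cpow p f)%E.
Proof.
move=> p0 uf; apply: le_int0 => z _; rewrite lee_fin ?powR_ge0//.
by apply: ge0_ler_powR; rewrite ?nnegrE ?cmod_ge0// ltW.
Qed.

(** Where |u| <= 1 the weight is integrable; elsewhere |u| <= |u|^p. *)
Lemma tame_Lp p f u : 1 <= p -> inLp p f -> measurable_fun setT u ->
  (forall z, `|u z| <= cmod (f z)) -> tame u.
Proof.
move=> p1 fp mu_ uf; have p0 : 0 < p by exact: lt_le_trans p1.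
split => //; have mup : measurable_fun setT (fun z => (`|u z| `^ p)%:E).
  apply/measurable_EFinP; apply: (measurableT_comp (measurable_powR p)).
  exact: measurableT_comp.
apply: (@le_lt_trans _ _ (\int[mu]_z ((`|u z| `^ p)%:E + (`|1 : R| / (1 + z ^+ 2))%:E))%E).
  apply: le_int0 => z _; rewrite -?EFinD lee_fin.
    by rewrite divr_ge0// addr_ge0// sqr_ge0.
  have d0 : 0 < 1 + z ^+ 2 by rewrite ltr_wpDr ?sqr_ge0.
  rewrite normr1 mul1r; have [u1|u1] := leP `|u z| 1.
    apply: (@le_trans _ _ (1 + z ^+ 2)^-1); last by rewrite lerDr powR_ge0.
    by rewrite ler_pdivrMr// mulVf ?gt_eqF.
  apply: (@le_trans _ _ (`|u z| `^ p)); last by rewrite lerDl invr_ge0 ltW.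
  apply: (@le_trans _ _ `|u z|).
    by rewrite ler_pdivrMr// ler_peMr// lerDl sqr_ge0.
  by rewrite -{1}(powRr1 (normr_ge0 (u z))) ler_powR// ltW.
rewrite ge0_integralD//.
- rewrite lte_add_pinfty ?int_weight_lty//.
  by apply: le_lt_trans (int_pow_le p0 uf) (inLp_cpow p0 fp).
- by move=> z _; rewrite lee_fin divr_ge0// addr_ge0// sqr_ge0.
- apply/measurable_EFinP; apply: mfM => //; apply/mfV/mfD => //; exact: mfX.
Qed.

Lemma tame_re p f : 1 <= p -> inLp p f -> tame (re f).
Proof. by move=> p1 fp; apply: (tame_Lp p1 fp); [case: fp|exact: re_le_cmod]. Qed.

Lemma tame_im p f : 1 <= p -> inLp p f -> tame (im f).
Proof. by move=> p1 fp; apply: (tame_Lp p1 fp); [case: fp|exact: im_le_cmod]. Qed.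

Lemma area_strong q p : 2 <= q -> 1 < p -> exists2 K : R, 0 < K &
  forall f, inLp p f -> (\int[mu]_x area_g q f x `^ p <= K%:E * cpow p f)%E.
Proof.
move=> q2 p1; have p0 : 0 < p by exact: lt_trans p1.
have ph : 0 < p / 2 by rewrite divr_gt0.
have [CH CH0 strongH] := @HL_strong R p p1.
have [CA CA0 strongA] := @area2_strong R (p / 2) ph.
have F0 : 0 < sdheat_cst :> R by exact: sdheat_cst_gt0.
pose k1 : R := sdheat_cst `^ p * 2 `^ p; pose k2 : R := 2 `^ (p / 2).
have k10 : 0 < k1 by rewrite mulr_gt0 ?powR_gt0.
have k20 : 0 < k2 by rewrite powR_gt0.
exists (k1 * (CH + CH) + k2 * (CA * CH + CA * CH)).
  by rewrite addr_gt0// mulr_gt0// addr_gt0// mulr_gt0.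
move=> f fp; have tr := tame_re (ltW p1) fp; have ti := tame_im (ltW p1) fp.
have lr := tame_loc tr; have li := tame_loc ti.
have [mr _] := tr; have [mi _] := ti.
have Hr x : (0 <= HL (re f) x)%E by exact: HL_maximalT_ge0.
have Hi x : (0 <= HL (im f) x)%E by exact: HL_maximalT_ge0.
have mHp u : locally_integrable setT u -> measurable_fun setT (fun x => HL u x `^ p)%E.
  by move=> lu; apply: (measurableT_comp (measurable_poweR _)); exact: measurable_HL_maximal.
have mAp u : measurable_fun setT u -> measurable_fun setT (fun x => area2 setT u x `^ (p / 2))%E.
  by move=> mu_; apply: (measurableT_comp (measurable_poweR _)); exact: mf_area2.
have pt x : (area_g q f x `^ p <= k1%:E * (HL (re f) x `^ p + HL (im f) x `^ p) +
    k2%:E * (area2 setT (re f) x `^ (p / 2) + area2 setT (im f) x `^ (p / 2)))%E.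
  have t1 : (0 <= k1%:E * (HL (re f) x `^ p + HL (im f) x `^ p))%E.
    by rewrite mule_ge0 ?adde_ge0 ?poweR_ge0// lee_fin ltW.
  have t2 : (0 <= k2%:E * (area2 setT (re f) x `^ (p / 2) + area2 setT (im f) x `^ (p / 2)))%E.
    by rewrite mule_ge0 ?adde_ge0 ?poweR_ge0// lee_fin ltW.
  case: (area_g_le x q2 tr ti) => h.
    apply: le_trans (leeDl _ t2).
    apply: (le_trans (le_poweR (ltW p0) (area_g_ge0 q f x) h)).
    rewrite /cmaximal poweRM ?adde_ge0 ?lee_fin ?(ltW F0)// poweR_EFin /k1 EFinM -muleA.
    by apply: lee_wpmul2l; [rewrite lee_fin powR_ge0|exact: poweRD_le].
  apply: le_trans (leeDr _ t1).
  apply: (le_trans (le_poweR (ltW p0) (area_g_ge0 q f x) h)).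
  rewrite -poweRrM [2^-1 * p]mulrC; apply: poweRD_le => //; exact: area2_ge0.
have IH u : locally_integrable setT u -> (forall z, `|u z| <= cmod (f z)) ->
    (\int[mu]_x HL u x `^ p <= CH%:E * cpow p f)%E.
  move=> lu uf; apply: (le_trans (strongH u lu)); apply: lee_wpmul2l.
    by rewrite lee_fin ltW.
  exact: int_pow_le.
have IA u : tame u -> (forall z, `|u z| <= cmod (f z)) ->
    (\int[mu]_x area2 setT u x `^ (p / 2) <= (CA * CH)%:E * cpow p f)%E.
  move=> tu uf; apply: (le_trans (strongA u tu)); rewrite EFinM -muleA.
  apply: lee_wpmul2l; first by rewrite lee_fin ltW.
  rewrite (_ : 2 * (p / 2) = p); last by field.
  by apply: IH => //; exact: tame_loc.
apply: (@le_trans _ _ (\int[mu]_x (k1%:E * (HL (re f) x `^ p + HL (im f) x `^ p) +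
    k2%:E * (area2 setT (re f) x `^ (p / 2) + area2 setT (im f) x `^ (p / 2))))%E).
  by apply: le_int0 => x _; [exact: poweR_ge0|exact: pt].
have mS1 : measurable_fun setT (fun x => HL (re f) x `^ p + HL (im f) x `^ p)%E.
  by apply: emeasurable_funD; exact: mHp.
have mS2 : measurable_fun setT (fun x => area2 setT (re f) x `^ (p / 2) + area2 setT (im f) x `^ (p / 2))%E.
  by apply: emeasurable_funD; exact: mAp.
have c0 := cpow_ge0 p f.
rewrite ge0_integralD//; last 4 first.
- by move=> x _; rewrite mule_ge0 ?adde_ge0 ?poweR_ge0// lee_fin ltW.
- by apply: emeasurable_funM => //; exact: measurable_cst.
- by move=> x _; rewrite mule_ge0 ?adde_ge0 ?poweR_ge0// lee_fin ltW.
- by apply: emeasurable_funM => //; exact: measurable_cst.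
rewrite EFinD ge0_muleDl ?lee_fin; last 2 first.
- by rewrite mulr_ge0 ?addr_ge0 ?(ltW k10) ?(ltW CH0).
- by rewrite mulr_ge0 ?addr_ge0 ?mulr_ge0 ?(ltW k20) ?(ltW CH0) ?(ltW CA0).
apply: leeD.
- rewrite ge0_integralZl_EFin ?(ltW k10)//; last by move=> x _; rewrite adde_ge0 ?poweR_ge0.
  rewrite [(k1 * _)%:E]EFinM -muleA; apply: lee_wpmul2l; first by rewrite lee_fin ltW.
  rewrite ge0_integralD//; last 4 first.
  + by move=> x _; exact: poweR_ge0.
  + exact: mHp.
  + by move=> x _; exact: poweR_ge0.
  + exact: mHp.
  rewrite EFinD ge0_muleDl ?lee_fin ?(ltW CH0)//.
  by apply: leeD; apply: IH => //; [exact: re_le_cmod|exact: im_le_cmod].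
- rewrite ge0_integralZl_EFin ?(ltW k20)//; last by move=> x _; rewrite adde_ge0 ?poweR_ge0.
  rewrite [(k2 * _)%:E]EFinM -muleA; apply: lee_wpmul2l; first by rewrite lee_fin ltW.
  rewrite ge0_integralD//; last 4 first.
  + by move=> x _; exact: poweR_ge0.
  + exact: mAp.
  + by move=> x _; exact: poweR_ge0.
  + exact: mAp.
  rewrite EFinD ge0_muleDl ?lee_fin ?mulr_ge0 ?(ltW CH0) ?(ltW CA0)//.
  by apply: leeD; apply: IA => //; [exact: re_le_cmod|exact: im_le_cmod].
Qed.

Lemma area_weak q : 2 <= q -> exists2 C : R, 0 < C & forall f (l : R), inLp 1 f -> 0 < l ->
  (l%:E * mu [set x | (l%:E < area_g q f x)%E] <= C%:E * cLnorm 1 f)%E.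
Proof.
move=> q2; have F0 : 0 < sdheat_cst :> R by exact: sdheat_cst_gt0.
have W0 : 0 < weak_cst :> R by exact: weak_cst_gt0.
exists (12 * sdheat_cst + 4 * weak_cst); first by rewrite addr_gt0// mulr_gt0.
move=> f l f1 l0; have tr := tame_re (lexx 1) f1; have ti := tame_im (lexx 1) f1.
have lr := tame_loc tr; have li := tame_loc ti.
have [mr _] := tr; have [mi _] := ti.
set nf := cLnorm 1 f.
have nfE : nf = (\int[mu]_z (cmod (f z))%:E)%E.
  by rewrite /nf /cLnorm Lnorm1; apply: eq_integral => z _; rewrite gee0_abs ?lee_fin ?cmod_ge0.
have nf0 : (0 <= nf)%E by exact: cLnorm_ge0.
have n1 u : (forall z, `|u z| <= cmod (f z)) -> (\int[mu]_z `|u z|%:E <= nf)%E.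
  by move=> uf; rewrite nfE; apply: le_int0 => z _; rewrite lee_fin.
have j1 u : measurable_fun setT u -> (forall z, `|u z| <= cmod (f z)) ->
    mu.-integrable setT (EFin \o u).
  move=> mu_ uf; apply/integrableP; split; first exact/measurable_EFinP.
  by apply: (le_lt_trans (n1 u uf)); case: f1.
pose cH := l / (2 * sdheat_cst).
have cH0 : 0 < cH by rewrite divr_gt0// mulr_gt0.
pose SH u := [set x | (cH%:E < HL u x)%E].
pose SA u := [set x | (((l / 2) ^+ 2)%:E < area2 setT u x)%E].
have l20 : 0 < l / 2 by rewrite divr_gt0.
have mSH u : locally_integrable setT u -> measurable (SH u).
  by move=> lu; apply: measurable_superlevel; exact: measurable_HL_maximal.
have mSA u : measurable_fun setT u -> measurable (SA u).
  by move=> mu_; apply: measurable_superlevel; exact: mf_area2.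
have muSH u : locally_integrable setT u -> (forall z, `|u z| <= cmod (f z)) ->
    (mu (SH u) <= (6 * sdheat_cst / l)%:E * nf)%E.
  move=> lu uf; apply: (le_trans (maximal_inequality lu cH0)).
  rewrite (_ : 3 / cH = 6 * sdheat_cst / l); last first.
    by rewrite /cH; move: sdheat_cst F0 => k k0; field; rewrite !gt_eqF.
  apply: lee_wpmul2l; last exact: n1.
  by rewrite lee_fin divr_ge0 ?mulr_ge0 ?(ltW F0) ?(ltW l0).
have muSA u : measurable_fun setT u -> (forall z, `|u z| <= cmod (f z)) ->
    (mu (SA u) <= (2 * weak_cst / l)%:E * nf)%E.
  move=> mu_ uf; apply: (le_trans (area2_weak (j1 u mu_ uf) l20)).
  rewrite (_ : weak_cst / (l / 2) = 2 * weak_cst / l); last first.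
    by move: weak_cst => k; field; rewrite gt_eqF.
  apply: lee_wpmul2l; last exact: n1.
  by rewrite lee_fin divr_ge0 ?mulr_ge0 ?(ltW W0) ?(ltW l0).
pose S := (SH (re f) `|` SH (im f)) `|` (SA (re f) `|` SA (im f)).
have sub : [set x | (l%:E < area_g q f x)%E] `<=` S.
  move=> x /= lg; apply: contrapT => /not_orP[/not_orP[h1 h2] /not_orP[h3 h4]].
  move: h1 h2 h3 h4 => /negP + /negP + /negP + /negP; rewrite -!leNgt => h1 h2 h3 h4.
  move: lg; rewrite ltNge => /negP; apply.
  case: (area_g_le x q2 tr ti) => /le_trans; apply.
    apply: (@le_trans _ _ (sdheat_cst%:E * (cH%:E + cH%:E))%E).
      by apply: lee_wpmul2l; [rewrite lee_fin ltW|exact: leeD].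
    rewrite -EFinD -EFinM lee_fin le_eqVlt; apply/orP; left; apply/eqP.
    by rewrite /cH; move: sdheat_cst F0 => k k0; field; rewrite !gt_eqF.
  rewrite -(@poweRK _ 2 l%:E) ?lee_fin ?(ltW l0)//.
  apply: le_poweR; [by rewrite invr_ge0|by apply: adde_ge0; exact: area2_ge0|].
  apply: (le_trans (leeD h3 h4)); rewrite -EFinD poweR_EFin lee_fin powR_mulrn ?(ltW l0)//.
  by have := sqr_ge0 l; rewrite !exprMn exprVn; lra.
have mS : measurable S.
  by apply: measurableU; apply: measurableU; [exact: mSH|exact: mSH|exact: mSA|exact: mSA].
have mg : measurable [set x | (l%:E < area_g q f x)%E].
  by apply: measurable_superlevel; exact: mf_area_g.
have muS : (mu [set x | (l%:E < area_g q f x)%E] <= ((12 * sdheat_cst + 4 * weak_cst) / l)%:E * nf)%E.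
  apply: (@le_trans _ _ (mu S)); first by apply: le_measure; rewrite ?inE.
  apply: (le_trans (measureU2 _ _ _)); [by apply: measurableU; exact: mSH|by apply: measurableU; exact: mSA|].
  have U2 (X Y : set (measurableTypeR R)) : measurable X -> measurable Y ->
    (mu (X `|` Y) <= mu X + mu Y)%E by move=> mX mY; exact: measureU2.
  apply: (le_trans (leeD (U2 _ _ (mSH _ lr) (mSH _ li)) (U2 _ _ (mSA _ mr) (mSA _ mi)))).
  have b1 := muSH _ lr (re_le_cmod f); have b2 := muSH _ li (im_le_cmod f).
  have b3 := muSA _ mr (re_le_cmod f); have b4 := muSA _ mi (im_le_cmod f).
  apply: (le_trans (leeD (leeD b1 b2) (leeD b3 b4))).
  have p1 : 0 <= 6 * sdheat_cst / l by rewrite divr_ge0 ?mulr_ge0 ?(ltW F0) ?(ltW l0).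
  have p2 : 0 <= 2 * weak_cst / l by rewrite divr_ge0 ?mulr_ge0 ?(ltW W0) ?(ltW l0).
  rewrite -!ge0_muleDl ?lee_fin ?addr_ge0// -!EFinD; apply: lee_wpmul2r => //.
  rewrite lee_fin le_eqVlt; apply/orP; left; apply/eqP.
  by move: weak_cst sdheat_cst => w k; ring.
apply: (@le_trans _ _ (l%:E * (((12 * sdheat_cst + 4 * weak_cst) / l)%:E * nf))%E).
  by apply: lee_wpmul2l => //; rewrite lee_fin ltW.
rewrite muleA -EFinM mulrCA divff ?gt_eqF// mulr1; exact: lexx.
Qed.

End norms.

Theorem proposition1p2 (R : realType) (q : R) (hq : 2 <= q) :
  (forall p : R, 1 < p ->
     exists2 C : R, 0 < C &
       forall f : R -> R[i], inLp p f ->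
         measurable_fun setT (area_g q f) /\
         (Lnorm (@lebesgue_measure R) p%:E (area_g q f) <= C%:E * cLnorm p f)%E) /\
  (exists2 C : R, 0 < C &
     forall f : R -> R[i], inLp 1 f ->
       measurable_fun setT (area_g q f) /\
       (weakL1norm (area_g q f) <= C%:E * cLnorm 1 f)%E).
Proof.
split=> [p p1|].
  have p0 : 0 < p by exact: lt_trans p1.
  have [K K0 HK] := area_strong hq p1.
  exists (K `^ p^-1); first by rewrite powR_gt0.
  move=> f fp; split.
    by apply: mf_area_g; [exact: tame_re (ltW p1) fp|exact: tame_im (ltW p1) fp].
  have c0 := cLnorm_ge0 p f.
  apply: (@poweR_le _ p) => //; first exact: Lnorm_ge0.
    by rewrite mule_ge0// lee_fin powR_ge0.
  rewrite poweRM ?lee_fin ?powR_ge0// poweR_EFin -powRrM mulVf ?gt_eqF// powRr1 ?(ltW K0)//.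
  rewrite cpowE// powR_Lnorm ?gt_eqF//; apply: le_trans (HK f fp).
  apply: le_int0 => x _; first exact: poweR_ge0.
  by rewrite gee0_abs ?area_g_ge0.
have [C C0 HC] := area_weak hq; exists C => // f f1; split.
  by apply: mf_area_g; [exact: tame_re (lexx 1) f1|exact: tame_im (lexx 1) f1].
apply: ge_ereal_sup => _ [l /= l0 <-].
rewrite (_ : [set x | _] = [set x | (l%:E < area_g q f x)%E]); first exact: HC.
by apply/seteqP; split => x /=; rewrite gee0_abs ?area_g_ge0.
Qed.
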